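(* Fix an integer $r \ge 2$ and parameters $\theta = (\mu,\sigma,\xi)$ with $\mu\in\mathbb{R}$, $\sigma>0$, $\xi\in\mathbb{R}$. Let $(Y_{i1},\ldots,Y_{ir})$, $i=1,\ldots,n$, be independent and identically distributed random vectors, each following the GEV$_r(\mu,\sigma,\xi)$ distribution. Define $z_{ij} = (Y_{ij}-\mu)/\sigma$ and $$D_{ir}(\theta) = -\log\sigma - (1+\xi z_{ir})^{-1/\xi} + (1+\xi z_{i,r-1})^{-1/\xi} - \Big(\frac{1}{\xi}+1\Big)\log(1+\xi z_{ir})$$ (for $\xi=0$ interpreted as the limit $\xi\to 0$, i.e. $D_{ir} = -\log\sigma - e^{-z_{ir}} + e^{-z_{i,r-1}} - z_{ir}$). Let $\bar D_r = n^{-1}\sum_{i=1}^n D_{ir}$, $S_{D_r}^2 = \sum_{i=1}^n (D_{ir}-\bar D_r)^2/(n-1)$, $\eta_r = -\log\sigma - 1 + (1+\xi)\psi(r)$, where $\psi$ is the digamma function, and $$T_n^{(r)}(\theta) = \sqrt{n}\,(\bar D_r - \eta_r)/S_{D_r}.$$ Then $T_n^{(r)}(\theta)$ converges in distribution to $N(0,1)$ as $n\to\infty$.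
   Context: The GEV$_r(\mu,\sigma,\xi)$ distribution (limiting joint distribution of the $r$ largest order statistics) is the distribution on $\{y_1>y_2>\cdots>y_r\}$ with density $$f_r(y_1,\ldots,y_r\mid\mu,\sigma,\xi) = \sigma^{-r}\exp\Big\{-(1+\xi z_r)^{-1/\xi} - \Big(\frac1\xi+1\Big)\sum_{j=1}^r \log(1+\xi z_j)\Big\},$$ where $z_j=(y_j-\mu)/\sigma$, supported where $1+\xi z_j>0$ for all $j$; for $\xi=0$ the density is the limit as $\xi\to0$, namely $\sigma^{-r}\exp\{-e^{-z_r} - \sum_{j=1}^r z_j\}$. The quantity $D_{ir}$ is the difference $l^{(r)}-l^{(r-1)}$ of the log-densities of the GEV$_r$ and GEV$_{r-1}$ models evaluated at the $r$ and $r-1$ top components of block $i$. *)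

(* Defs.v *)
From HB Require Import structures.
From mathcomp Require Import all_boot all_order all_algebra.
From mathcomp Require Import all_classical all_reals all_analysis.
Set Implicit Arguments.
Unset Strict Implicit.
Unset Printing Implicit Defensive.
Import Order.TTheory GRing.Theory Num.Theory Num.Def.
Import numFieldNormedType.Exports.
Local Open Scope classical_set_scope.
Local Open Scope ring_scope.

Section gev_defs.
Context {R : realType}.

Definition Gamma (x : R) : R :=
  fine (\int[@lebesgue_measure R]_(t in `]0%R, +oo[) ((t `^ (x - 1)) * expR (- t))%:E)%E.

Definition digamma (x : R) : R := derive1 (fun t => ln (Gamma t)) x.

Definition gev_z (mu sigma y : R) : R := (y - mu) / sigma.

(** Points y = (y_1,...,y_r), stored as a sequence with y_j = nth 0 y (j-1).
    Support of GEV_r : y_1 > y_2 > ... > y_r and 1 + xi z_j > 0 for all j. *)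
Definition gevr_support (r : nat) (mu sigma xi : R) (y : seq R) : Prop :=
  size y = r /\
  (forall j : nat, (j.+1 < r)%N -> nth 0 y j.+1 < nth 0 y j) /\
  (forall j : nat, (j < r)%N -> 0 < 1 + xi * gev_z mu sigma (nth 0 y j)).

Definition gevr_pdf (r : nat) (mu sigma xi : R) (y : seq R) : R :=
  let z j := gev_z mu sigma (nth 0 y j) in
  if `[< gevr_support r mu sigma xi y >] then
    if xi == 0 then
      sigma ^- r * expR (- expR (- z r.-1) - \sum_(j < r) z j)
    else
      sigma ^- r * expR (- ((1 + xi * z r.-1) `^ (- xi^-1))
                         - (xi^-1 + 1) * \sum_(j < r) ln (1 + xi * z j))
  else 0.

(** Iterated Lebesgue integral over R^k (coordinates are the entries of a
    sequence of length k); for nonnegative integrands this is the integral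
    against k-dimensional Lebesgue measure (Tonelli). *)
Fixpoint iter_lebesgue (k : nat) (f : seq R -> \bar R) : \bar R :=
  match k with
  | 0 => f [::]
  | k.+1 => (\int[@lebesgue_measure R]_x iter_lebesgue k (fun s => f (x :: s)))%E
  end.

Definition rect_event d (T : measurableType d) (r : nat) (Yi : nat -> T -> R)
  (B : nat -> set R) : set T :=
  [set w | forall j, (j < r)%N -> B j (Yi j w)].

(** The random vector (Yi 0, ..., Yi (r-1)) has the GEV_r(mu,sigma,xi) law:
    its law agrees with the density on all measurable rectangles (which
    generate the Borel sigma-algebra of R^r). *)
Definition is_gevr d (T : measurableType d) (P : probability T R) (r : nat)
  (mu sigma xi : R) (Yi : nat -> T -> R) : Prop :=
  forall B : nat -> set R, (forall j, measurable (B j)) ->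
    P (rect_event r Yi B) =
    iter_lebesgue r (fun s =>
      (gevr_pdf r mu sigma xi s * \1_[set s : seq R | forall j, (j < r)%N -> B j (nth 0 s j)] s)%:E).

(** Mutual independence of the random vectors (Y i)_{i : nat}
    (product rule over every finite family of distinct indices, on the
    generating pi-system of rectangle events). *)
Definition independent_vectors d (T : measurableType d) (P : probability T R)
  (r : nat) (Y : nat -> nat -> T -> R) : Prop :=
  forall (F : seq nat) (B : nat -> nat -> set R), uniq F ->
    (forall i j, measurable (B i j)) ->
    P (\bigcap_(i in [set` F]) rect_event r (Y i) (B i)) =
    (\prod_(i <- F) P (rect_event r (Y i) (B i)))%E.

Definition D_stat (mu sigma xi y_r y_prev : R) : R :=
  let zr := gev_z mu sigma y_r in
  let zp := gev_z mu sigma y_prev in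
  if xi == 0 then - ln sigma - expR (- zr) + expR (- zp) - zr
  else - ln sigma - (1 + xi * zr) `^ (- xi^-1) + (1 + xi * zp) `^ (- xi^-1)
       - (xi^-1 + 1) * ln (1 + xi * zr).

Definition eta_r (r : nat) (sigma xi : R) : R :=
  - ln sigma - 1 + (1 + xi) * digamma r%:R.

(** T_n^{(r)}(theta), using blocks i = 0, ..., n-1 (Y i j is Y_{i+1, j+1}). *)
Definition T_stat d (T : measurableType d) (r : nat) (mu sigma xi : R)
  (Y : nat -> nat -> T -> R) (n : nat) (w : T) : R :=
  let D i := D_stat mu sigma xi (Y i r.-1 w) (Y i r.-2 w) in
  let Dbar := n%:R^-1 * \sum_(i < n) D i in
  let S2 := (\sum_(i < n) (D i - Dbar) ^+ 2) / (n%:R - 1) in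
  Num.sqrt n%:R * (Dbar - eta_r r sigma xi) / Num.sqrt S2.

(** Convergence in distribution of X n to the law mu (a probability on R):
    convergence of the cdfs at every continuity point of the limit cdf. *)
Definition cvg_in_distribution d (T : measurableType d) (P : probability T R)
  (X : nat -> T -> R) (mu : set R -> \bar R) : Prop :=
  forall x : R, mu [set x] = 0%E ->
    (fun n => P [set w | X n w <= x]) @ \oo --> mu [set y : R | y <= x].

End gev_defs.

(* Main.v *)
(** The map y |-> (1 + xi z)^(-1/xi) (e^(-z) for xi = 0) turns a GEV_r vector into
    the first r arrival times of a unit-rate Poisson process.  If u < t are the last
    two of them, D = - ln sigma - t + u + (1 + xi) ln t.  Here t - u has mean 1 and t
    is Gamma(r), so E D = eta_r since E ln t = digamma r; D has a fourth moment
    because |ln t|^4 is dominated by a multiple of t + 1/t, with E (1/t) finite for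
    r >= 2; and D is not almost surely constant, since D is strictly increasing in u
    for fixed t.  The D_i are thus i.i.d. with mean eta_r and positive variance.

    The central limit theorem comes from Lindeberg's replacement in Trotter's operator
    form: X |-> E f(x + X) and its Gaussian analogue differ by O(n^(-3/2)) on a
    rescaled smooth step f, and these operators commute, so n replacements cost
    O(n^(-1/2)).  The sample variance converges in probability by Chebyshev's
    inequality applied to X^2 - 1, and monotonicity of the distribution functions
    gives the studentized limit. *)
Require Import Defs.
From HB Require Import structures.
From mathcomp Require Import all_boot all_order all_algebra.
From mathcomp Require Import all_classical all_reals all_analysis.
From mathcomp Require Import measurable_realfun ring lra.
Set Implicit Arguments.
Unset Strict Implicit.
Unset Printing Implicit Defensive.
Import Order.TTheory GRing.Theory Num.Theory Num.Def.
Import numFieldNormedType.Exports.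
Local Open Scope classical_set_scope.
Local Open Scope ring_scope.

Local Notation image_measure :=
  measure_function_pushforward__canonical__measure_function_Measure.

(** * Measures on products and measures with a density *)

(** The hypotheses give product rules on rectangles and an iterated Lebesgue integral only. Since
    [D] depends jointly on the last two coordinates, independence and the density must first be
    carried from rectangles to all measurable sets of pairs. The operators act on nonnegative
    extended-real functions, so every exchange of integrals is Tonelli's and needs no integrability;
    moments enter only in the one-step comparison. The smooth step is a piecewise cubic because its
    second-order Taylor remainder can be bounded by plain algebra. The Gaussian side closes because
    convolving two centred normal densities is an algebraic identity. Arrival times turn y_1 > ... >
    y_r into 0 < u_1 < ... < u_r and the density into exp(- u_r). Integrating out coordinates then
    means iterating a single operator, which fixes exp(- u). The fourth moment is used because the
    weak law for X^2 - 1 rests on the second moment of that variable. *)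

Definition density_measure d (T : measurableType d) (R : realType)
  (mu : {measure set T -> \bar R}) (w : T -> R)
  (mw : measurable_fun setT w) (w0 : forall x, 0 <= w x) (A : set T) : \bar R :=
  (\int[mu]_(x in A) (w x)%:E)%E.

Section density_measure.
Local Open Scope ereal_scope.
Context d (T : measurableType d) (R : realType) (mu : {measure set T -> \bar R}).
Variables (w : T -> R) (mw : measurable_fun setT w).
Variable w0 : forall x, (0 <= w x)%R.
Local Notation nu := (density_measure mu mw w0).

Let nu0 : nu set0 = 0.
Proof. by rewrite /density_measure integral_set0. Qed.

Let nu_ge0 A : 0 <= nu A.
Proof. by rewrite /density_measure integral_ge0//= => x _; rewrite lee_fin. Qed.

Let nu_sigma_additive : semi_sigma_additive nu.
Proof.
move=> /= A mA tA mUA.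
rewrite /density_measure/= ge0_integral_bigcup//=.
- apply: is_cvg_ereal_nneg_natsum_cond => n _ _.
  by apply: integral_ge0 => /= x ?; rewrite lee_fin.
- by apply/measurable_EFinP; exact: measurable_funTS.
- by move=> x _; rewrite lee_fin.
Qed.

HB.instance Definition _ := isMeasure.Build _ _ _
  nu nu0 nu_ge0 nu_sigma_additive.

Import HBNNSimple.

(** Monotone convergence along the simple approximations [h n] on both sides reduces the claim to
    one simple function, and additivity over its finite range reduces it to an indicator, where it
    is the definition of [density_measure]. *)
Lemma ge0_integral_density_measure (f : T -> \bar R) :
  measurable_fun setT f -> (forall x, 0 <= f x) ->
  \int[nu]_x f x = \int[mu]_x (f x * (w x)%:E).
Proof.
move=> mf f0; pose h := nnsfun_approx measurableT mf.
have mwE : measurable_fun setT (EFin \o w) by exact/measurable_EFinP.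
have -> : \int[nu]_x f x = limn (fun n => \int[nu]_x (h n x)%:E).
  rewrite -monotone_convergence//.
  - by apply: eq_integral => x _; apply/esym/cvg_lim => //; exact: cvg_nnsfun_approx.
  - by move=> n; exact/measurable_EFinP.
  - by move=> n x _; rewrite lee_fin.
  - by move=> x _ a b ab; rewrite lee_fin; exact/lefP/nd_nnsfun_approx.
have -> : \int[mu]_x (f x * (w x)%:E) =
    limn (fun n => \int[mu]_x ((h n x)%:E * (w x)%:E)).
  rewrite -monotone_convergence//.
  - apply: eq_integral => x _; apply/esym/cvg_lim => //.
    by apply: cvgeZr => //; exact: cvg_nnsfun_approx.
  - by move=> n; apply: emeasurable_funM => //; exact/measurable_EFinP.
  - by move=> n x _; rewrite mule_ge0// lee_fin.
  - move=> x _ a b ab; rewrite lee_wpmul2r ?lee_fin//; exact/lefP/nd_nnsfun_approx.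
congr (limn _); apply/funext => n.
have mh r : measurable (h n @^-1` [set r]) by [].
have mhr r : measurable_fun [set: T] (fun x => (r * \1_(h n @^-1` [set r]) x)%:E).
  by apply/measurable_EFinP; exact: measurable_funM.
transitivity (\int[nu]_x
   (\sum_(y \in range (h n)) (y * \1_(h n @^-1` [set y]) x)%:E)).
  by apply: eq_integral => t _; rewrite fimfunE -fsumEFin.
rewrite ge0_integral_fsum//; last by move=> y x _; exact: nnfun_muleindic_ge0.
transitivity (\int[mu]_x (\sum_(y \in range (h n))
    (y * \1_(h n @^-1` [set y]) x)%:E * (w x)%:E)); last first.
  apply: eq_integral => x _.
  rewrite -ge0_mule_fsuml => [|y]; last exact: nnfun_muleindic_ge0.
  by rewrite fsumEFin // -(fimfunE _ x).
rewrite ge0_integral_fsum//; last 2 first.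
  - by move=> y; exact: emeasurable_funM.
  - by move=> m y _; apply: mule_ge0; [exact: nnfun_muleindic_ge0|rewrite lee_fin].
apply: eq_fsbigr => r rhn.
under eq_integral do rewrite EFinM.
rewrite integralZl_indic_nnsfun //.
under [RHS]eq_integral do rewrite EFinM -muleA.
rewrite ge0_integralZl//.
- congr (_ * _); rewrite integral_indic// setIT /density_measure.
  rewrite [LHS]integral_mkcond; apply: eq_integral => x _.
  by rewrite epatch_indic muleC.
- by apply: emeasurable_funM => //; exact/measurable_EFinP.
- by move=> t _; rewrite mule_ge0 ?lee_fin.
- by move: rhn; rewrite inE => -[t _ <-]; rewrite lee_fin.
Qed.

End density_measure.

(** Rectangles form a generating pi-system that contains [setT]; as [m1] is finite, the constant
    sequence [setT] serves as the exhausting cover. *)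
Lemma finite_measure_prod_unique d1 d2 (T1 : measurableType d1)
    (T2 : measurableType d2) (R : realType)
    (m1 m2 : {measure set (T1 * T2)%type -> \bar R}) :
  (m1 setT < +oo)%E ->
  (forall A B, measurable A -> measurable B -> m1 (A `*` B) = m2 (A `*` B)) ->
  forall X, measurable X -> m1 X = m2 X.
Proof.
move=> fm m12 X mX.
pose C : set (set (T1 * T2)) :=
  [set C | exists A, measurable A /\ exists B, measurable B /\ C = A `*` B].
have CI : setI_closed C.
  move=> /= _ _ [X1 [mX1 [X2 [mX2 ->]]]] [Y1 [mY1 [Y2 [mY2 ->]]]].
  rewrite -setXI; exists (X1 `&` Y1); split; first exact: measurableI.
  by exists (X2 `&` Y2); split => //; exact: measurableI.
apply: (measure_unique C (fun=> setT)) => //.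
- rewrite measurable_prod_measurableType //; congr (<<s _ >>).
  rewrite predeqE; split => [[A mA [B mB <-]]|[A [mA [B [mB ->]]]]].
    by exists A; split => //; exists B.
  by exists A => //; exists B.
- by move=> n; exists setT; split => //; exists setT; split => //; rewrite setXTT.
- by rewrite bigcup_const.
- by move=> A [A1 [mA1 [A2 [mA2 ->]]]]; exact: m12.
Qed.

(** * Affine change of variable for Lebesgue measure *)

Section affine_change.
Local Open Scope ereal_scope.
Context (R : realType).
Local Notation lam := (@lebesgue_measure R).

Lemma measurable_affine (a b : R) :
  measurable_fun setT (fun x : R => a * x + b)%R.
Proof. by apply: measurable_funD => //; exact: measurable_funM. Qed.

(** Pushing the measure with constant density [a] forward along x |-> a x + b gives mass v - u to
    []u, v]], so the result is Lebesgue measure by uniqueness. *)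
Lemma ge0_integral_affine (a b : R) (f : R -> \bar R) : (0 < a)%R ->
  measurable_fun setT f -> (forall x, 0 <= f x) ->
  \int[lam]_x f x = \int[lam]_x (f (a * x + b)%R * a%:E).
Proof.
move=> a0 mf f0.
have ma := measurable_affine a b.
have mca : measurable_fun setT (cst a : measurableTypeR R -> R) by [].
have ca0 : forall x : measurableTypeR R, (0 <= cst a x)%R by move=> x; exact: ltW.
transitivity (\int[pushforward (density_measure lam mca ca0)
    (fun x : measurableTypeR R => a * x + b : measurableTypeR R)%R]_x f x).
  apply: eq_measure_integral => //= A mA _.
  apply: lebesgue_measure_unique => //= _ [[u v]] _ <-.
  rewrite /pushforward /density_measure/=.
  have -> : (fun x : R => a * x + b)%R @^-1` `]u, v]%classic =
      `](u - b) / a, (v - b) / a]%classic%R.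
    apply/seteqP; split => x /=; rewrite !in_itv/= ltr_pdivrMr// ler_pdivlMr//;
      rewrite ltrBlDr lerBrDr (mulrC x)//.
  rewrite integral_cst//= !lebesgue_measure_itv/= !lte_fin.
  rewrite ltr_pM2r ?invr_gt0// ltrD2r; case: ifPn => uv; last by rewrite mule0.
  rewrite -!EFinB -EFinM -mulrBl mulrCA divff ?gt_eqF// mulr1; congr EFin.
  by rewrite opprB addrA subrK.
rewrite ge0_integral_pushforward// preimage_setT.
rewrite ge0_integral_density_measure//.
exact: measurableT_comp.
by move=> x /=; exact: f0.
Qed.

End affine_change.

(** * Independence of pairs *)

Section independence.
Local Open Scope ereal_scope.
Context d (T : measurableType d) (R : realType) (P : probability T R).

Lemma measurable_cylinder d' (T' : measurableType d') (s : seq nat)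
    (X : nat -> T -> T') (C : nat -> set T') :
  (forall i, measurable_fun setT (X i)) -> (forall i, measurable (C i)) ->
  measurable [set w | forall i, i \in s -> C i (X i w)].
Proof.
move=> mX mC; rewrite [X in measurable X](_ : _ =
    \bigcap_(i in [set` s]) (X i @^-1` C i)); last first.
  by apply/seteqP; split => w /= h i => [|] /h.
apply: fin_bigcap_measurable => // i _.
by rewrite -[X in measurable X]setTI; exact: mX.
Qed.

(** Both sides are finite measures in [X]: the law of [Z] under [P] restricted to [E], and the law
    of [Z] scaled by [P E]. *)
Lemma indep_prod_ext d1 d2 (T1 : measurableType d1) (T2 : measurableType d2)
    (Z : T -> T1 * T2) (E : set T) :
  measurable_fun setT Z -> measurable E ->
  (forall A B, measurable A -> measurable B ->
     P (Z @^-1` (A `*` B) `&` E) = P (Z @^-1` (A `*` B)) * P E) ->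
  forall X, measurable X -> P (Z @^-1` X `&` E) = P (Z @^-1` X) * P E.
Proof.
move=> mZ mE ZE X mX.
have PE0 : (0 <= fine (P E))%R by rewrite fine_ge0.
pose m1 : {measure set (T1 * T2)%type -> \bar R} :=
  image_measure (mrestr P mE) mZ.
pose m2 : {measure set (T1 * T2)%type -> \bar R} :=
  mscale (NngNum PE0) (image_measure P mZ).
have PEE : (fine (P E))%:E = P E.
  by rewrite fineK// fin_num_measure.
have H : m1 X = m2 X.
  apply: finite_measure_prod_unique => //.
    rewrite /m1/= /pushforward /mrestr preimage_setT setTI.
    by rewrite (le_lt_trans (probability_le1 _ _))// ltry.
  move=> A B mA mB.
  by rewrite /m1 /m2/= /pushforward /mrestr /mscale/= PEE ZE// muleC.
by move: H; rewrite /m1 /m2/= /pushforward /mrestr /mscale/= PEE muleC.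
Qed.

(** The product rule passes from rectangles to arbitrary measurable sets one index at a time. *)
Lemma indep_pairs d1 d2 (T1 : measurableType d1) (T2 : measurableType d2)
    (W : nat -> T -> T1 * T2) :
  (forall i, measurable_fun setT (W i)) ->
  (forall s A B, uniq s -> (forall i, measurable (A i)) ->
     (forall i, measurable (B i)) ->
     P [set w | forall i, i \in s -> (A i `*` B i) (W i w)] =
     \prod_(i <- s) P (W i @^-1` (A i `*` B i))) ->
  forall s C, uniq s -> (forall i, measurable (C i)) ->
     P [set w | forall i, i \in s -> C i (W i w)] =
     \prod_(i <- s) P (W i @^-1` C i).
Proof.
move=> mW rW s C us mC.
(* Indices in [s1] carry arbitrary sets, those in [s2] still carry rectangles; the induction on [s1]
   starts from the hypothesis [rW]. *)
suff gen s1 s2 C' : uniq (s1 ++ s2) -> (forall i, measurable (C' i)) ->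
    (forall i, i \in s2 -> exists A B,
      [/\ measurable A, measurable B & C' i = A `*` B]) ->
    P [set w | forall i, i \in s1 ++ s2 -> C' i (W i w)] =
     \prod_(i <- s1 ++ s2) P (W i @^-1` C' i).
  by have := gen s [::] C; rewrite cats0; apply.
elim: s1 s2 C' => [|i s1 IH] s2 C'.
  move=> /= us2 mC' rC.
  have /choice[AB hAB] : forall i, exists AB : set T1 * set T2,
      [/\ measurable AB.1, measurable AB.2 & i \in s2 -> C' i = AB.1 `*` AB.2].
    move=> i; have [/rC[A [B [mA mB e]]]|p] := boolP (i \in s2).
      by exists (A, B); split.
    by exists (setT, setT); split => //=; rewrite (negbTE p).
  rewrite (_ : [set w | _] = [set w | forall i, i \in s2 ->
      ((AB i).1 `*` (AB i).2) (W i w)]); last first.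
    apply/seteqP; split => w /= h i is2; have := h i is2;
      by have [_ _ ->] := hAB i.
  rewrite rW//; last 2 first.
    by move=> i; have [] := hAB i.
    by move=> i; have [] := hAB i.
  by apply: eq_big_seq => i is2; have [_ _ ->] := hAB i.
move=> us12 mC' rC.
rewrite /= big_cons.
have /andP[nis us'] : (i \notin s1 ++ s2) && uniq (s1 ++ s2) by [].
pose E := [set w | forall j, j \in s1 ++ s2 -> C' j (W j w)].
have mE : measurable E by exact: measurable_cylinder.
rewrite (_ : [set w | _] = W i @^-1` C' i `&` E); last first.
  apply/seteqP; split => w /=.
    move=> h; split; first by apply: h; rewrite inE eqxx.
    by move=> j js; apply: h; rewrite inE js orbT.
  by move=> [h1 h2] j; rewrite inE => /predU1P[->//|]; exact: h2.
rewrite indep_prod_ext//; first by rewrite /E IH.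
move=> A B mA mB.
(* Once [indep_prod_ext] has reduced the set at [i] to a rectangle, [i] can move from the first list
   to the second, where the induction hypothesis applies. *)
pose C2 j := if j == i then A `*` B else C' j.
have C2E j : j \in s1 ++ s2 -> C2 j = C' j.
  by move=> js; rewrite /C2; case: eqP => // ji; rewrite -ji js in nis.
have pe : perm_eq (s1 ++ i :: s2) (i :: s1 ++ s2).
  by rewrite perm_catC /= perm_cons perm_catC.
transitivity (P [set w | forall j, j \in s1 ++ i :: s2 -> C2 j (W j w)]).
  congr (P _); apply/seteqP; split => w /=.
    move=> [h1 h2] j; rewrite (perm_mem pe) inE => /predU1P[->|js].
      by rewrite /C2 eqxx.
    by rewrite C2E//; exact: h2.
  move=> h; split.
    by have := h i; rewrite /C2 eqxx; apply; rewrite (perm_mem pe) inE eqxx.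
  by move=> j js; rewrite -C2E//; apply: h; rewrite (perm_mem pe) inE js orbT.
rewrite IH.
- rewrite (perm_big _ pe) /= big_cons {1}/C2 eqxx; congr (_ * _).
  by rewrite /E IH//; apply: eq_big_seq => j js; rewrite C2E.
- by rewrite (perm_uniq pe) /= nis.
- by move=> j; rewrite /C2; case: eqP => // _; exact: measurableX.
- move=> j; rewrite inE /C2; case: eqP => [_ _|_ /= /rC//].
  by exists A, B.
Qed.

End independence.

(** * Lindeberg replacement *)

(** Trotter's operator. With values in the extended reals, nonnegativity and measurability are the
    only properties to be preserved by iteration. *)
Definition shift_mean d (T : measurableType d) (R : realType)
  (P : probability T R) (X : T -> R) (f : R -> \bar R) (x : R) : \bar R :=
  (\int[P]_w f (x + X w)%R)%E.

Section shift_mean.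
Local Open Scope ereal_scope.
Context d (T : measurableType d) (R : realType) (P : probability T R).
Variables (X : T -> R) (mX : measurable_fun setT X).
Local Notation A := (shift_mean P X).
Implicit Type f g : R -> \bar R.

Lemma measurable_fun_shift f x : measurable_fun setT f ->
  measurable_fun setT (fun w => f (x + X w)%R).
Proof. by move=> mf; apply: measurableT_comp => //; exact: measurable_funD. Qed.

Lemma shift_mean_ge0 f : (forall x, 0 <= f x) -> forall x, 0 <= A f x.
Proof. by move=> f0 x; apply: integral_ge0. Qed.

Lemma measurable_shift_mean f : measurable_fun setT f -> (forall x, 0 <= f x) ->
  measurable_fun setT (A f).
Proof.
move=> mf f0.
pose F (z : R * T) := f (z.1 + X z.2)%R.
have mF : measurable_fun setT F.
  apply: measurableT_comp => //; apply: measurable_funD => //.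
  exact: measurableT_comp.
exact: (measurable_fun_fubini_tonelli_F (m2 := P) F mF (fun=> f0 _)).
Qed.

Lemma shift_mean_le f g : measurable_fun setT f -> measurable_fun setT g ->
  (forall x, 0 <= f x) -> (forall x, f x <= g x) -> forall x, A f x <= A g x.
Proof.
move=> mf mg f0 fg x; apply: ge0_le_integral => //.
- exact: measurable_fun_shift.
- exact: measurable_fun_shift.
Qed.

Lemma shift_meanDcst f (c : R) : measurable_fun setT f -> (forall x, 0 <= f x) ->
  (0 <= c)%R -> A (fun x => f x + c%:E) = (fun x => A f x + c%:E).
Proof.
move=> mf f0 c0; apply/funext => x; rewrite /shift_mean ge0_integralD//.
- by rewrite integral_cst//= probability_setT mule1.
- exact: measurable_fun_shift.
Qed.

Lemma iter_shift_mean n f : measurable_fun setT f -> (forall x, 0 <= f x) ->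
  measurable_fun setT (iter n A f) /\ forall x, 0 <= iter n A f x.
Proof.
move=> mf f0; elim: n => [//|n [IHm IH0]]; split.
  exact: measurable_shift_mean.
exact: shift_mean_ge0.
Qed.

Lemma iter_shift_mean_le n f g : measurable_fun setT f -> measurable_fun setT g ->
  (forall x, 0 <= f x) -> (forall x, f x <= g x) ->
  forall x, iter n A f x <= iter n A g x.
Proof.
move=> mf mg f0 fg; have g0 x : 0 <= g x by exact: le_trans (fg x).
elim: n => [//|n IH] x; rewrite !iterS.
have [mfn fn0] := iter_shift_mean n mf f0.
have [mgn gn0] := iter_shift_mean n mg g0.
exact: shift_mean_le.
Qed.

Lemma iter_shift_meanDcst n f (c : R) : measurable_fun setT f ->
  (forall x, 0 <= f x) -> (0 <= c)%R ->
  iter n A (fun x => f x + c%:E) = (fun x => iter n A f x + c%:E).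
Proof.
move=> mf f0 c0; elim: n => [//|n IH]; rewrite !iterS IH.
have [mAn An0] := iter_shift_mean n mf f0.
by rewrite shift_meanDcst.
Qed.

End shift_mean.
Arguments measurable_shift_mean {d T R P X} mX {f}.
Arguments shift_mean_ge0 {d T R P X f}.
Arguments iter_shift_mean {d T R P X} mX n {f}.

Section lindeberg_trotter.
Local Open Scope ereal_scope.
Context d1 d2 (T1 : measurableType d1) (T2 : measurableType d2) (R : realType)
  (P : probability T1 R) (Q : probability T2 R).
Variables (X : T1 -> R) (mX : measurable_fun setT X).
Variables (Z : T2 -> R) (mZ : measurable_fun setT Z).
Local Notation A := (shift_mean P X).
Local Notation B := (shift_mean Q Z).

Lemma shift_meanC f : measurable_fun setT f -> (forall x, 0 <= f x) ->
  A (B f) = B (A f).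
Proof.
move=> mf f0; apply/funext => x; rewrite /shift_mean.
pose F (z : T1 * T2) := f (x + X z.1 + Z z.2)%R.
have mF : measurable_fun setT F.
  apply: measurableT_comp => //; apply: measurable_funD => //.
    by apply: measurable_funD => //; exact: measurableT_comp.
  exact: measurableT_comp.
rewrite (fubini_tonelli (m1 := P) (m2 := Q) F mF (fun=> f0 _)).
apply: eq_integral => w _; apply: eq_integral => w' _.
by rewrite /F /= addrAC.
Qed.

Lemma iter_shift_meanC n f : measurable_fun setT f -> (forall x, 0 <= f x) ->
  A (iter n B f) = iter n B (A f).
Proof.
move=> mf f0; elim: n => [//|n IH]; rewrite !iterS.
have [mBn Bn0] := iter_shift_mean (P := Q) mZ n mf f0.
by rewrite shift_meanC// IH.
Qed.

(* Replaces the increments one at a time: the operators commute, so the errors add. *)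
Lemma iter_shift_mean_compare n f (e : R) :
  measurable_fun setT f -> (forall x, 0 <= f x) -> (0 <= e)%R ->
  (forall x, A f x <= B f x + e%:E) ->
  forall x, iter n A f x <= iter n B f x + (n%:R * e)%:E.
Proof.
move=> mf f0 e0 AB; elim: n => [x|n IH x]; first by rewrite mul0r adde0.
have [mBn Bn0] := iter_shift_mean (P := Q) mZ n mf f0.
have [mAn An0] := iter_shift_mean (P := P) mX n mf f0.
have mA := measurable_shift_mean (P := P) mX mf f0.
have A0 := shift_mean_ge0 (P := P) (X := X) f0.
have mB := measurable_shift_mean (P := Q) mZ mf f0.
have B0 := shift_mean_ge0 (P := Q) (X := Z) f0.
have ne0 : (0 <= n%:R * e)%R by exact: mulr_ge0.
rewrite [iter n.+1 A f]iterS.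
apply: (@le_trans _ _ (A (fun x => iter n B f x + (n%:R * e)%:E) x)).
  by apply: shift_mean_le => //; apply: emeasurable_funD.
rewrite shift_meanDcst// iter_shift_meanC// -natr1 mulrDl mul1r (addrC (_ * _)%R) EFinD addeA.
apply: leeD2r => //.
have -> : iter n.+1 B f x + e%:E = iter n B (fun x => B f x + e%:E) x.
  by rewrite iter_shift_meanDcst// iterSr.
by apply: iter_shift_mean_le => //; exact: emeasurable_funD.
Qed.

End lindeberg_trotter.

(** * Sums of i.i.d. variables as iterates of one operator *)

Section iid_sums.
Local Open Scope ereal_scope.
Context d (T : measurableType d) (R : realType) (P : probability T R).
Variables (X : nat -> T -> R) (mX : forall i, measurable_fun setT (X i)).
Hypothesis indepX : forall s A, uniq s -> (forall i, measurable (A i)) ->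
  P [set w | forall i, i \in s -> A i (X i w)] = \prod_(i <- s) P (X i @^-1` A i).
Hypothesis idX : forall i A, measurable A -> P (X i @^-1` A) = P (X 0%N @^-1` A).

Let S k w : R := (\sum_(i < k) X i w)%R.

Let mS k : measurable_fun setT (S k).
Proof. exact: measurable_sum. Qed.

(** An event on the sum of [k.+1] terms is an event on the pair [(S k, X k)]. By [indep_prod_ext] it
    may be tested on rectangles, and there [X k] simply joins the list [s]. *)
Lemma indep_partial_sum k s C A : uniq s -> (forall i, i \in s -> (k <= i)%N) ->
  measurable C -> (forall i, measurable (A i)) ->
  P (S k @^-1` C `&` [set w | forall i, i \in s -> A i (X i w)]) =
  P (S k @^-1` C) * P [set w | forall i, i \in s -> A i (X i w)].
Proof.
elim: k s C A => [|k IH] s C A us ks mC mA.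
  have [C0|C0] := pselect (C 0%R).
    rewrite (_ : S 0%N @^-1` C = setT) ?setTI ?probability_setT ?mul1e//.
    by apply/seteqP; split => // w _; rewrite /= /S big_ord0.
  rewrite (_ : S 0%N @^-1` C = set0) ?set0I ?measure0 ?mul0e//.
  by apply/seteqP; split => // w; rewrite /= /S big_ord0.
set E := [set w | _].
pose Z w := (S k w, X k w).
have mZ : measurable_fun setT Z by exact: measurable_fun_pair.
have mD : measurable [set z : R * R | C (z.1 + z.2)%R].
  rewrite -[X in measurable X]setTI.
  by apply: (measurable_funD measurable_fst measurable_snd).
have -> : S k.+1 @^-1` C = Z @^-1` [set z | C (z.1 + z.2)%R].
  by apply/seteqP; split => w /=; rewrite /S big_ord_recr.
have ks' : k \notin s by apply/negP => /ks; rewrite ltnn.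
apply: indep_prod_ext => //; first exact: measurable_cylinder.
move=> B1 B2 mB1 mB2.
pose A2 i := if i == k then B2 else A i.
have mA2 i : measurable (A2 i) by rewrite /A2; case: eqP.
have A2E i : i \in s -> A2 i = A i.
  by move=> si; rewrite /A2; case: eqP => // ik; rewrite -ik si in ks'.
have EE : E = [set w | forall i, i \in s -> A2 i (X i w)].
  by apply/seteqP; split => w /= h i si; have := h i si; rewrite A2E.
have -> : Z @^-1` (B1 `*` B2) = S k @^-1` B1 `&` X k @^-1` B2.
  by apply/seteqP; split.
have k1 : S k @^-1` B1 `&` X k @^-1` B2 = S k @^-1` B1 `&`
    [set w | forall i, i \in [:: k] -> A2 i (X i w)].
  apply/seteqP; split => w /= [h1 h2]; split => //.
    by move=> i; rewrite inE => /eqP ->; rewrite /A2 eqxx.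
  by have := h2 k; rewrite inE eqxx /A2 eqxx; apply.
have kE : S k @^-1` B1 `&` X k @^-1` B2 `&` E = S k @^-1` B1 `&`
    [set w | forall i, i \in k :: s -> A2 i (X i w)].
  rewrite EE; apply/seteqP; split => w /=.
    move=> [[h1 h2] h3]; split => // i; rewrite inE => /predU1P[->|]; last exact: h3.
    by rewrite /A2 eqxx.
  move=> [h1 h2]; split; first split => //.
    by have := h2 k; rewrite inE eqxx /A2 eqxx; apply.
  by move=> i si; apply: h2; rewrite inE si orbT.
have uks : uniq (k :: s) by rewrite /= ks'.
have kk i : i \in [:: k] -> (k <= i)%N by rewrite inE => /eqP ->.
have kks i : i \in k :: s -> (k <= i)%N.
  by rewrite inE => /predU1P[->//|/ks]; exact: ltnW.
rewrite kE k1 !IH// !indepX//.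
rewrite big_cons big_seq1 muleA; congr (_ * _).
by apply: eq_big_seq => i si; rewrite A2E.
Qed.

(** The law of [(S k, X k)] is the product of its marginals, and the second marginal is that of
    [X 0]; integrating it out first turns [g] into its shift mean. *)
Lemma mean_partial_sumS k (g : R -> \bar R) : measurable_fun setT g ->
  (forall x, 0 <= g x) ->
  \int[P]_w g (S k.+1 w) = \int[P]_w shift_mean P (X 0%N) g (S k w).
Proof.
move=> mg g0.
pose Sk : {mfun T >-> R} := HB.pack (S k) (isMeasurableFun.Build _ _ _ _ _ (mS k)).
pose X0 : {mfun T >-> R} := HB.pack (X 0%N) (isMeasurableFun.Build _ _ _ _ _ (mX 0%N)).
pose Z w := (S k w, X k w).
have mZ : measurable_fun setT Z by exact: measurable_fun_pair.
pose G (z : R * R) := g (z.1 + z.2)%R.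
have mG : measurable_fun setT G.
  apply: measurableT_comp => //.
  exact: (measurable_funD measurable_fst measurable_snd).
have G0 z : 0 <= G z by exact: g0.
transitivity (\int[image_measure P mZ]_z G z).
  rewrite ge0_integral_pushforward//.
  by apply: eq_integral => w _; rewrite /G /Z /= /S big_ord_recr.
transitivity (\int[distribution P Sk \x distribution P X0]_z G z).
  apply: eq_measure_integral => D mD _; apply/esym.
  apply: product_measure_unique => // A B mA mB.
  rewrite /= /distribution /pushforward.
  have kk i : i \in [:: k] -> (k <= i)%N by rewrite inE => /eqP ->.
  have := @indep_partial_sum k [:: k] A (fun=> B) isT kk mA (fun=> mB).
  have := @indepX [:: k] (fun=> B) isT (fun=> mB).
  rewrite big_seq1 idX// => -> <-.
  congr (P _); apply/seteqP; split => w /= [h1 h2]; split => //.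
    by move=> i; rewrite inE => /eqP ->.
  by apply: h2; rewrite inE.
have mF := measurable_fun_fubini_tonelli_F (m2 := distribution P X0) G mG G0.
rewrite fubini_tonelli1//.
rewrite ge0_integral_distribution//; last by move=> y; apply: integral_ge0.
apply: eq_integral => w _ /=.
rewrite /fubini_F ge0_integral_distribution//.
by apply: measurableT_comp => //; exact: pair1_measurable.
Qed.

Lemma mean_partial_sum n (g : R -> \bar R) : measurable_fun setT g ->
  (forall x, 0 <= g x) ->
  \int[P]_w g (\sum_(i < n) X i w)%R = iter n (shift_mean P (X 0%N)) g 0%R.
Proof.
rewrite -/(S n _); elim: n g => [|n IH] g mg g0.
  under eq_integral do rewrite /S big_ord0.
  by rewrite integral_cst//= probability_setT mule1.
rewrite mean_partial_sumS// IH ?iterSr//; first exact: measurable_shift_mean.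
exact: shift_mean_ge0.
Qed.

End iid_sums.

(** * A cubic spline approximation of a step *)

Section cubic_spline_step.
Variable R : realType.
Implicit Types x y t : R.

Definition pos_cube t : R := Num.max t 0 ^+ 3.

(** The truncated cube has second derivative 6 max(x, 0), which is 6-Lipschitz, so the second-order
    remainder is at most 6 |y|^3 / 3!. *)
Lemma pos_cube_taylor x y :
  `|pos_cube (x + y) - pos_cube x - 3 * Num.max x 0 ^+ 2 * y
    - 3 * Num.max x 0 * y ^+ 2| <= `|y| ^+ 3.
Proof.
rewrite -normrX /pos_cube.
have [x0|x0] := leP x 0; have [xy0|xy0] := leP (x + y) 0.
- rewrite (_ : _ - _ = 0) ?normr0//; ring.
- rewrite (_ : _ - _ = (x + y) ^+ 3); last by ring.
  have y0 : 0 <= y by lra.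
  rewrite !ger0_norm ?exprn_ge0 ?(ltW xy0)//.
  by apply: lerXn2r; rewrite ?nnegrE; lra.
- rewrite (_ : _ - _ = y ^+ 3 - (x + y) ^+ 3); last by ring.
  have y0 : y <= 0 by lra.
  have e : y ^+ 3 = - (- y) ^+ 3 by ring.
  have e' : (x + y) ^+ 3 = - (- (x + y)) ^+ 3 by ring.
  have h0 : 0 <= (- (x + y)) ^+ 3 by apply: exprn_ge0; lra.
  have h1 : (- (x + y)) ^+ 3 <= (- y) ^+ 3.
    by apply: lerXn2r; rewrite ?nnegrE; lra.
  by rewrite !ler0_norm; lra.
- by rewrite (_ : _ - _ = y ^+ 3)//; ring.
Qed.

(* The distribution function of a sum of three independent uniform variables on [0, 1]. *)
Definition spline_step t : R :=
  (pos_cube t - 3 * pos_cube (t - 1) + 3 * pos_cube (t - 2) - pos_cube (t - 3)) / 6.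

(** The weights 1, 3, 3, 1 over 6 add up to 4/3, rounded up to 2. The coefficients [a] and [b] may
    stay anonymous: they cancel between two laws with equal first and second moments. *)
Lemma spline_step_taylor x : exists a b, forall y,
  `|spline_step (x + y) - spline_step x - a * y - b * y ^+ 2| <= 2 * `|y| ^+ 3.
Proof.
pose m k := Num.max (x - k) (0 : R).
exists (3 * (m 0 ^+ 2 - 3 * m 1 ^+ 2 + 3 * m 2 ^+ 2 - m 3 ^+ 2) / 6).
exists (3 * (m 0 - 3 * m 1 + 3 * m 2 - m 3) / 6) => y.
have tk k := pos_cube_taylor (x - k) y.
have := tk 0; have := tk 1; have := tk 2; have := tk 3.
rewrite -!/(m _) !subr0 !(addrAC x _ y) /spline_step -(subr0 x) -/(m 0) !subr0.
have : 0 <= `|y| ^+ 3 by exact: exprn_ge0.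
move: (`|y| ^+ 3) => Y Y0; rewrite !ler_norml => /andP[? ?] /andP[? ?] /andP[? ?] /andP[? ?].
by apply/andP; split; lra.
Qed.

Lemma spline_step_le0 t : t <= 0 -> spline_step t = 0.
Proof.
move=> t0; rewrite /spline_step /pos_cube !max_r; [|lra..].
by rewrite expr0n/=; ring.
Qed.

Lemma spline_step_ge3 t : 3 <= t -> spline_step t = 1.
Proof. by move=> t3; rewrite /spline_step /pos_cube !max_l; [field|lra..]. Qed.

Lemma spline_step01 t : 0 <= spline_step t <= 1.
Proof.
have [t0|t0] := leP t 0; first by rewrite spline_step_le0// lexx ler01.
have [t3|t3] := leP 3 t; first by rewrite spline_step_ge3// lexx ler01.
rewrite /spline_step /pos_cube (max_l (ltW t0)) (@max_r _ _ (t - 3)); last lra.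
have [t1|t1] := leP (t - 1) 0; have [t2|t2] := leP (t - 2) 0; try lra.
- have h0 : 0 <= t ^+ 3 by exact/exprn_ge0/ltW.
  have h1 : t ^+ 3 <= 1 by apply: exprn_ile1; lra.
  by rewrite !expr0n/=; apply/andP; split; lra.
(* On the middle piece the spline is (1 + 3 s + 3 s^2 - 2 s^3) / 6 with s in [0, 1]. *)
- set s := t - 1 in t1 *; have -> : t = s + 1 by rewrite /s subrK.
  have s1 : s <= 1 by rewrite /s; lra.
  have h0 : 0 <= s ^+ 3 by exact/exprn_ge0/ltW.
  have h1 : s ^+ 3 <= s ^+ 2.
    by rewrite exprS ler_piMl// ?exprn_ge0// ltW.
  have h2 : s ^+ 2 <= s by rewrite expr2 ler_piMl// ltW.
  have h3 : 3 * s ^+ 2 - 2 * s ^+ 3 <= 1.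
    rewrite -subr_ge0 (_ : _ - _ = (1 - s) ^+ 2 * (1 + 2 * s)); last by ring.
    by rewrite mulr_ge0 ?sqr_ge0//; lra.
  have -> : (s + 1) ^+ 3 = s ^+ 3 + 3 * s ^+ 2 + 3 * s + 1 by ring.
  by rewrite !expr0n/=; apply/andP; split; lra.
(* The last piece is the mirror image of the first one: its value is 1 - s^3 / 6. *)
- set s := 3 - t; have -> : t = 3 - s by rewrite /s; ring.
  have s0 : 0 <= s by rewrite /s; lra.
  have s1 : s <= 1 by rewrite /s; lra.
  have h0 : 0 <= s ^+ 3 by exact/exprn_ge0.
  have h1 : s ^+ 3 <= 1 by apply: exprn_ile1.
  have -> : ((3 - s) ^+ 3 - 3 * (3 - s - 1) ^+ 3 + 3 * (3 - s - 2) ^+ 3 - 0 ^+ 3) / 6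
    = 1 - s ^+ 3 / 6 by field.
  by apply/andP; split; lra.
Qed.

Lemma measurable_spline_step : measurable_fun setT spline_step.
Proof.
have mp k : measurable_fun setT (fun t : R => pos_cube (t - k)).
  apply: measurable_funX; apply: measurable_maxr => //.
  exact: measurable_funB.
have -> : spline_step = fun t => (pos_cube (t - 0) - 3 * pos_cube (t - 1) +
    3 * pos_cube (t - 2) - pos_cube (t - 3)) / 6.
  by apply/funext => t; rewrite subr0.
apply: measurable_funM => //; apply: measurable_funB => //.
apply: measurable_funD; last exact: measurable_funM.
by apply: measurable_funB => //; exact: measurable_funM.
Qed.

End cubic_spline_step.

(** * The normal law *)

Section normal_law.
Local Open Scope ereal_scope.
Variable R : realType.
Local Notation lam := (@lebesgue_measure R).
Implicit Types s x : R.

Lemma ge0_integral_normal_prob s (f : R -> \bar R) : measurable_fun setT f ->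
  (forall x, 0 <= f x) ->
  \int[normal_prob 0%R s]_x f x = \int[lam]_x (f x * (normal_pdf 0%R s x)%:E).
Proof.
move=> mf f0.
rewrite -(ge0_integral_density_measure lam
  (measurable_normal_pdf 0%R s) (normal_pdf_ge0 0%R s))//.
Qed.

(** Completing the square in [y]: the right side is the density of the sum [w] times the conditional
    density of [y] given [w], which is again normal. *)
Lemma normal_pdf_conv s (w y : R) : (0 < s)%R ->
  (normal_pdf 0 s (w - y) * normal_pdf 0 1 y =
   normal_pdf 0 (Num.sqrt (1 + s ^+ 2)) w *
   normal_pdf (w / (1 + s ^+ 2)) (s / Num.sqrt (1 + s ^+ 2)) y)%R.
Proof.
move=> s0.
have s2 : (0 < 1 + s ^+ 2)%R by rewrite ltr_wpDr// exprn_ge0// ltW.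
have q0 : (0 < Num.sqrt (1 + s ^+ 2))%R by rewrite sqrtr_gt0.
have q2 : (Num.sqrt (1 + s ^+ 2) ^+ 2 = 1 + s ^+ 2)%R by rewrite sqr_sqrtr// ltW.
rewrite !normal_pdfE ?gt_eqF ?divr_gt0//.
rewrite mulrACA [RHS]mulrACA /normal_fun -!expRD; congr (_ * expR _)%R.
- rewrite /normal_peak -!invfM -!sqrtrM; last 2 first.
  + by rewrite mulrn_wge0// mulr_ge0 ?pi_ge0// sqr_ge0.
  + by rewrite mulrn_wge0// mulr_ge0 ?pi_ge0// sqr_ge0.
  congr (_^-1)%R; congr (Num.sqrt _).
  by rewrite expr_div_n q2; field; rewrite gt_eqF.
- rewrite expr_div_n q2; field.
  by rewrite !gt_eqF.
Qed.

(** The inner integral is recentred so that [w] is the total increment; after the exchange of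
    integrals only the conditional density of [y] depends on [y], and it has mass one. *)
Lemma normal_shift_mean s f x : (0 < s)%R -> measurable_fun setT f ->
  (forall x, 0 <= f x) ->
  shift_mean (normal_prob 0%R 1%R) idfun
    (shift_mean (normal_prob 0%R s) idfun f) x =
  shift_mean (normal_prob 0%R (Num.sqrt (1 + s ^+ 2))) idfun f x.
Proof.
move=> s0 mf f0.
have mfx z : measurable_fun setT (fun w : R => f (z + w)%R).
  by apply: measurableT_comp => //; exact: measurable_funD.
have mpdf t : measurable_fun setT (fun w : R => (normal_pdf 0%R t w)%:E).
  by apply/measurable_EFinP; exact: measurable_normal_pdf.
have pdf0 t w : 0 <= (normal_pdf 0%R t w)%:E by rewrite lee_fin normal_pdf_ge0.
have mid : measurable_fun setT (idfun : R -> R) by exact: measurable_id.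
have inner y : shift_mean (normal_prob 0%R s) idfun f (x + y)%R =
    \int[lam]_w (f (x + w)%R * (normal_pdf 0%R s (w - y))%:E).
  rewrite /shift_mean (ge0_integral_normal_prob s (mfx (x + y)%R) (fun=> f0 _)).
  rewrite (@ge0_integral_affine R 1 (- y)%R)//.
  - apply: eq_integral => w _; rewrite mule1 mul1r; congr (f _ * _).
    by rewrite /= addrACA subrr addr0.
  - by apply: emeasurable_funM.
  - by move=> w; rewrite mule_ge0.
rewrite {1}/shift_mean ge0_integral_normal_prob//; last 2 first.
- apply: measurableT_comp; last exact: measurable_funD.
  exact: (measurable_shift_mean (P := normal_prob 0%R s)).
- by move=> w; apply: integral_ge0.
pose F (z : R * R) := f (x + z.2)%R *
  (normal_pdf 0 s (z.2 - z.1) * normal_pdf 0 1 z.1)%:E.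
have mF : measurable_fun setT F.
  apply: emeasurable_funM.
    by apply: measurableT_comp => //; exact: measurable_funD.
  apply/measurable_EFinP; apply: measurable_funM.
    apply: (measurableT_comp (measurable_normal_pdf 0%R s)).
    exact: measurable_funB.
  by apply: (measurableT_comp (measurable_normal_pdf 0%R 1%R)).
have F0 z : 0 <= F z by rewrite mule_ge0// lee_fin mulr_ge0// normal_pdf_ge0.
transitivity (\int[lam]_y \int[lam]_w F (y, w)).
  apply: eq_integral => y _; rewrite inner muleC -ge0_integralZl//; last 2 first.
  - apply: emeasurable_funM; [exact: mfx|apply/measurable_EFinP => /=].
    apply: (measurableT_comp (measurable_normal_pdf 0%R s)).
    exact: measurable_funB.
  - by move=> w _; rewrite mule_ge0.
  by apply: eq_integral => w _; rewrite /F /= EFinM muleCA; congr (_ * _); rewrite muleC.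
rewrite (fubini_tonelli (m1 := lam) (m2 := lam) F mF F0).
rewrite /shift_mean (ge0_integral_normal_prob _ (mfx x) (fun=> f0 _)).
apply: eq_integral => w _; rewrite /F /=.
under eq_integral do rewrite normal_pdf_conv// EFinM muleA.
rewrite ge0_integralZl//.
- by rewrite integral_normal_pdf mule1.
- by apply/measurable_EFinP; exact: measurable_normal_pdf.
- by move=> y _; rewrite lee_fin normal_pdf_ge0.
- by rewrite mule_ge0.
Qed.

(** Stated from one iterate on, because [normal_shift_mean] adds to a normal law of positive
    standard deviation. *)
Lemma iter_normal_shift_mean n f x : measurable_fun setT f ->
  (forall x, 0 <= f x) ->
  iter n.+1 (shift_mean (normal_prob 0%R 1%R) idfun) f x =
  shift_mean (normal_prob 0%R (Num.sqrt n.+1%:R)) idfun f x.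
Proof.
move=> mf f0; elim: n x => [x|n IH x]; first by rewrite sqrtr1.
rewrite iterS (_ : iter n.+1 _ _ =
    shift_mean (normal_prob 0%R (Num.sqrt n.+1%:R)) idfun f); last exact/funext.
have s0 : (0 < Num.sqrt n.+1%:R :> R)%R by rewrite sqrtr_gt0.
have e : (1 + Num.sqrt n.+1%:R ^+ 2 = n.+2%:R :> R)%R by rewrite sqr_sqrtr// nat1r.
by rewrite (normal_shift_mean x s0 mf f0) e.
Qed.

Lemma measurable_le_itv x : measurable [set y : R | (y <= x)%R].
Proof. by rewrite -set_itvNyc; exact: measurable_itv. Qed.

Lemma normal_prob_scale s x : (0 < s)%R ->
  normal_prob 0%R s [set y | (y <= s * x)%R] = normal_prob 0%R 1%R [set y | (y <= x)%R].
Proof.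
move=> s0; rewrite /normal_prob.
rewrite [LHS]integral_mkcond [RHS]integral_mkcond.
rewrite (@ge0_integral_affine R s 0%R)//.
- apply: eq_integral => y _; rewrite !patchE addr0.
  have -> : ((s * y)%R \in [set y | (y <= s * x)%R]) = (y \in [set y | (y <= x)%R]).
    by apply/idP/idP; rewrite !inE/= ler_pM2l.
  case: ifPn => _; last by rewrite mul0e.
  rewrite -EFinM !normal_pdfE ?gt_eqF//; congr EFin.
  rewrite mulrAC; congr (_ * _)%R.
    rewrite /normal_peak expr1n mul1r -mulrnAr sqrtrM ?sqr_ge0// sqrtr_sqr gtr0_norm//.
    by rewrite invfM mulrAC mulVf ?gt_eqF// mul1r.
  by rewrite /normal_fun; congr expR; field; rewrite gt_eqF.
- apply/(measurable_restrictT _ (measurable_le_itv _)); apply: measurable_funTS.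
  by apply/measurable_EFinP; exact: measurable_normal_pdf.
- by move=> y; rewrite patchE; case: ifP => // _; rewrite lee_fin normal_pdf_ge0.
Qed.

(** The density never exceeds its peak. This bound converts every displacement of the threshold [x]
    into an error in probability. *)
Lemma normal_prob_lip (a b : R) : (a <= b)%R ->
  normal_prob 0%R 1%R [set y | (y <= b)%R] <=
  normal_prob 0%R 1%R [set y | (y <= a)%R] + (normal_peak 1 * (b - a))%:E.
Proof.
move=> ab.
have -> : [set y : R | (y <= b)%R] = [set y : R | (y <= a)%R] `|` `]a, b]%classic.
  apply/seteqP; split => y /=; rewrite in_itv/=.
    by have [ya|ay] := leP y a; [left|right].
  by case=> [/le_trans ->//|/andP[]].
have ma := measurable_le_itv a.
rewrite [X in X <= _]measureU//; last first.
  apply/seteqP; split => // y [/= ya]; rewrite in_itv/= => /andP[].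
  by rewrite ltNge ya.
apply: leeD2l.
apply: (@le_trans _ _ (\int[lam]_(y in `]a, b]) (normal_peak 1)%:E)).
  apply: ge0_le_integral => //.
  - by move=> y _; rewrite lee_fin normal_pdf_ge0.
  - by apply: measurable_funTS; apply/measurable_EFinP; exact: measurable_normal_pdf.
  - by move=> y _; rewrite lee_fin normal_pdf_ub// oner_neq0.
rewrite integral_cst//= lebesgue_measure_itv/= lte_fin.
case: ifPn => _; first by rewrite -EFinB -EFinM.
by rewrite mule0 lee_fin mulr_ge0 ?normal_peak_ge0 ?subr_ge0.
Qed.

End normal_law.

(** * Improper integrals from antiderivatives *)

Section improper_ftc.
Variable R : realType.
Local Notation lam := (@lebesgue_measure R).

Lemma ge0_integral_is_derivey (f F : R -> R) (a l : R) :
  (forall x, a <= x -> 0 <= f x) -> continuous f ->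
  (forall x, is_derive x (1 : R) F (f x)) -> F x @[x --> +oo] --> l ->
  (\int[lam]_(x in `[a, +oo[) (f x)%:E = (l - F a)%:E)%E.
Proof.
move=> f0 cf dF Fl; rewrite EFinB.
have cF : continuous F.
  move=> x; apply: differentiable_continuous.
  by apply/derivable1_diffP; exact: ex_derive.
apply: ge0_continuous_FTC2y => //.
- exact: continuous_subspaceT.
- by apply/cvg_at_right_filter; exact: cF.
- by move=> x _; rewrite derive1E derive_val.
Qed.

Lemma integral_expRN (a : R) :
  (\int[lam]_(x in `[a, +oo[) (expR (- x))%:E = (expR (- a))%:E)%E.
Proof.
have cexp : continuous (fun x : R => expR (- x)).
  move=> x; apply: continuous_comp; last exact: continuous_expR.
  exact: continuousN.
have dF (x : R) : is_derive x (1 : R) (fun x => - expR (- x)) (expR (- x)).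
  by apply: is_derive_eq; rewrite /GRing.scale/=; ring.
have Fl : (- expR (- x)) @[x --> +oo] --> (0 : R).
  by rewrite -[X in _ --> X]oppr0; apply: cvgN; exact: cvgr_expR.
by rewrite (ge0_integral_is_derivey (fun x _ => expR_ge0 (- x)) cexp dF Fl) sub0r opprK.
Qed.

End improper_ftc.

(** * Moments of the standard normal law *)

Section normal_moments.
Variable R : realType.
Local Notation lam := (@lebesgue_measure R).
Local Notation N01 := (@normal_prob R 0 1).
Local Notation phi := (@normal_pdf R 0 1).

Lemma normal01E (x : R) : phi x = normal_peak 1 * expR (- (x ^+ 2 / 2)).
Proof.
rewrite normal_pdfE ?oner_neq0// /normal_fun subr0 expr1n.
by congr (_ * expR _); rewrite mulNr.
Qed.

Lemma normal01N (x : R) : phi (- x) = phi x.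
Proof. by rewrite !normal01E sqrrN. Qed.

(** Half of the Gaussian exponent absorbs the polynomial: with u = x^2 / 4, 1 + 16 u^2 is at most 33
    (1 + u^2 / 2), hence at most 33 exp u. The other half is, up to a factor, the density of
    variance 2. *)
Lemma normal01_pow_le (x : R) :
  (1 + x ^+ 4) * phi x <= 33 * Num.sqrt 2 * normal_pdf 0 (Num.sqrt 2) x.
Proof.
have s2 : (Num.sqrt 2 : R) != 0 by rewrite gt_eqF// sqrtr_gt0.
rewrite normal01E normal_pdfE// /normal_fun subr0 sqr_sqrtr//.
have -> : normal_peak (Num.sqrt 2) = normal_peak 1 / Num.sqrt 2 :> R.
  rewrite /normal_peak sqr_sqrtr// expr1n -mulrnAr sqrtrM// mul1r.
  by rewrite invfM mulrC.
rewrite mulrCA (_ : 33 * _ * _ = normal_peak 1 * (33 * expR (- x ^+ 2 / (2 *+ 2)))); last first.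
  by field.
rewrite ler_wpM2l ?normal_peak_ge0//.
set u := x ^+ 2 / 4; have u0 : 0 <= u by rewrite divr_ge0// sqr_ge0.
have -> : - (x ^+ 2 / 2) = - u - u by rewrite /u; field.
have -> : - x ^+ 2 / (2 *+ 2) = - u by rewrite /u; field.
rewrite expRD mulrA ler_wpM2r ?expR_ge0// expRN ler_pdivrMr ?expR_gt0//.
have -> : x ^+ 4 = 16 * u ^+ 2 by rewrite /u; field.
have := expR_ge1Dxn 1 u0; rewrite (_ : 2`!%:R = 2)// => h.
have : 0 <= u ^+ 2 by exact: sqr_ge0.
by lra.
Qed.

Lemma continuous_normal01 : continuous phi.
Proof. by apply: continuous_normal_pdf; exact: oner_neq0. Qed.

Lemma ge0_integral_normal01N (f : R -> \bar R) : measurable_fun setT f ->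
  (forall x, 0 <= f x)%E -> (\int[N01]_x f (- x)%R = \int[N01]_x f x)%E.
Proof.
move=> mf f0.
have mfN : measurable_fun setT (fun x : R => f (- x)).
  exact: measurableT_comp.
have mphi : measurable_fun setT (fun x => (phi x)%:E).
  by apply/measurable_EFinP; exact: measurable_normal_pdf.
rewrite (ge0_integral_normal_prob 1 mf f0).
rewrite (ge0_integral_normal_prob 1 mfN (fun=> f0 _)).
transitivity (\int[pushforward lam (-%R : measurableTypeR R -> measurableTypeR R)]_x
    (f x * (phi x)%:E))%E; last first.
  by apply: eq_measure_integral => A mA _; exact: lebesgue_measureN.
have mN : measurable_fun setT (-%R : measurableTypeR R -> measurableTypeR R) by [].
have g0 : {in [set: measurableTypeR R], forall x, (0 <= f x * (phi x)%:E)%E}.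
  by move=> x _; rewrite mule_ge0// lee_fin normal_pdf_ge0.
rewrite (ge0_integral_pushforward mN lam measurableT (emeasurable_funM mf mphi) g0).
by apply: eq_integral => x _; rewrite /= normal01N.
Qed.

Lemma integrable_normal01_pow (f : R -> R) : measurable_fun setT f ->
  (forall x, `|f x| <= 1 + x ^+ 4) -> N01.-integrable setT (EFin \o f).
Proof.
move=> mf fle; apply/integrableP; split; first exact/measurable_EFinP.
have mnf : measurable_fun setT (fun x => `|(EFin \o f) x|)%E.
  by apply: measurableT_comp => //; exact/measurable_EFinP.
rewrite (ge0_integral_normal_prob 1 mnf)//.
apply: (@le_lt_trans _ _ (\int[lam]_x
    ((33 * Num.sqrt 2)%:E * (normal_pdf 0 (Num.sqrt 2) x)%:E))%E).
  apply: ge0_le_integral => //.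
  - by move=> x _; rewrite mule_ge0// lee_fin normal_pdf_ge0.
  - apply: emeasurable_funM => //.
    by apply/measurable_EFinP; exact: measurable_normal_pdf.
  - apply: emeasurable_funM => //.
    by apply/measurable_EFinP; exact: measurable_normal_pdf.
  - move=> x _; rewrite -!EFinM lee_fin; apply: le_trans (normal01_pow_le x).
    by rewrite ler_wpM2r ?normal_pdf_ge0.
rewrite ge0_integralZl//.
- by rewrite integral_normal_pdf mule1 ltry.
- by apply/measurable_EFinP; exact: measurable_normal_pdf.
- by move=> x _; rewrite lee_fin normal_pdf_ge0.
Qed.

Lemma sqr_le_pow4 (x : R) : 2 * x ^+ 2 <= 1 + x ^+ 4.
Proof.
by rewrite -subr_ge0 (_ : _ - _ = (x ^+ 2 - 1) ^+ 2) ?sqr_ge0//; ring.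
Qed.

Lemma normal01_mean : (\int[N01]_x x%:E = 0)%E.
Proof.
have iN : N01.-integrable setT (EFin \o idfun).
  apply: integrable_normal01_pow; first exact: measurable_id.
  move=> x; rewrite /=.
  have := sqr_le_pow4 x; have : 0 <= x ^+ 2 - 2 * `|x| + 1.
    rewrite -(real_normK (num_real x)).
    by rewrite (_ : _ + 1 = (`|x| - 1) ^+ 2) ?sqr_ge0//; ring.
  have : 0 <= x ^+ 4 by exact: exprn_even_ge0.
  by have := sqr_ge0 x; lra.
have mE : measurable_fun setT (EFin : R -> \bar R) by [].
have mpos : measurable_fun setT ((fun x : R => x%:E)^\+)%E.
  exact: measurable_funepos.
have pos0 (x : R) : (0 <= ((fun x : R => x%:E)^\+) x)%E by exact: funepos_ge0.
rewrite integralE.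
(* Reflection exchanges the positive and negative parts of x, so their integrals agree; both are
   finite by [iN]. *)
have -> : (\int[N01]_x ((fun x : R => x%:E)^\-) x =
           \int[N01]_x ((fun x : R => x%:E)^\+) x)%E.
  rewrite -(ge0_integral_normal01N mpos pos0).
  by apply: eq_integral => x _; rewrite funeposE funenegE.
rewrite subee//.
exact: integrable_pos_fin_num iN.
Qed.

Lemma normal01_variance : (\int[N01]_x (x ^+ 2)%:E = 1)%E.
Proof.
have msq : measurable_fun setT (fun x : R => (x ^+ 2)%:E).
  by apply/measurable_EFinP.
rewrite (ge0_integral_normal_prob 1 msq); last first.
  by move=> x; rewrite lee_fin sqr_ge0.
under eq_integral do rewrite -EFinM.
(* From x^2 / 2 - x + 1/2 >= 0, exp(- x^2 / 2) is at most exp(1/2) exp(- x). *)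
pose c : R := normal_peak 1 * expR (2^-1).
have c0 : 0 <= c by rewrite mulr_ge0 ?normal_peak_ge0 ?expR_ge0.
have phile x : phi x <= c * expR (- x).
  rewrite normal01E /c -[leRHS]mulrA ler_wpM2l ?normal_peak_ge0// -expRD ler_expR.
  rewrite -subr_ge0 (_ : _ - _ = (x - 1) ^+ 2 / 2); last by field.
  by rewrite divr_ge0 ?sqr_ge0.
have csq : continuous (fun x : R => x ^+ 2 * phi x).
  move=> x; apply: cvgM; first exact: exprn_continuous.
  exact: continuous_normal01.
have cexp : continuous (fun x : R => c * expR (- x)).
  move=> x; apply: cvgM; first exact: cvg_cst.
  apply: continuous_comp; last exact: continuous_expR.
  exact: continuousN.
have mphi : measurable_fun setT (fun x => (phi x)%:E).
  by apply/measurable_EFinP; exact: measurable_normal_pdf.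
have mexp : measurable_fun setT (fun x : R => (c * expR (- x))%:E).
  by apply/measurable_EFinP; exact: continuous_measurable_fun.
have mcsq : measurable_fun setT (fun x : R => (x ^+ 2 * phi x)%:E).
  by apply/measurable_EFinP; exact: continuous_measurable_fun.
have sq0 x : 0 <= x ^+ 2 * phi x by rewrite mulr_ge0 ?sqr_ge0 ?normal_pdf_ge0.
have phi0 x : 0 <= phi x by exact: normal_pdf_ge0.
have ce0 x : 0 <= c * expR (- x) by rewrite mulr_ge0 ?expR_ge0.
rewrite ge0_symfun_integralT//; last by move=> x; rewrite /= sqrrN normal01N.
rewrite -(integral_normal_pdf 0%R 1%R) ge0_symfun_integralT//; last 2 first.
- exact: continuous_normal01.
- by move=> x; rewrite /= normal01N.
congr (_ * _)%E; rewrite -set_itvcy.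
(* (x^2 - 1) phi is the derivative of - x phi but changes sign, while the improper fundamental
   theorem used here asks for a nonnegative integrand. Adding [c * expR (- x)], which dominates phi,
   repairs this; its integral [c] is cancelled at the end. *)
pose g x := (x ^+ 2 - 1) * phi x + c * expR (- x).
have g0 x : 0 <= x -> 0 <= g x.
  by move=> x0; have := sq0 x; have := phile x; rewrite /g; lra.
have cg : continuous g.
  move=> x; apply: (@cvgD _ R^o); last exact: cexp.
  apply: cvgM; last exact: continuous_normal01.
  by apply: (@cvgB _ R^o); [exact: exprn_continuous|exact: cvg_cst].
have Ig : (\int[lam]_(x in `[0%R, +oo[) (g x)%:E = c%:E)%E.
  pose G x := - (x * phi x) - c * expR (- x).
  have dG (x : R) : is_derive x (1 : R) G (g x).
    rewrite /G (_ : (fun _ => _) = (fun x => - (x * (normal_peak 1 *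
        expR (- (x ^+ 2 / 2)))) - c * expR (- x))); last first.
      by apply/funext => t; rewrite normal01E.
    rewrite /g normal01E; apply: is_derive_eq.
    by rewrite /GRing.scale/=; field.
  have Gl : G x @[x --> +oo] --> (0 : R).
    (* Since x^2 <= 1 + x^4, x^2 phi is bounded by K, and x phi is squeezed between 0 and K / x. *)
    have bnd t : (1 + t ^+ 4) * phi t <= 33 * Num.sqrt 2 * normal_peak (Num.sqrt 2).
      apply: (le_trans (normal01_pow_le t)); rewrite ler_wpM2l ?mulr_ge0//.
      by apply: normal_pdf_ub; rewrite gt_eqF// sqrtr_gt0.
    set K : R := 33 * Num.sqrt 2 * normal_peak (Num.sqrt 2) in bnd.
    have h : x * phi x @[x --> +oo] --> (0 : R).
      apply: (@squeeze_cvgr _ _ _ _ (cst 0) (fun x => K * x^-1)).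
      + near=> x.
        have x0 : 0 < x by near: x; exact: nbhs_pinfty_gt.
        rewrite /= mulr_ge0 ?(ltW x0)//= ler_pdivlMr//.
        apply: le_trans (bnd x); rewrite mulrAC ler_wpM2r// -expr2.
        by have := sqr_le_pow4 x; have := sqr_ge0 x; lra.
      + exact: cvg_cst.
      + rewrite -(mulr0 K); apply: cvgM; first exact: cvg_cst.
        apply/gtr0_cvgV0; last exact: cvg_id.
        exact: nbhs_pinfty_gt.
    have -> : (0 : R) = - 0 - c * 0 by rewrite mulr0 subr0 oppr0.
    apply: (@cvgB _ R^o); first exact: (@cvgN _ R^o).
    by apply: cvgM; [exact: cvg_cst|exact: cvgr_expR].
  rewrite (ge0_integral_is_derivey g0 cg dG Gl) /G.
  by rewrite mul0r oppr0 expR0 mulr1 !sub0r opprK.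
have Ie : (\int[lam]_(x in `[0%R, +oo[) (c * expR (- x))%:E = c%:E)%E.
  under eq_integral do rewrite EFinM.
  rewrite ge0_integralZl//.
  - by rewrite integral_expRN oppr0 expR0 mule1.
  - by apply: measurable_funTS; apply/measurable_EFinP; apply: measurableT_comp.
have : (\int[lam]_(x in `[0%R, +oo[) ((x ^+ 2 * phi x)%:E + (c * expR (- x))%:E) =
    \int[lam]_(x in `[0%R, +oo[) ((g x)%:E + (phi x)%:E))%E.
  by apply: eq_integral => x _; rewrite -!EFinD; congr EFin; rewrite /g; ring.
rewrite ge0_integralD//; last 4 first.
- by move=> x _; rewrite lee_fin.
- exact: measurable_funTS.
- by move=> x _; rewrite lee_fin.
- exact: measurable_funTS.
rewrite ge0_integralD//; last 4 first.
- by move=> x; rewrite /= in_itv/= andbT => x0; rewrite lee_fin g0.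
- by apply: measurable_funTS; apply/measurable_EFinP; exact: continuous_measurable_fun.
- by move=> x _; rewrite lee_fin.
- exact: measurable_funTS.
rewrite Ig Ie [X in _ = X -> _]addeC => /(congr1 (fun z => z - c%:E)%E).
by rewrite !addeK.
Unshelve. all: by end_near. Qed.

End normal_moments.

(** * The central limit theorem *)

Section third_moment.
Local Open Scope ereal_scope.
Context d (T : measurableType d) (R : realType) (P : probability T R).
Variables (X : T -> R) (mX : measurable_fun setT X) (m3 : R).
Hypothesis iX1 : P.-integrable setT (fun w => (X w)%:E).
Hypothesis iX2 : P.-integrable setT (fun w => (X w ^+ 2)%:E).
Hypothesis iX3 : P.-integrable setT (fun w => (`|X w| ^+ 3)%:E).
Hypothesis X1 : \int[P]_w (X w)%:E = 0.
Hypothesis X2 : \int[P]_w (X w ^+ 2)%:E = 1.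
Hypothesis X3 : \int[P]_w (`|X w| ^+ 3)%:E = m3%:E.

Lemma cubic_mean (c a b k : R) :
  P.-integrable setT (fun w => (c + a * X w + b * X w ^+ 2 + k * `|X w| ^+ 3)%:E) /\
  \int[P]_w (c + a * X w + b * X w ^+ 2 + k * `|X w| ^+ 3)%:E = (c + b + k * m3)%:E.
Proof.
have i0 : P.-integrable setT (fun=> c%:E) by exact: finite_measure_integrable_cst.
have ia : P.-integrable setT (fun w => a%:E * (X w)%:E) by exact: integrableZl.
have ib : P.-integrable setT (fun w => b%:E * (X w ^+ 2)%:E) by exact: integrableZl.
have ik : P.-integrable setT (fun w => k%:E * (`|X w| ^+ 3)%:E) by exact: integrableZl.
have i0a := integrableD measurableT i0 ia.
have i0ab := integrableD measurableT i0a ib.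
have E : (fun w => (c + a * X w + b * X w ^+ 2 + k * `|X w| ^+ 3)%:E) =
    (fun w => c%:E + a%:E * (X w)%:E + b%:E * (X w ^+ 2)%:E + k%:E * (`|X w| ^+ 3)%:E).
  by apply/funext => w; rewrite !EFinD !EFinM.
rewrite E; split; first exact: integrableD.
rewrite integralD// integralD// integralD//.
rewrite integral_cst//= probability_setT mule1 !integralZl// X1 X2 X3.
by rewrite mule0 adde0 mule1 -!EFinM -!EFinD.
Qed.

Variables (h : R -> R) (mh : measurable_fun setT h) (h01 : forall x, (0 <= h x <= 1)%R).
Variables (x a b k : R).
Hypothesis taylor : forall y,
  (`|h (x + y) - h x - a * y - b * y ^+ 2| <= k * `|y| ^+ 3)%R.

Let mhX : measurable_fun setT (fun w => (h (x + X w))%:E).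
Proof.
by apply/measurable_EFinP; apply: measurableT_comp => //; exact: measurable_funD.
Qed.

Let ihX : P.-integrable setT (fun w => (h (x + X w))%:E).
Proof.
apply/integrableP; split => //.
apply: (@le_lt_trans _ _ (\int[P]_w (cst 1 w))); last first.
  by rewrite integral_cst//= probability_setT mule1 ltry.
apply: ge0_le_integral => //.
- exact: measurableT_comp.
- move=> w _ /=; rewrite lee_fin.
  by have /andP[h0 h1] := h01 (x + X w); rewrite ger0_norm.
Qed.

(** The linear Taylor term has mean 0 and the quadratic one mean [b], so the law of [X] enters only
    through [m3]. With [shift_mean_cubic_ge] for the Gaussian, this is one Lindeberg replacement. *)
Lemma shift_mean_cubic_le :
  shift_mean P X (EFin \o h) x <= (h x + b + k * m3)%:E.
Proof.
have [i <-] := cubic_mean (h x) a b k.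
apply: le_integral => // w _; rewrite /= lee_fin.
by have := taylor (X w); rewrite ler_norml => /andP[_]; lra.
Qed.

Lemma shift_mean_cubic_ge :
  (h x + b - k * m3)%:E <= shift_mean P X (EFin \o h) x.
Proof.
have [i E] := cubic_mean (h x) a b (- k); rewrite mulNr in E; rewrite -E.
apply: le_integral => // w _; rewrite /= lee_fin.
by have := taylor (X w); rewrite ler_norml => /andP[+ _]; lra.
Qed.

End third_moment.

Section central_limit.
Local Open Scope ereal_scope.
Context d (T : measurableType d) (R : realType) (P : probability T R).
Variables (X : nat -> T -> R) (mX : forall i, measurable_fun setT (X i)).
Hypothesis indepX : forall s A, uniq s -> (forall i, measurable (A i)) ->
  P [set w | forall i, i \in s -> A i (X i w)] = \prod_(i <- s) P (X i @^-1` A i).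
Hypothesis idX : forall i A, measurable A -> P (X i @^-1` A) = P (X 0%N @^-1` A).
Hypothesis iX1 : P.-integrable setT (fun w => (X 0%N w)%:E).
Hypothesis iX2 : P.-integrable setT (fun w => (X 0%N w ^+ 2)%:E).
Hypothesis iX3 : P.-integrable setT (fun w => (`|X 0%N w| ^+ 3)%:E).
Hypothesis X1 : \int[P]_w (X 0%N w)%:E = 0.
Hypothesis X2 : \int[P]_w (X 0%N w ^+ 2)%:E = 1.

Let S n w : R := (\sum_(i < n) X i w)%R.
Local Notation N01 := (@normal_prob R 0%R 1%R).

Let m3 : R := fine (\int[P]_w (`|X 0%N w| ^+ 3)%:E).
Let g3 : R := fine (\int[N01]_y (`|y| ^+ 3)%:E).

Let m3E : \int[P]_w (`|X 0%N w| ^+ 3)%:E = m3%:E.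
Proof. by rewrite fineK//; exact: integrable_fin_num. Qed.

Let pow4_bound (y : R) : (`|y| <= 1 + y ^+ 4)%R /\ (`|y| ^+ 3 <= 1 + y ^+ 4)%R.
Proof.
have -> : (y ^+ 4 = `|y| ^+ 4)%R by rewrite -normrX ger0_norm// exprn_even_ge0.
have := normr_ge0 y; move: (`|y|)%R => t t0.
have [t1|t1] := leP t 1%R.
  have := exprn_ge0 4 t0; have := exprn_ile1 3 t0 t1; split; lra.
have h1 : (t <= t ^+ 4)%R by rewrite ler_eXnr// ltW.
have h3 : (t ^+ 3 <= t ^+ 4)%R by rewrite ler_weXn2l// ltW.
by split; lra.
Qed.

Let gi1 : N01.-integrable setT (fun y : R => y%:E).
Proof.
apply: (@integrable_normal01_pow R idfun); first exact: measurable_id.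
by move=> y; case: (pow4_bound y).
Qed.

Let gi2 : N01.-integrable setT (fun y : R => (y ^+ 2)%:E).
Proof.
apply: (@integrable_normal01_pow R (fun y => y ^+ 2)%R) => //.
move=> y; rewrite ger0_norm ?sqr_ge0//; have := sqr_le_pow4 y.
by have := sqr_ge0 y; lra.
Qed.

Let gi3 : N01.-integrable setT (fun y : R => (`|y| ^+ 3)%:E).
Proof.
apply: (@integrable_normal01_pow R (fun y => `|y| ^+ 3)%R).
  by apply: measurable_funX; exact: normr_measurable.
move=> y; rewrite ger0_norm ?exprn_ge0//; by case: (pow4_bound y).
Qed.

Let g3E : \int[N01]_y (`|y| ^+ 3)%:E = g3%:E.
Proof. by rewrite fineK//; exact: integrable_fin_num. Qed.

Let C : R := (2 * (m3 + g3))%R.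

(** Scaling by [be] multiplies the Taylor remainder by |be|^3. Each of the [n.+1] replacements pays
    this remainder twice, once against [X] and once against the Gaussian, which explains [C]. *)
Lemma mean_spline_step_le n (al be : R) :
  \int[P]_w (spline_step (al + be * S n.+1 w))%:E <=
  \int[normal_prob 0%R (Num.sqrt n.+1%:R)]_y (spline_step (al + be * y))%:E +
  (n.+1%:R * (`|be| ^+ 3 * C))%:E.
Proof.
pose h (y : R) : R := spline_step (al + be * y).
have h01 y : (0 <= h y <= 1)%R by exact: spline_step01.
have mh : measurable_fun setT h.
  apply: measurableT_comp; first exact: measurable_spline_step.
  by apply: measurable_funD => //; exact: measurable_funM.
have mhE : measurable_fun setT (EFin \o h) by exact/measurable_EFinP.
have h0 y : 0 <= (EFin \o h) y by rewrite lee_fin; case/andP: (h01 y).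
have taylor x : exists a b, forall y,
    (`|h (x + y) - h x - a * y - b * y ^+ 2| <= (2 * `|be| ^+ 3) * `|y| ^+ 3)%R.
  have [a [b ab]] := spline_step_taylor (al + be * x).
  exists (a * be)%R, (b * be ^+ 2)%R => y.
  have -> : (2 * `|be| ^+ 3 * `|y| ^+ 3 = 2 * `|be * y| ^+ 3)%R by rewrite normrM; ring.
  rewrite /h mulrDr addrA; apply: le_trans (ab (be * y)%R).
  by rewrite le_eqVlt; apply/orP; left; apply/eqP; congr (`|_|)%R; ring.
have C0 : (0 <= `|be| ^+ 3 * C)%R.
  rewrite mulr_ge0 ?exprn_ge0// mulr_ge0// addr_ge0// fine_ge0//;
  by apply: integral_ge0 => ? _; rewrite lee_fin exprn_ge0.
have cmp x : shift_mean P (X 0%N) (EFin \o h) x <=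
    shift_mean N01 idfun (EFin \o h) x + (`|be| ^+ 3 * C)%:E.
  have [a [b ab]] := taylor x.
  have A := shift_mean_cubic_le (mX 0%N) iX1 iX2 iX3 X1 X2 m3E mh h01 ab.
  have B := shift_mean_cubic_ge (P := N01) (X := idfun) (@measurable_id _ _ _)
    gi1 gi2 gi3 (normal01_mean R) (normal01_variance R) g3E mh h01 ab.
  apply: (le_trans A); apply: le_trans (leeD2r _ B).
  by rewrite -EFinD lee_fin /C; lra.
rewrite (mean_partial_sum mX indepX idX n.+1 mhE h0).
have mid : measurable_fun setT (idfun : R -> R) by exact: measurable_id.
have := iter_shift_mean_compare (P := P) (Q := N01) (Z := idfun) (mX 0%N) mid n.+1
  mhE h0 C0 cmp 0%R.
rewrite (iter_normal_shift_mean n 0%R mhE h0) {2}/shift_mean.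
by under [X in _ <= X + _ -> _]eq_integral do rewrite add0r.
Qed.

Let C0 : (0 <= C)%R.
Proof.
rewrite mulr_ge0// addr_ge0// fine_ge0//;
by apply: integral_ge0 => ? _; rewrite lee_fin exprn_ge0.
Qed.

Let mS n : measurable_fun setT (S n).
Proof. exact: measurable_sum. Qed.

Let error_small (dl e : R) : (0 < dl)%R -> (0 < e)%R ->
  exists N, forall n, (N <= n)%N ->
    (n.+1%:R * (`|(dl * Num.sqrt n.+1%:R)^-1| ^+ 3 * C) <= e)%R.
Proof.
move=> dl0 e0.
(* With s the square root of n + 1, the error is C / (dl^3 s); it is at most e as soon as s >= B. *)
pose B := (C / (dl ^+ 3 * e))%R.
have B0 : (0 <= B)%R by rewrite divr_ge0// mulr_ge0 ?exprn_ge0 ?ltW.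
exists (truncn (B ^+ 2)).+1 => n Nn.
set s := Num.sqrt n.+1%:R.
have s0 : (0 < s)%R by rewrite sqrtr_gt0.
have s2 : (n.+1%:R = s ^+ 2)%R by rewrite sqr_sqrtr.
have Bs : (B <= s)%R.
  rewrite -(@ler_pXn2r _ 2)// ?nnegrE ?(ltW s0)// -s2.
  rewrite ltW// (lt_le_trans (truncnS_gt _))// ler_nat.
  exact: leq_trans Nn _.
rewrite ger0_norm; last by rewrite invr_ge0 mulr_ge0 ?ltW.
rewrite s2 (_ : (_ * (_ * _) = C / (dl ^+ 3 * s))%R); last first.
  by field; rewrite !gt_eqF.
rewrite ler_pdivrMr; last by rewrite mulr_gt0// exprn_gt0.
move: Bs; rewrite /B ler_pdivrMr; last by rewrite mulr_gt0// exprn_gt0.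
by move/le_trans; apply; rewrite le_eqVlt; apply/orP; left; apply/eqP; ring.
Qed.

Lemma clt_cdf_le (x e : R) : (0 < e)%R -> exists N, forall n, (N <= n)%N ->
  P [set w | (S n.+1 w <= Num.sqrt n.+1%:R * x)%R] <=
  N01 [set y | (y <= x)%R] + e%:E.
Proof.
move=> e0; set pk := @normal_peak R 1.
have pk0 : (0 <= pk)%R by exact: normal_peak_ge0.
(* The smoothing window has width 3 dl and costs at most 3 dl pk <= e / 2 by the Lipschitz bound;
   the other e / 2 is left for the replacement error. The added 1 keeps the denominator positive. *)
pose dl := (e / (6 * (pk + 1)))%R.
have dl0 : (0 < dl)%R by rewrite divr_gt0// mulr_gt0// ltr_wpDl.
have [N HN] := error_small dl0 (divr_gt0 e0 (ltr0n R 2)).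
exists N => n Nn; set s := Num.sqrt n.+1%:R.
have s0 : (0 < s)%R by rewrite sqrtr_gt0.
have ds : (0 < dl * s)%R by exact: mulr_gt0.
(* The spline then decreases in y, from 1 for y <= s x to 0 for y >= s (x + 3 dl); it lies between
   the two indicators. *)
pose al := ((x + 3 * dl) / dl)%R; pose be := (- (dl * s)^-1)%R.
have alE y : (al + be * y = (s * (x + 3 * dl) - y) / (dl * s))%R.
  by rewrite /al /be; field; rewrite !gt_eqF.
have q0 t : (0 <= @spline_step R t)%R by case/andP: (spline_step01 t).
have q1 t : (@spline_step R t <= 1)%R by case/andP: (spline_step01 t).
apply: (@le_trans _ _ (\int[P]_w (spline_step (al + be * S n.+1 w))%:E)).
  have mA : measurable [set w | (S n.+1 w <= s * x)%R].
    rewrite -[X in measurable X]setTI.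
    exact: (mS n.+1 measurableT (measurable_le_itv (s * x)%R)).
  rewrite -[X in P X]setIT -integral_indic//; apply: ge0_le_integral => //.
  - by apply/measurable_EFinP; exact: measurable_indic.
  - apply/measurable_EFinP; apply: measurableT_comp; first exact: measurable_spline_step.
    by apply: measurable_funD => //; exact: measurable_funM.
  - move=> w _; rewrite lee_fin indicE.
    have [wA|wA] := pselect (S n.+1 w <= s * x)%R; last by rewrite memNset.
    rewrite mem_set// spline_step_ge3// alE ler_pdivlMr//; lra.
apply: le_trans (mean_spline_step_le n al be) _.
rewrite /be normrN.
apply: (@le_trans _ _ (N01 [set y | (y <= x + 3 * dl)%R] + (e / 2)%:E)).
  apply: leeD; last by rewrite lee_fin; exact: HN.
  rewrite -(normal_prob_scale (x + 3 * dl) s0).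
  rewrite -(setIT [set y | (y <= s * _)%R]).
  rewrite -(integral_indic (normal_prob 0%R s) measurableT (measurable_le_itv _)).
  apply: ge0_le_integral => //.
  - by move=> y _; rewrite lee_fin.
  - apply/measurable_EFinP; apply: measurableT_comp; first exact: measurable_spline_step.
    by apply: measurable_funD => //; exact: measurable_funM.
  - apply/measurable_EFinP; apply: measurable_indic; exact: measurable_le_itv.
  - move=> y _; rewrite lee_fin indicE.
    have [yA|yA] := leP y (s * (x + 3 * dl))%R; first by rewrite mem_set.
    rewrite memNset /=; last by apply/negP; rewrite -ltNge.
    rewrite spline_step_le0// alE.
    by rewrite ler_pdivrMr// mul0r; lra.
have xd : (x <= x + 3 * dl)%R by rewrite lerDl mulr_ge0 ?ltW.
apply: le_trans (leeD2r _ (normal_prob_lip xd)) _.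
rewrite -addeA leeD2l// -EFinD lee_fin -/pk (addrC x) addrK.
have : (6 * (pk + 1) * dl = e)%R by rewrite /dl; field; rewrite gt_eqF// ltr_wpDl.
by have := mulr_ge0 pk0 (ltW dl0); lra.
Qed.

End central_limit.

Section iid_comp.
Local Open Scope ereal_scope.
Context d (T : measurableType d) (R : realType) (P : probability T R).
Context d' (T' : measurableType d').
Variables (X : nat -> T -> T').
Variables (h : T' -> R) (mh : measurable_fun setT h).

Let mhA (A : set R) : measurable A -> measurable (h @^-1` A).
Proof. by move=> mA; rewrite -[X in measurable X]setTI; exact: mh. Qed.

Lemma indep_comp :
  (forall s A, uniq s -> (forall i, measurable (A i)) ->
    P [set w | forall i, i \in s -> A i (X i w)] =
    \prod_(i <- s) P (X i @^-1` A i)) ->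
  forall s A, uniq s -> (forall i, measurable (A i)) ->
    P [set w | forall i, i \in s -> A i (h (X i w))] =
    \prod_(i <- s) P ((fun w => h (X i w)) @^-1` A i).
Proof.
move=> indepX s A us mA.
by rewrite (indepX s (fun i => h @^-1` A i) us (fun i => mhA (mA i))).
Qed.

Lemma ident_comp :
  (forall i A, measurable A -> P (X i @^-1` A) = P (X 0%N @^-1` A)) ->
  forall i A, measurable A ->
    P ((fun w => h (X i w)) @^-1` A) = P ((fun w => h (X 0%N w)) @^-1` A).
Proof. by move=> idX i A mA; exact: (idX i _ (mhA mA)). Qed.

End iid_comp.

Section central_limit_lower.
Local Open Scope ereal_scope.
Context d (T : measurableType d) (R : realType) (P : probability T R).
Variables (X : nat -> T -> R) (mX : forall i, measurable_fun setT (X i)).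
Hypothesis indepX : forall s A, uniq s -> (forall i, measurable (A i)) ->
  P [set w | forall i, i \in s -> A i (X i w)] = \prod_(i <- s) P (X i @^-1` A i).
Hypothesis idX : forall i A, measurable A -> P (X i @^-1` A) = P (X 0%N @^-1` A).
Hypothesis iX1 : P.-integrable setT (fun w => (X 0%N w)%:E).
Hypothesis iX2 : P.-integrable setT (fun w => (X 0%N w ^+ 2)%:E).
Hypothesis iX3 : P.-integrable setT (fun w => (`|X 0%N w| ^+ 3)%:E).
Hypothesis X1 : \int[P]_w (X 0%N w)%:E = 0.
Hypothesis X2 : \int[P]_w (X 0%N w ^+ 2)%:E = 1.

Let S n w : R := (\sum_(i < n) X i w)%R.
Local Notation N01 := (@normal_prob R 0%R 1%R).

Lemma normal01_geE (x : R) :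
  N01 [set y | (x <= y)%R] = N01 [set y | (y <= - x)%R].
Proof.
have mge : measurable [set y : R | (x <= y)%R].
  by rewrite -set_itvcy; exact: measurable_itv.
rewrite -(setIT [set y | (x <= y)%R]) -(setIT [set y | (y <= - x)%R]).
rewrite -(integral_indic N01 measurableT mge).
rewrite -(integral_indic N01 measurableT (measurable_le_itv _)).
have m1 : measurable_fun setT (fun y : R => (\1_[set y : R | (x <= y)%R] y)%:E : \bar R).
  by apply/measurable_EFinP; exact: measurable_indic.
have p1 (y : R) : 0 <= (\1_[set y : R | (x <= y)%R] y)%:E :> \bar R by rewrite lee_fin.
rewrite -(ge0_integral_normal01N m1 p1).
apply: eq_integral => y _; rewrite !indicE; congr (_%:R)%:E; congr nat_of_bool.
by apply/idP/idP; rewrite !inE /= lerNr.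
Qed.

(** Apply [clt_cdf_le] to - X at - x: it bounds the complementary event by the normal mass above
    x. *)
Lemma clt_cdf_ge (x e : R) : (0 < e)%R -> exists N, forall n, (N <= n)%N ->
  N01 [set y | (y <= x)%R] <=
  P [set w | (S n.+1 w <= Num.sqrt n.+1%:R * x)%R] + e%:E.
Proof.
move=> e0; set pk := @normal_peak R 1.
have pk0 : (0 <= pk)%R by exact: normal_peak_ge0.
have mN : measurable_fun setT (-%R : R -> R) by [].
pose X' i w := (- X i w)%R.
have mX' i : measurable_fun setT (X' i) by exact: measurableT_comp.
have iN1 : P.-integrable setT (fun w => (X' 0%N w)%:E).
  by under eq_fun do rewrite EFinN; exact: integrableN.
have iN2 : P.-integrable setT (fun w => (X' 0%N w ^+ 2)%:E).
  by under eq_fun do rewrite sqrrN.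
have iN3 : P.-integrable setT (fun w => (`|X' 0%N w| ^+ 3)%:E).
  by under eq_fun do rewrite normrN.
have N1 : \int[P]_w (X' 0%N w)%:E = 0.
  by under eq_integral do rewrite EFinN; rewrite integralN ?X1 ?oppe0//;
  exact: integrable_add_def.
have N2 : \int[P]_w (X' 0%N w ^+ 2)%:E = 1.
  by under eq_integral do rewrite sqrrN.
have e20 : (0 < e / 2)%R by rewrite divr_gt0.
have [N HN] := clt_cdf_le mX' (indep_comp mN indepX) (ident_comp mN idX)
  iN1 iN2 iN3 N1 N2 (- x)%R e20.
exists N => n Nn; set s := Num.sqrt n.+1%:R.
have mS : measurable_fun setT (S n.+1) by exact: measurable_sum.
have mA : measurable [set w | (S n.+1 w <= s * x)%R].
  by rewrite -[X in measurable X]setTI; exact: (mS measurableT _ (measurable_le_itv (s * x)%R)).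
have mB : measurable [set y : R | (x - e / (2 * (pk + 1)) < y)%R].
  by rewrite -set_itvoy; exact: measurable_itv.
have h1 : P (~` [set w | (S n.+1 w <= s * x)%R]) <=
    N01 [set y | (y <= - x)%R] + (e / 2)%:E.
  apply: le_trans (HN n Nn); apply: le_measure; rewrite ?inE//.
  - exact: measurableC.
  - have mS' : measurable_fun setT (fun w => \sum_(i < n.+1) X' i w)%R.
      exact: measurable_sum.
    by rewrite -[X in measurable X]setTI; exact: (mS' measurableT _ (measurable_le_itv (s * - x)%R)).
  - move=> w /= /negP; rewrite -ltNge => h.
    by rewrite /X' sumrN mulrN lerN2 ltW.
rewrite probability_setC// -normal01_geE in h1.
(* A point strictly below x makes {y >= x} and {y <= a} disjoint; the gap x - a costs at most e /
   2. *)
set a := (x - e / (2 * (pk + 1)))%R.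
have d0 : (0 < e / (2 * (pk + 1)))%R by rewrite divr_gt0// mulr_gt0// ltr_wpDl.
have ax : (a < x)%R by rewrite /a ltrBlDr ltrDl.
have h2 : N01 [set y | (x <= y)%R] <= 1 - N01 [set y | (y <= a)%R].
  rewrite -(probability_setC N01 (measurable_le_itv a)); apply: le_measure; rewrite ?inE.
  - by rewrite -set_itvcy; exact: measurable_itv.
  - by apply: measurableC; exact: measurable_le_itv.
  - by move=> y /= xy; apply/negP; rewrite -ltNge (lt_le_trans ax).
have h3 := normal_prob_lip (ltW ax).
have fP (A : set T) : measurable A -> P A = (fine (P A))%:E.
  by move=> mA'; rewrite fineK// fin_num_measure.
have fN (A : set R) : measurable A -> N01 A = (fine (N01 A))%:E.
  by move=> mA'; rewrite fineK// fin_num_measure.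
move: h1 h2 h3; rewrite (fP _ mA) (fN _ (measurable_le_itv a)) (fN _ (measurable_le_itv x)).
rewrite (fN [set y | (x <= y)%R]); last by rewrite -set_itvcy; exact: measurable_itv.
rewrite -!EFinB -!EFinD !lee_fin -/pk => h1 h2 h3.
have : (pk * (x - a) <= e / 2)%R.
  rewrite /a opprB addrCA subrr addr0 mulrA ler_pdivrMr ?mulr_gt0 ?ltr_wpDl//.
  rewrite (_ : (_ * (2 * _) = e * (pk + 1))%R); last by field.
  by rewrite mulrC ler_pM2l// lerDl.
by move: h1 h2 h3; lra.
Qed.

End central_limit_lower.

(** * The weak law of large numbers *)

Section weak_law.
Local Open Scope ereal_scope.
Context d (T : measurableType d) (R : realType) (P : probability T R).
Variables (X : nat -> T -> R) (mX : forall i, measurable_fun setT (X i)).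
Hypothesis indepX : forall s A, uniq s -> (forall i, measurable (A i)) ->
  P [set w | forall i, i \in s -> A i (X i w)] = \prod_(i <- s) P (X i @^-1` A i).
Hypothesis idX : forall i A, measurable A -> P (X i @^-1` A) = P (X 0%N @^-1` A).
Hypothesis iX1 : P.-integrable setT (fun w => (X 0%N w)%:E).
Hypothesis iX2 : P.-integrable setT (fun w => (X 0%N w ^+ 2)%:E).
Hypothesis X1 : \int[P]_w (X 0%N w)%:E = 0.

Let S n w : R := (\sum_(i < n) X i w)%R.

(** Chebyshev's inequality by the same operator comparison, with the increment 0 in place of the
    Gaussian: each step raises the mean of a truncated square by at most v / c^2, and n + 1 steps by
    v / ((n + 1) e^2). *)
Lemma weak_law (e eta : R) : (0 < e)%R -> (0 < eta)%R ->
  exists N, forall n, (N <= n)%N ->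
  P [set w | (n.+1%:R * e <= `|S n.+1 w|)%R] <= eta%:E.
Proof.
move=> e0 eta0.
pose v : R := fine (\int[P]_w (X 0%N w ^+ 2)%:E).
have vE : \int[P]_w (X 0%N w ^+ 2)%:E = v%:E.
  by rewrite fineK//; exact: integrable_fin_num.
have v0 : (0 <= v)%R.
  by rewrite fine_ge0//; apply: integral_ge0 => w _; rewrite lee_fin sqr_ge0.
exists (truncn (v / (e ^+ 2 * eta))).+1 => n Nn.
set c := (n.+1%:R * e)%R; have c0 : (0 < c)%R by rewrite mulr_gt0.
(* The square is truncated at 1: [f] is bounded and still dominates the indicator of |y| >= c. *)
pose f (y : R) : R := (Num.min ((y / c) ^+ 2) 1)%R.
have f0 y : (0 <= f y)%R by rewrite le_min sqr_ge0 ler01.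
have mf : measurable_fun setT f.
  by apply: measurable_minr => //; apply: measurable_funX; exact: measurable_funM.
have mfE : measurable_fun setT (EFin \o f) by exact/measurable_EFinP.
have f0E y : 0 <= (EFin \o f) y by rewrite lee_fin.
(* Below the truncation level the square is expanded exactly; above it, [f x] is already the maximum
   1 and slope 0 works. *)
have taylor x : exists a, forall y, (f (x + y) <= f x + a * y + c ^- 2 * y ^+ 2)%R.
  rewrite {2}/f; have [x1|x1] := leP ((x / c) ^+ 2)%R 1%R.
    exists (2 * x / c ^+ 2)%R => y; rewrite /f ge_min; apply/orP; left.
    by rewrite le_eqVlt; apply/orP; left; apply/eqP; field; rewrite gt_eqF.
  exists 0%R => y; rewrite mul0r addr0 (@le_trans _ _ 1%R) ?ge_min ?lexx ?orbT//.
  by rewrite lerDl mulr_ge0 ?sqr_ge0// invr_ge0 sqr_ge0.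
have q0 : (0 <= c ^- 2 * v)%R by rewrite mulr_ge0// invr_ge0 sqr_ge0.
have m0 : measurable_fun setT (cst 0%R : T -> R) by [].
have idE : shift_mean P (cst 0%R) (EFin \o f) = EFin \o f.
  apply/funext => x; rewrite /shift_mean.
  under eq_integral do rewrite addr0.
  by rewrite integral_cst//= probability_setT mule1.
have cmp x : shift_mean P (X 0%N) (EFin \o f) x <=
    shift_mean P (cst 0%R) (EFin \o f) x + (c ^- 2 * v)%:E.
  rewrite idE; have [a ta] := taylor x.
  have i0 : P.-integrable setT (fun=> (f x)%:E) by exact: finite_measure_integrable_cst.
  have ia : P.-integrable setT (fun w => a%:E * (X 0%N w)%:E) by exact: integrableZl.
  have ib : P.-integrable setT (fun w => (c ^- 2)%:E * (X 0%N w ^+ 2)%:E).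
    exact: integrableZl.
  have i0a := integrableD measurableT i0 ia.
  have i0ab := integrableD measurableT i0a ib.
  apply: (@le_trans _ _ (\int[P]_w
      ((f x)%:E + a%:E * (X 0%N w)%:E + (c ^- 2)%:E * (X 0%N w ^+ 2)%:E))).
    apply: ge0_le_integral => //.
    - apply: (measurable_fun_shift (mX 0%N)); exact: mfE.
    - exact: measurable_int i0ab.
    - by move=> w _; rewrite -!EFinM -!EFinD lee_fin; exact: ta.
  rewrite integralD// integralD// integral_cst//= probability_setT mule1.
  by rewrite !integralZl// X1 vE mule0 adde0 -EFinM -EFinD.
have := iter_shift_mean_compare (mX 0%N) m0 n.+1 mfE f0E q0 cmp 0%R.
rewrite -(mean_partial_sum mX indepX idX n.+1 mfE f0E).
have -> : iter n.+1 (shift_mean P (cst 0%R)) (EFin \o f) = EFin \o f.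
  by elim: (n.+1) => [//|k IH]; rewrite iterS IH idE.
have mS : measurable_fun setT (S n.+1) by exact: measurable_sum.
have mA : measurable [set w | (c <= `|S n.+1 w|)%R].
  rewrite -[X in measurable X]setTI.
  have mge : measurable [set y : R | (c <= y)%R].
    by rewrite -set_itvcy; exact: measurable_itv.
  have mnS : measurable_fun setT (fun w => `|S n.+1 w|)%R by exact: measurableT_comp.
  exact: (mnS measurableT _ mge).
move=> H; apply: (@le_trans _ _ (\int[P]_w (EFin \o f) (S n.+1 w))).
  rewrite -[X in P X]setIT -integral_indic//; apply: ge0_le_integral => //.
  - by apply/measurable_EFinP; exact: measurable_indic.
  - exact: measurableT_comp.
  - move=> w _; rewrite /= lee_fin indicE.
    have [wA|wA] := pselect (c <= `|S n.+1 w|)%R; last by rewrite memNset//=.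
    rewrite mem_set//= /f le_min lexx andbT -(real_normK (num_real _)) normf_div.
    rewrite expr_ge1// ?divr_ge0// (gtr0_norm c0) ler_pdivlMr// mul1r//.
apply: le_trans H _; rewrite /= /f mul0r expr0n/= min_l// add0e lee_fin.
rewrite (_ : (_ * _ = v / (n.+1%:R * e ^+ 2))%R); last first.
  have : (0 < n.+1%:R :> R)%R by rewrite ltr0n.
  by rewrite /c; move: (n.+1%:R : R)%R => t t0; field; rewrite !gt_eqF.
rewrite ler_pdivrMr ?mulr_gt0 ?exprn_gt0//.
have : (v / (e ^+ 2 * eta) <= n.+1%:R)%R.
  rewrite ltW// (lt_le_trans (truncnS_gt _))// ler_nat.
  exact: leq_trans Nn _.
rewrite ler_pdivrMr; last by rewrite mulr_gt0// exprn_gt0.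
by move/le_trans; apply; rewrite le_eqVlt; apply/orP; left; apply/eqP; ring.
Qed.

End weak_law.

(** * Studentization *)

(** Here [m] is the sample size, [q] the sum of squares and [s] the sum. The condition on [m] gives
    e (m - 1) >= 1, which absorbs the passage from m to m - 1; the bounds are the squares of 1 + 3e
    and 1 - 3e, so the root can be taken directly. *)
Lemma student_ratio (R : realType) (m q s e : R) :
  0 < e -> e <= 10^-1 -> 1 + e^-1 <= m -> `|q - m| <= m * e -> `|s| <= m * e ->
  `|Num.sqrt ((q - s ^+ 2 / m) / (m - 1)) - 1| <= 3 * e.
Proof.
move=> e0 e10 em qm sm.
have ei0 : 0 < e^-1 by rewrite invr_gt0.
have m1 : 0 < m - 1 by lra.
have m0 : 0 < m by lra.
have em1 : 1 <= e * (m - 1) by rewrite mulrC -ler_pdivrMr// mul1r; lra.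
have s2 : s ^+ 2 / m <= m * e ^+ 2.
  rewrite ler_pdivrMr// -(real_normK (num_real s)).
  rewrite (_ : m * e ^+ 2 * m = (m * e) ^+ 2); last by ring.
  by apply: lerXn2r; rewrite ?nnegrE// mulr_ge0 ?ltW.
have s20 : 0 <= s ^+ 2 / m by rewrite divr_ge0 ?sqr_ge0 ?ltW.
move: qm; rewrite ler_norml => /andP[qm1 qm2].
have ub : (q - s ^+ 2 / m) / (m - 1) <= (1 + 3 * e) ^+ 2.
  rewrite ler_pdivrMr//.
  have h : 0 <= (e * (m - 1) - 1) * (1 + e) by rewrite mulr_ge0; lra.
  have h2 : 0 <= (m - 1) * (4 * e + 8 * e ^+ 2).
    by rewrite mulr_ge0 ?(ltW m1)// addr_ge0 ?mulr_ge0 ?sqr_ge0 ?ltW.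
  have -> : (1 + 3 * e) ^+ 2 * (m - 1) = m * (1 + e) + (e * (m - 1) - 1) * (1 + e)
     + (m - 1) * (4 * e + 8 * e ^+ 2) by ring.
  by lra.
have lb : (1 - 3 * e) ^+ 2 <= (q - s ^+ 2 / m) / (m - 1).
  rewrite ler_pdivlMr//.
  (* The numerator is at least m (1 - e - e^2), and the difference of the two sides is 5 e (1 - 2
     e), nonnegative because e <= 1/10. *)
  have h1 : (1 - 3 * e) ^+ 2 <= 1 - e - e ^+ 2.
    rewrite -subr_ge0 (_ : _ - _ = 5 * e * (1 - 2 * e)); last by ring.
    by rewrite mulr_ge0 ?mulr_ge0 ?(ltW e0)//; lra.
  have h2 : (1 - 3 * e) ^+ 2 * (m - 1) <= (1 - e - e ^+ 2) * (m - 1).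
    by rewrite ler_wpM2r// ltW.
  apply: le_trans h2 _.
  have h3 : 0 <= 1 - e - e ^+ 2 by apply: le_trans h1; exact: sqr_ge0.
  have -> : (1 - e - e ^+ 2) * (m - 1) = m - m * e - m * e ^+ 2 - (1 - e - e ^+ 2) by ring.
  by lra.
have e3 : 0 <= 1 - 3 * e by lra.
have e4 : 0 <= 1 + 3 * e by lra.
rewrite ler_norml; apply/andP; split.
  have := ler_wsqrtr lb; rewrite sqrtr_sqr ger0_norm//; lra.
have := ler_wsqrtr ub; rewrite sqrtr_sqr ger0_norm//; lra.
Qed.

Section studentized.
Local Open Scope ereal_scope.
Context d (T : measurableType d) (R : realType) (P : probability T R).

(** The shape of [T_stat] for arbitrary summands: for [k.+2], [T_stat] unfolds to it. The limit
    theorem can thus be proved away from the GEV law. *)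
Definition student_stat (eta : R) (D : nat -> T -> R) (n : nat) (w : T) : R :=
  let Dbar := (n%:R^-1 * \sum_(i < n) D i w)%R in
  let S2 := ((\sum_(i < n) (D i w - Dbar) ^+ 2) / (n%:R - 1))%R in
  (Num.sqrt n%:R * (Dbar - eta) / Num.sqrt S2)%R.

Lemma measurable_sqrtV (f : T -> R) : measurable_fun setT f ->
  measurable_fun setT (fun w => (Num.sqrt (f w))^-1)%R.
Proof.
move=> mf.
(* Where [f w <= 0] both sides are 0: the inverse of 0 is 0, and so is 0 raised to a nonzero
   power. *)
have -> : (fun w => (Num.sqrt (f w))^-1)%R = (fun w => Num.max (f w) 0 `^ (- 2^-1))%R.
  apply/funext => w; have [f0|f0] := leP (f w) 0%R.
    by rewrite ler0_sqrtr// invr0 powR0// oppr_eq0 invr_eq0.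
  by rewrite powRN powR12_sqrt// ltW.
apply: (@measurableT_comp _ _ _ _ _ _ (fun y => y `^ (- 2^-1))%R); first exact: measurable_powR.
exact: measurable_maxr.
Qed.

Lemma measurable_student_stat eta D n : (forall i, measurable_fun setT (D i)) ->
  measurable_fun setT (student_stat eta D n).
Proof.
move=> mD; have mbar : measurable_fun setT (fun w => n%:R^-1 * \sum_(i < n) D i w)%R.
  by apply: measurable_funM => //; exact: measurable_sum.
apply: measurable_funM.
  by apply: measurable_funM => //; exact: measurable_funB.
apply: measurable_sqrtV; apply: measurable_funM => //.
apply: measurable_sum => i; apply: measurable_funX; exact: measurable_funB.
Qed.

Variables (X : nat -> T -> R) (mX : forall i, measurable_fun setT (X i)).
Hypothesis indepX : forall s A, uniq s -> (forall i, measurable (A i)) ->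
  P [set w | forall i, i \in s -> A i (X i w)] = \prod_(i <- s) P (X i @^-1` A i).
Hypothesis idX : forall i A, measurable A -> P (X i @^-1` A) = P (X 0%N @^-1` A).
Hypothesis iX1 : P.-integrable setT (fun w => (X 0%N w)%:E).
Hypothesis iX2 : P.-integrable setT (fun w => (X 0%N w ^+ 2)%:E).
Hypothesis iX3 : P.-integrable setT (fun w => (`|X 0%N w| ^+ 3)%:E).
Hypothesis iX4 : P.-integrable setT (fun w => (X 0%N w ^+ 4)%:E).
Hypothesis X1 : \int[P]_w (X 0%N w)%:E = 0.
Hypothesis X2 : \int[P]_w (X 0%N w ^+ 2)%:E = 1.

Local Notation N01 := (@normal_prob R 0%R 1%R).
Let S n w : R := (\sum_(i < n) X i w)%R.
Let V i w : R := (X i w ^+ 2 - 1)%R.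
Let Q n w : R := (\sum_(i < n) V i w)%R.

Variables (eta tau : R) (tau0 : (0 < tau)%R).
Let D i w : R := (eta + tau * X i w)%R.

(** Centring at [eta] and scaling by [tau] cancel in the ratio. The sum of squares is expressed by
    the centred sum [Q], to which the weak law applies. *)
Let student_statE n w : student_stat eta D n.+1 w =
  (S n.+1 w / (Num.sqrt n.+1%:R * Num.sqrt
    ((Q n.+1 w + n.+1%:R - S n.+1 w ^+ 2 / n.+1%:R) / (n.+1%:R - 1))))%R.
Proof.
have n0 : (0 < n.+1%:R :> R)%R by rewrite ltr0n.
have sqn : (n.+1%:R = Num.sqrt n.+1%:R * Num.sqrt n.+1%:R :> R)%R.
  by rewrite -expr2 sqr_sqrtr// ltW.
have sq0 : (0 < Num.sqrt n.+1%:R :> R)%R by rewrite sqrtr_gt0.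
rewrite /student_stat.
have -> : (n.+1%:R^-1 * \sum_(i < n.+1) D i w = eta + tau * (S n.+1 w / n.+1%:R))%R.
  rewrite /D big_split/= -mulr_sumr sumr_const card_ord -/(S n.+1 w) -mulr_natr.
  by field; rewrite gt_eqF.
have -> : (\sum_(i < n.+1) (D i w - (eta + tau * (S n.+1 w / n.+1%:R))) ^+ 2 =
    tau ^+ 2 * (Q n.+1 w + n.+1%:R - S n.+1 w ^+ 2 / n.+1%:R))%R.
  pose c := (S n.+1 w / n.+1%:R)%R.
  transitivity (\sum_(i < n.+1) (tau ^+ 2 * V i w + tau ^+ 2 * (1 + c ^+ 2)
      - 2 * tau ^+ 2 * c * X i w))%R.
    by apply: eq_bigr => i _; rewrite /D /V -/c; ring.
  rewrite big_split/= sumrN big_split/= -!mulr_sumr sumr_const card_ord.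
  rewrite -/(S n.+1 w) -/(Q n.+1 w) -mulr_natr /c.
  by field; rewrite gt_eqF.
have -> (a b : R) : (Num.sqrt (tau ^+ 2 * a / b) = tau * Num.sqrt (a / b))%R.
  by rewrite -mulrA sqrtrM ?sqr_ge0// sqrtr_sqr gtr0_norm.
rewrite addrAC subrr add0r !invfM.
move: (Num.sqrt (_ / _))^-1%R => r.
rewrite [X in (_ * (_ * (_ / X)))%R]sqn.
move: (Num.sqrt n.+1%:R)%R sq0 => t t0.
by field; rewrite !gt_eqF.
Qed.

Let mD i : measurable_fun setT (D i).
Proof. by apply: measurable_funD => //; exact: measurable_funM. Qed.

Let mS n : measurable_fun setT (S n).
Proof. exact: measurable_sum. Qed.

Let mV i : measurable_fun setT (V i).
Proof. by apply: measurable_funB => //; exact: measurable_funX. Qed.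

Let mQ n : measurable_fun setT (Q n).
Proof. exact: measurable_sum. Qed.

Let i_cst (c : R) : P.-integrable setT (fun=> c%:E).
Proof. exact: finite_measure_integrable_cst. Qed.

Let iV1 : P.-integrable setT (fun w => (V 0%N w)%:E).
Proof. by under eq_fun do rewrite /V EFinB; exact: integrableB. Qed.

Let iV2 : P.-integrable setT (fun w => (V 0%N w ^+ 2)%:E).
Proof.
have -> : (fun w => (V 0%N w ^+ 2)%:E) =
    (fun w => (X 0%N w ^+ 4)%:E - 2%:E * (X 0%N w ^+ 2)%:E + 1%:E).
  by apply/funext => w; rewrite -EFinM -EFinB -EFinD /V; congr EFin; ring.
apply: integrableD => //; apply: integrableB => //; exact: integrableZl.
Qed.

Let V1 : \int[P]_w (V 0%N w)%:E = 0.
Proof.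
under eq_integral do rewrite /V EFinB.
rewrite (integralB measurableT iX2 (i_cst 1%R)).
by rewrite X2 integral_cst//= probability_setT mule1 subee.
Qed.

Let mVh : measurable_fun setT (fun x : R => x ^+ 2 - 1)%R.
Proof. by apply: measurable_funB => //; exact: measurable_funX. Qed.

(** Off two rare events the statistic is at most x exactly when [S] is at most x rho times the root
    of m, with x rho within [kap] of x. The distribution function is thus caught between those of
    [S] at x - kap and x + kap. The error e splits into quarters: two rare events, the limit
    theorem, the displacement [kap]. *)
Lemma studentized_clt (x e : R) : (0 < e)%R -> exists N, forall n, (N <= n)%N ->
  P [set w | (student_stat eta D n.+1 w <= x)%R] <= N01 [set y | (y <= x)%R] + e%:E /\
  N01 [set y | (y <= x)%R] <= P [set w | (student_stat eta D n.+1 w <= x)%R] + e%:E.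
Proof.
move=> e0; set pk := @normal_peak R 1.
have pk0 : (0 <= pk)%R by exact: normal_peak_ge0.
(* Chosen so that ep K <= e gives pk kap = 3 ep |x| pk <= e / 4, whence the factor 12. *)
pose K := (12 * (`|x| + 1) * (pk + 1))%R.
have K0 : (0 < K)%R by rewrite /K !mulr_gt0// ltr_wpDl.
pose ep : R := Num.min 10^-1%R (e / K)%R.
have ep0 : (0 < ep)%R by rewrite /ep lt_min invr_gt0 divr_gt0// ltr0n.
have ep10 : (ep <= 10^-1)%R by rewrite /ep ge_min lexx.
have epK : (ep * K <= e)%R by rewrite -ler_pdivlMr// /ep ge_min lexx orbT.
pose kap := (3 * ep * `|x|)%R.
have kap0 : (0 <= kap)%R by rewrite !mulr_ge0// ltW.
have pkkap : (pk * kap <= e / 4)%R.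
  have -> : (pk * kap = 3 * (ep * (`|x| * pk)))%R by rewrite /kap; ring.
  have h : (ep * (12 * (`|x| * pk)) <= ep * K)%R.
    rewrite ler_pM2l// /K -mulrA ler_pM2l// mulrDl mul1r mulrDr mulr1 -addrA lerDl.
    by rewrite addr_ge0// addr_ge0.
  by move: (le_trans h epK); rewrite mulrCA; lra.
have e4 : (0 < e / 4)%R by rewrite divr_gt0.
have [N1 HN1] := weak_law mV (indep_comp mVh indepX) (ident_comp mVh idX) iV1 iV2 V1 ep0 e4.
have [N2 HN2] := weak_law mX indepX idX iX1 iX2 X1 ep0 e4.
have [N3 HN3] := clt_cdf_le mX indepX idX iX1 iX2 iX3 X1 X2 (x + kap)%R e4.
have [N4 HN4] := clt_cdf_ge mX indepX idX iX1 iX2 iX3 X1 X2 (x - kap)%R e4.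
(* The last threshold ensures the sample-size condition of [student_ratio]. *)
exists (maxn N1 (maxn N2 (maxn N3 (maxn N4 (truncn (1 + ep^-1)%R).+1)))) => n.
rewrite !geq_max => /and5P[/HN1{}HN1 /HN2{}HN2 /HN3{}HN3 /HN4{}HN4 Nn].
have mn : (1 + ep^-1 <= n.+1%:R)%R.
  by rewrite ltW// (lt_le_trans (truncnS_gt _))// ler_nat leqW.
set m : R := n.+1%:R in mn HN2 HN3 HN4 *.
pose B1 := [set w | (m * ep <= `|Q n.+1 w|)%R].
pose B2 := [set w | (m * ep <= `|S n.+1 w|)%R].
have m0 : (0 < m)%R by rewrite ltr0n.
have sm0 : (0 < Num.sqrt m)%R by rewrite sqrtr_gt0.
have good w : ~ B1 w -> ~ B2 w -> exists2 rho : R, (0 < rho)%R &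
    (student_stat eta D n.+1 w = S n.+1 w / (Num.sqrt m * rho) /\
     x - kap <= x * rho /\ x * rho <= x + kap)%R.
  move=> /negP; rewrite -ltNge => b1 /negP; rewrite -ltNge => b2.
  have := @student_ratio R m (Q n.+1 w + m) (S n.+1 w) ep ep0 ep10 mn.
  rewrite addrK => /(_ (ltW b1) (ltW b2)).
  set rho := Num.sqrt _ => hr.
  exists rho; first by move: hr; rewrite ler_norml => /andP[]; lra.
  split; first by rewrite student_statE.
  have : (`|x * rho - x| <= kap)%R.
    rewrite -[X in (_ - X)%R]mulr1 -mulrBr normrM /kap mulrC.
    by rewrite ler_wpM2r.
  by rewrite ler_norml => /andP[]; lra.
have mge (f : T -> R) (c : R) : measurable_fun setT f -> measurable [set w | (c <= `|f w|)%R].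
  move=> mf; have mgc : measurable [set y : R | (c <= y)%R].
    by rewrite -set_itvcy; exact: measurable_itv.
  have mnf : measurable_fun setT (fun w => `|f w|)%R by exact: measurableT_comp.
  by rewrite -[X in measurable X]setTI; exact: (mnf measurableT _ mgc).
have mle (f : T -> R) (c : R) : measurable_fun setT f -> measurable [set w | (f w <= c)%R].
  move=> mf.
  by rewrite -[X in measurable X]setTI; exact: (mf measurableT _ (measurable_le_itv c)).
have mB1 : measurable B1 by exact: mge.
have mB2 : measurable B2 by exact: mge.
have mB : measurable (B1 `|` B2) by exact: measurableU.
have PB : P (B1 `|` B2) <= (e / 4 + e / 4)%:E.
  by apply: le_trans (measureU2 _ mB1 mB2) _; rewrite EFinD; exact: leeD.
have mT : measurable [set w | (student_stat eta D n.+1 w <= x)%R].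
  by apply: mle; exact: measurable_student_stat.
have UB (A A' : set T) : measurable A -> measurable A' -> A `<=` A' `|` (B1 `|` B2) ->
    P A <= P A' + (e / 4 + e / 4)%:E.
  move=> mA mA' AA'; apply: (@le_trans _ _ (P (A' `|` (B1 `|` B2)))).
    by apply: le_measure; rewrite ?inE//; exact: measurableU.
  by apply: le_trans (measureU2 _ mA' mB) _; exact: leeD2l.
have cmp w rho : (0 < rho)%R ->
    ((S n.+1 w / (Num.sqrt m * rho) <= x) = (S n.+1 w <= Num.sqrt m * (x * rho)))%R.
  by move=> r0; rewrite ler_pdivrMr ?mulr_gt0// mulrCA.
split.
- apply: (@le_trans _ _ (P [set w | (S n.+1 w <= Num.sqrt m * (x + kap))%R]
      + (e / 4 + e / 4)%:E)).
    apply: UB => //; first exact: mle.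
    move=> w /= Tx; have [b1|b1] := pselect (B1 w); first by right; left.
    have [b2|b2] := pselect (B2 w); first by right; right.
    have [rho r0 [TE [_ xr]]] := good _ b1 b2; left.
    move: Tx; rewrite TE cmp// => /le_trans; apply.
    by rewrite ler_pM2l.
  apply: (le_trans (leeD2r _ HN3)).
  have xk : (x <= x + kap)%R by rewrite lerDl.
  apply: (le_trans (leeD2r _ (leeD2r _ (normal_prob_lip xk)))).
  move: (N01 [set y | (y <= x)%R]) => Nx.
  rewrite -!addeA leeD2l// -!EFinD lee_fin -/pk.
  by rewrite (addrC x) addrK; lra.
- have xk : (x - kap <= x)%R by rewrite gerBl.
  apply: (le_trans (normal_prob_lip xk)).
  apply: (le_trans (leeD2r _ HN4)).
  have h : P [set w | (S n.+1 w <= Num.sqrt m * (x - kap))%R] <=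
      P [set w | (student_stat eta D n.+1 w <= x)%R] + (e / 4 + e / 4)%:E.
    apply: UB => //; first exact: mle.
    move=> w /= Sx; have [b1|b1] := pselect (B1 w); first by right; left.
    have [b2|b2] := pselect (B2 w); first by right; right.
    have [rho r0 [TE [xr _]]] := good _ b1 b2; left.
    by rewrite TE cmp// (le_trans Sx)// ler_pM2l.
  apply: (le_trans (leeD2r _ (leeD2r _ h))).
  move: (P [set w | (student_stat eta D n.+1 w <= x)%R]) => Px.
  rewrite -!addeA leeD2l// -!EFinD lee_fin -/pk.
  by rewrite (_ : x - (x - kap) = kap)%R; [lra|ring].
Qed.

End studentized.

(** * The arrival-time coordinate *)

Lemma integral_is_derive (R : realType) (f F : R -> R) (a b : R) : a <= b ->
  (forall x, a <= x <= b -> is_derive x (1 : R) F (f x)) ->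
  (forall x, a <= x <= b -> {for x, continuous f}) ->
  (\int[@lebesgue_measure R]_(x in `[a, b]) (f x)%:E = (F b - F a)%:E)%E.
Proof.
rewrite le_eqVlt => /predU1P[<- _ _|ab dF cf].
  by rewrite set_itv1 integral_set1 subrr.
have cF x : a <= x <= b -> {for x, continuous F}.
  move=> xab; apply: differentiable_continuous; apply/derivable1_diffP.
  by have := dF _ xab => h; exact: ex_derive.
rewrite EFinB; apply: continuous_FTC2 => //.
- by apply: continuous_in_subspaceT => x; rewrite inE/= in_itv/=; exact: cf.
- split.
  + move=> x; rewrite in_itv/= => /andP[ax xb].
    have h := dF x; rewrite !ltW// in h; have := h isT => h'; exact: ex_derive.
  + by apply/cvg_at_right_filter; apply: cF; rewrite lexx ltW.
  + by apply/cvg_at_left_filter; apply: cF; rewrite lexx ltW.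
- move=> x; rewrite in_itv/= => /andP[ax xb].
  have h := dF x; rewrite !ltW// in h; have := h isT => h'.
  by rewrite derive1E derive_val.
Qed.

Section gev_coordinate.
Variables (R : realType) (mu sigma xi : R).
Hypothesis sigma0 : 0 < sigma.
Local Notation lam := (@lebesgue_measure R).
Local Notation z := (gev_z mu sigma).

Definition gev_supp (y : R) : bool := 0 < 1 + xi * z y.

(** Written with [expR] and [ln], it is positive at every y, even off the support, so positivity
    never requires a case distinction. *)
Definition gev_arrival (y : R) : R :=
  if xi == 0 then expR (- z y) else expR (- xi^-1 * ln (1 + xi * z y)).

Definition gev_quantile (u : R) : R :=
  if xi == 0 then mu - sigma * ln u
  else mu + sigma * ((expR (- xi * ln u) - 1) / xi).

(** The Jacobian of the change to arrival times: minus the derivative of [gev_arrival] on the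
    support. The GEV density is the product of these weights times exp(- u_r). *)
Definition gev_weight (y : R) : R :=
  if gev_supp y then
    if xi == 0 then sigma^-1 * expR (- z y)
    else sigma^-1 * expR (- (xi^-1 + 1) * ln (1 + xi * z y))
  else 0.

Local Notation U := gev_arrival.
Local Notation V := gev_quantile.
Local Notation w := gev_weight.

Lemma gev_arrival_gt0 y : 0 < U y.
Proof. by rewrite /gev_arrival; case: ifP => _; exact: expR_gt0. Qed.

Lemma gev_weight_ge0 y : 0 <= w y.
Proof.
rewrite /gev_weight; case: ifP => // _.
by case: ifP => _; rewrite mulr_ge0 ?expR_ge0// invr_ge0 ltW.
Qed.

Lemma gev_supp_quantile u : gev_supp (V u).
Proof.
rewrite /gev_supp /gev_quantile; case: eqVneq => [->|xi0]; first by rewrite mul0r addr0.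
rewrite /gev_z (_ : 1 + _ = expR (- xi * ln u)) ?expR_gt0//.
by field; rewrite xi0 gt_eqF.
Qed.

Lemma gev_arrivalK y : gev_supp y -> V (U y) = y.
Proof.
rewrite /gev_supp /gev_quantile /gev_arrival; case: eqVneq => [_ _|xi0 sy].
  by rewrite expRK /gev_z; field; rewrite gt_eqF.
rewrite expRK (_ : - xi * _ = ln (1 + xi * z y)); last by field.
rewrite lnK ?posrE// /gev_z; by field; rewrite xi0 gt_eqF.
Qed.

Lemma gev_quantileK u : 0 < u -> U (V u) = u.
Proof.
move=> u0; rewrite /gev_quantile /gev_arrival; case: eqVneq => [_|xi0].
  rewrite /gev_z (_ : - _ = ln u) ?lnK ?posrE//.
  by field; rewrite gt_eqF.
rewrite /gev_z (_ : 1 + _ = expR (- xi * ln u)); last by field; rewrite xi0 gt_eqF.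
rewrite expRK (_ : - xi^-1 * _ = ln u); last by field.
by rewrite lnK ?posrE.
Qed.

Lemma gev_quantile_lt u v : 0 < u -> 0 < v -> (V v < V u) = (u < v).
Proof.
move=> u0 v0; rewrite /gev_quantile.
have luv : (ln u < ln v) = (u < v) by apply: ltr_ln.
case: eqVneq => [_|]; first by rewrite ltrD2l ltrN2 ltr_pM2l.
rewrite neq_lt ltrD2l ltr_pM2l// => /orP[xi0|xi0].
  by rewrite ltr_nM2r ?invr_lt0// ltrD2r ltr_expR ltr_pM2l ?oppr_gt0.
by rewrite ltr_pM2r ?invr_gt0// ltrD2r ltr_expR ltr_nM2l ?oppr_lt0.
Qed.

Lemma gev_arrival_lt y y' : gev_supp y -> gev_supp y' -> (U y < U y') = (y' < y).
Proof.
move=> sy sy'; rewrite -{2}(gev_arrivalK sy) -{2}(gev_arrivalK sy').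
by rewrite gev_quantile_lt// gev_arrival_gt0.
Qed.

Lemma gev_arrival_le y y' : gev_supp y -> gev_supp y' -> (U y <= U y') = (y' <= y).
Proof. by move=> sy sy'; rewrite leNgt gev_arrival_lt// -leNgt. Qed.

Lemma measurable_gev_z : measurable_fun setT z.
Proof. by apply: measurable_funM => //; exact: measurable_funB. Qed.

Let mxz : measurable_fun setT (fun y => 1 + xi * z y).
Proof.
by apply: measurable_funD => //; apply: measurable_funM => //; exact: measurable_gev_z.
Qed.

Let mln : measurable_fun setT (fun y => ln (1 + xi * z y)).
Proof. by apply: measurableT_comp. Qed.

Lemma measurable_gev_arrival : measurable_fun setT U.
Proof.
rewrite /gev_arrival; case: (xi == 0); apply: measurableT_comp => //.
  by apply: measurableT_comp => //; exact: measurable_gev_z.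
exact: measurable_funM.
Qed.

Lemma measurable_gev_quantile : measurable_fun setT V.
Proof.
rewrite /gev_quantile; case: (xi == 0).
  by apply: measurable_funB => //; exact: measurable_funM.
apply: measurable_funD => //; apply: measurable_funM => //.
apply: measurable_funM => //; apply: measurable_funB => //.
by apply: measurableT_comp => //; exact: measurable_funM.
Qed.

Lemma measurable_gev_weight : measurable_fun setT w.
Proof.
rewrite /gev_weight; apply: measurable_fun_if => //.
- by rewrite /gev_supp; apply: measurable_fun_ltr.
- apply: measurable_funTS; case: (xi == 0); apply: measurable_funM => //;
  apply: measurableT_comp => //.
  + by apply: measurableT_comp => //; exact: measurable_gev_z.
  + exact: measurable_funM.
Qed.

Lemma is_derive_gev_arrival y : gev_supp y -> is_derive y (1 : R) U (- w y).
Proof.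
move=> sy; rewrite /gev_weight sy; have sn : sigma != 0 by rewrite gt_eqF.
rewrite /gev_arrival /gev_z; case: eqVneq => [_|xi0].
  by apply: is_derive_eq; rewrite /GRing.scale/=; field.
have sy' : 0 < 1 + xi * ((y - mu) / sigma) by [].
have dl : is_derive y (1 : R) (fun y => ln (1 + xi * ((y - mu) / sigma)))
    ((xi / sigma) / (1 + xi * ((y - mu) / sigma))).
  have dg : is_derive y (1 : R) (fun y => 1 + xi * ((y - mu) / sigma)) (xi / sigma).
    by apply: is_derive_eq; rewrite /GRing.scale/=; field.
  pose g y := 1 + xi * ((y - mu) / sigma).
  have dln : is_derive (g y) (1 : R) (@ln R) (g y)^-1 by exact: is_derive1_ln.
  by have := is_derive1_comp dln dg; rewrite mulrC.
apply: is_derive_eq; rewrite /GRing.scale/=.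
move: sy'; set c := 1 + _ => c0.
have -> : expR (- (xi^-1 + 1) * ln c) = expR (- xi^-1 * ln c) / c.
  by rewrite -{3}(@lnK _ c) ?posrE// -expRN -expRD; congr expR; ring.
by field; rewrite sn xi0 gt_eqF.
Qed.

Lemma continuous_gev_weight y : gev_supp y -> {for y, continuous w}.
Proof.
move=> sy.
have cz : continuous z.
  by move=> t; apply: cvgM; [apply: (@cvgB _ R^o); [exact: cvg_id|exact: cvg_cst]|exact: cvg_cst].
have cxz : continuous (fun t => 1 + xi * z t).
  move=> t; apply: (@cvgD _ R^o); first exact: cvg_cst.
  by apply: cvgM; [exact: cvg_cst|exact: cz].
pose w0 t : R := if xi == 0 then sigma^-1 * expR (- z t)
    else sigma^-1 * expR (- (xi^-1 + 1) * ln (1 + xi * z t)).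
have cw0 : {for y, continuous w0}.
  rewrite /w0; case: (xi == 0).
    apply: cvgM; first exact: cvg_cst.
    apply: (cvg_comp _ expR); last exact: continuous_expR.
    by apply: (@cvgN _ R^o); exact: cz.
  apply: cvgM; first exact: cvg_cst.
  apply: (cvg_comp _ expR); last exact: continuous_expR.
  apply: cvgM; first exact: cvg_cst.
  apply: (cvg_comp _ (@ln R)); first exact: cxz.
  exact: continuous_ln.
have ws : \forall t \near y, gev_supp t.
  have := cxz y => /cvgr_gt; apply; exact: sy.
have e : \forall t \near y, w0 t = w t.
  by apply: filterS ws => t st; rewrite /gev_weight st.
rewrite /prop_for /continuous_at.
rewrite {2}/gev_weight sy -/(w0 y).
by apply: cvg_trans cw0; apply: near_eq_cvg.
Qed.

Lemma integral_gev_weight (a b : R) : 0 < a -> a <= b ->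
  (\int[lam]_(y in U @^-1` `]a, b]) (w y)%:E = (b - a)%:E)%E.
Proof.
move=> a0 ab; have b0 : 0 < b by exact: lt_le_trans ab.
have Vab : V b <= V a by rewrite leNgt gev_quantile_lt// -leNgt.
(* The map 1 + xi z is affine in y, so on the segment it is smallest at an endpoint, which one
   depending on the sign of xi; both endpoints are quantiles and lie in the support. *)
have sint y : V b <= y <= V a -> gev_supp y.
  move=> /andP[by_ ya]; have := gev_supp_quantile a; have := gev_supp_quantile b.
  rewrite /gev_supp => hb ha.
  have zmono t t' : t <= t' -> z t <= z t'.
    by move=> tt'; rewrite /gev_z ler_pM2r ?invr_gt0// lerD2r.
  have [xi0|xi0] := leP 0 xi.
    by apply: lt_le_trans hb _; rewrite lerD2l ler_wpM2l// zmono.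
  by apply: lt_le_trans ha _; rewrite lerD2l ler_wnM2l ?(ltW xi0)// zmono.
transitivity (\int[lam]_(y in `[V b, V a]) (w y)%:E)%E; last first.
  have dU y : V b <= y <= V a -> is_derive y (1 : R) (fun y => - U y) (w y).
    move=> /sint/is_derive_gev_arrival dU.
    by apply: is_derive_eq; rewrite opprK.
  rewrite (integral_is_derive Vab dU); last by move=> y /sint; exact: continuous_gev_weight.
  by rewrite !gev_quantileK// opprK addrC.
(* As [U] is decreasing, the preimage of []a, b]] within the support is closed on the left and open
   on the right. *)
transitivity (\int[lam]_(y in `[V b, V a[) (w y)%:E)%E; last first.
  apply: integral_itv_bndo_bndc.
  by apply/measurable_EFinP/measurable_funTS; exact: measurable_gev_weight.
rewrite integral_mkcond [RHS]integral_mkcond; apply: eq_integral => y _.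
rewrite !patchE; have [sy|sy] := boolP (gev_supp y); last first.
  by rewrite /gev_weight (negbTE sy) !if_same.
suff -> : (y \in U @^-1` `]a, b]) = (y \in `[V b, V a[%classic) by [].
apply/idP/idP; rewrite !inE/= !in_itv/=.
  rewrite -{1}(gev_quantileK a0) -{1}(gev_quantileK b0).
  by rewrite gev_arrival_lt ?gev_arrival_le ?gev_supp_quantile// andbC.
rewrite -{2}(gev_quantileK a0) -{2}(gev_quantileK b0).
by rewrite gev_arrival_lt ?gev_arrival_le ?gev_supp_quantile// andbC.
Qed.

End gev_coordinate.

(** * Lebesgue measure in the arrival coordinate *)

Section gev_change.
Variables (R : realType) (mu sigma xi : R).
Hypothesis sigma0 : 0 < sigma.
Local Notation lam := (@lebesgue_measure R).
Local Notation U := (gev_arrival mu sigma xi).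
Local Notation w := (gev_weight mu sigma xi).

Let mw : measurable_fun setT (w : measurableTypeR R -> R).
Proof. exact: measurable_gev_weight. Qed.

Let w0 : forall y : measurableTypeR R, 0 <= w y.
Proof. exact: gev_weight_ge0. Qed.

Let mU : measurable_fun setT (U : measurableTypeR R -> measurableTypeR R).
Proof. exact: measurable_gev_arrival. Qed.

Let nu : {measure set (measurableTypeR R) -> \bar R} :=
  image_measure (density_measure lam mw w0) mU.

Let nuE (a b : R) : 0 < a -> a <= b -> nu `]a, b]%classic = (b - a)%:E.
Proof. by move=> a0 ab; rewrite -(integral_gev_weight mu xi sigma0 a0 ab). Qed.

(** The value 0 is not an arrival time of any y, so the interval is exhausted from inside by
    intervals with positive left endpoint. *)
Let nu0E (b : R) : 0 <= b -> nu `]0, b]%classic = b%:E.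
Proof.
rewrite le_eqVlt => /predU1P[<-|b0].
  by rewrite (_ : `]0, 0]%classic = set0) ?measure0// set_itvoc0.
pose F (n : nat) := `]b / n.+1%:R, b]%classic.
have mF n : measurable (F n) by exact: measurable_itv.
have UF : \bigcup_n F n = `]0, b]%classic.
  apply/seteqP; split => x /=.
    move=> [n _]; rewrite /F/= !in_itv/= => /andP[bx ->]; rewrite andbT.
    by apply: le_lt_trans bx; rewrite divr_ge0// ltW.
  rewrite in_itv/= => /andP[x0 xb]; exists (truncn (b / x)).+1 => //.
  rewrite /F/= in_itv/= xb andbT ltr_pdivrMr// mulrC -ltr_pdivrMr//.
  by rewrite (lt_le_trans (truncnS_gt _))// ler_nat.
have ndF : nondecreasing_seq F.
  move=> n m nm; apply/subsetPset => x; rewrite /F/= !in_itv/= => /andP[h ->].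
  rewrite andbT (le_lt_trans _ h)// ler_wpM2l ?(ltW b0)// lef_pV2 ?posrE//.
  by rewrite ler_nat.
have := nondecreasing_cvg_mu (mu := nu) mF.
rewrite UF => /(_ (measurable_itv _) ndF) h.
have : (nu \o F) n @[n --> \oo] --> b%:E.
  have -> : nu \o F = EFin \o (fun n => b - b * n.+1%:R^-1).
    apply/funext => n /=.
    rewrite /F nuE ?divr_gt0// ler_pdivrMr// ler_peMr ?(ltW b0)//.
    by rewrite ler1n.
  apply: cvg_EFin; first exact: nearW.
  rewrite -[X in _ --> X]subr0; apply: (@cvgB _ R^o); first exact: cvg_cst.
  rewrite -[X in _ --> X](mulr0 b); apply: cvgM; first exact: cvg_cst.
  exact: cvg_harmonic.
by move=> h'; exact: (cvg_unique _ h h').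
Qed.

Let nu_neg (A : set R) : measurable A -> nu (A `&` `]-oo, 0]%classic) = 0%E.
Proof.
move=> mA; rewrite /nu/= /pushforward (_ : _ @^-1` _ = set0) ?measure0//.
apply/seteqP; split => // y /= [_]; rewrite in_itv/= leNgt.
by rewrite gev_arrival_gt0.
Qed.

Let m0 : measurable (`]-oo, 0]%classic : set (measurableTypeR R)).
Proof. exact: measurable_itv. Qed.

(** [nu] charges only the positive half-line. Adding Lebesgue measure on the other half gives a
    measure on the whole line, to which the uniqueness of Lebesgue measure applies. *)
Let lam_split A : measurable A ->
  lam A = measure_add nu (mrestr lam m0) A.
Proof.
move=> mA; apply: lebesgue_measure_unique => // _ [[a b]] _ <-.
rewrite [RHS]measure_addE; change (lam `]a, b]%classic =
  nu `]a, b]%classic + lam (`]a, b] `&` `]-oo, 0%R])%classic)%E.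
have [ab|ba] := ltP a b; last first.
  have e0 : `]a, b]%classic = set0 :> set R by apply: set_itv_ge; rewrite bnd_simp -leNgt.
  by rewrite e0 set0I !measure0 adde0.
rewrite lebesgue_measure_itv/= lte_fin ab -EFinB.
have [a0|a0] := leP 0 a.
  have -> : (`]a, b] `&` `]-oo, 0])%classic = set0 :> set R.
    apply/seteqP; split => // x /= [] /=; rewrite !in_itv/= => /andP[ax _].
    by move/(lt_le_trans ax); rewrite ltNge a0.
  rewrite measure0 adde0; move: a0; rewrite le_eqVlt => /predU1P[a0|a0].
    by move: ab; rewrite -a0 => b0; rewrite nu0E ?subr0// ltW.
  by rewrite nuE// ltW.
have [b0|b0] := leP b 0.
  have -> : (`]a, b] `&` `]-oo, 0])%classic = `]a, b]%classic :> set R.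
    apply/seteqP; split => x /=; rewrite !in_itv/=; first by case.
    by move=> /andP[ax xb]; rewrite ax xb (le_trans xb b0).
  have {1}<- : (`]a, b] `&` `]-oo, 0])%classic = `]a, b]%classic :> set R.
    apply/seteqP; split => x /=; rewrite !in_itv/=; first by case.
    by move=> /andP[ax xb]; rewrite ax xb (le_trans xb b0).
  by rewrite nu_neg// add0e lebesgue_measure_itv/= lte_fin ab -EFinB.
have -> : (`]a, b] `&` `]-oo, 0])%classic = `]a, 0]%classic :> set R.
  apply/seteqP; split => x /=; rewrite !in_itv/=.
    by move=> [/andP[-> _] ->].
  by move=> /andP[ax x0]; rewrite ax x0 (le_trans x0 (ltW b0)).
have e : `]a, b]%classic = (`]a, b] `&` `]-oo, 0] `|` `]0, b])%classic :> set R.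
  apply/seteqP; split => x /=; rewrite !in_itv/=.
    move=> /andP[ax xb]; have [x0|x0] := leP x 0; first by left; rewrite ax xb.
    by right; rewrite xb.
  by move=> [[]//|/andP[x0 xb]]; rewrite xb (lt_trans a0).
have mab : measurable (`]a, b] `&` `]-oo, 0] : set (measurableTypeR R))%classic.
  by apply: measurableI => //; exact: measurable_itv.
have m0b : measurable (`]0, b]%classic : set (measurableTypeR R)) by exact: measurable_itv.
have dj : (`]a, b] `&` `]-oo, 0] `&` `]0, b])%classic = set0 :> set R.
  apply/seteqP; split => // x /= [[_]]; rewrite !in_itv/= => x0 /andP[].
  by rewrite ltNge x0.
have -> : nu `]a, b]%classic = b%:E.
  rewrite e; transitivity (nu (`]a, b] `&` `]-oo, 0%R])%classic + nu `]0%R, b]%classic)%E.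
    exact: (measureU nu mab m0b dj).
  by rewrite nu_neg ?add0e ?nu0E ?(ltW b0)//; exact: measurable_itv.
rewrite lebesgue_measure_itv/= lte_fin a0 -EFinB -EFinD.
by congr EFin; ring.
Qed.

Lemma gev_change_of_variable (G : R -> \bar R) : measurable_fun setT G ->
  (forall u, 0 <= G u)%E ->
  (\int[lam]_y ((w y)%:E * G (U y)) = \int[lam]_u (((0 < u)%R%:R)%:E * G u))%E.
Proof.
move=> mG G0.
have mGU : measurable_fun setT (fun y : measurableTypeR R => G (U y)).
  by apply: measurableT_comp => //; exact: measurable_gev_arrival.
transitivity (\int[nu]_(u in `]0%R, +oo[%classic) G u)%E.
  rewrite /nu (ge0_integral_pushforward mU _ (measurable_itv _) (measurable_funTS mG)).
    rewrite (_ : _ @^-1` _ = setT); last first.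
      by apply/seteqP; split => // y _; rewrite /= in_itv/= andbT gev_arrival_gt0.
    rewrite (ge0_integral_density_measure lam mw w0 mGU (fun=> G0 _)).
    by apply: eq_integral => y _; rewrite muleC.
  by move=> y _.
transitivity (\int[lam]_(u in `]0%R, +oo[%classic) G u)%E.
  apply: eq_measure_integral => A mA A0.
  rewrite [RHS](lam_split mA) measure_addE/= /mrestr.
  rewrite (_ : A `&` _ = set0) ?measure0 ?adde0//.
  apply/seteqP; split => // x [/A0] /=; rewrite !in_itv/= andbT => x0.
  by rewrite leNgt x0.
rewrite integral_mkcond; apply: eq_integral => u _.
rewrite patchE; have [u0|u0] := ltP 0 u; first by rewrite mem_set ?mul1e//= in_itv/= u0.
by rewrite memNset ?mul0e//= in_itv/= andbT => /lt_geF; rewrite u0.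
Qed.

End gev_change.

(** * Iterated tail integrals *)

Section tail.
Local Open Scope ereal_scope.
Variable R : realType.
Local Notation lam := (@lebesgue_measure R).
Implicit Types (G : R -> \bar R).

(** Integrates out the next arrival time when the present one is [a]. *)
Definition tail G (a : R) : \bar R := \int[lam]_u (((a < u)%R%:R)%:E * G u).

Lemma measurable_lt_indic : measurable_fun setT
  (fun z : R * R => ((z.1 < z.2)%R%:R : R)).
Proof.
have m : measurable_fun setT (fun z : R * R => (z.1 < z.2)%R).
  exact: measurable_fun_ltr.
rewrite (_ : (fun z : R * R => _) = (fun z => if (z.1 < z.2)%R then 1%R else 0%R)).
  exact: measurable_fun_ifT.
by apply/funext => z; case: (_ < _)%R.
Qed.

Lemma measurable_gt_indic (a : R) : measurable_fun setT
  (fun u : R => ((a < u)%R%:R : R)).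
Proof.
exact: (measurableT_comp measurable_lt_indic (measurable_pair1 _)).
Qed.

Lemma tail_ge0 G : (forall u, 0 <= G u) -> forall a, 0 <= tail G a.
Proof. by move=> G0 a; apply: integral_ge0 => u _; rewrite mule_ge0. Qed.

Lemma measurable_tail G : measurable_fun setT G -> (forall u, 0 <= G u) ->
  measurable_fun setT (tail G).
Proof.
move=> mG G0.
pose F (z : R * R) := ((z.1 < z.2)%R%:R)%:E * G z.2.
have mF : measurable_fun setT F.
  apply: emeasurable_funM; last exact: measurableT_comp.
  by apply/measurable_EFinP; exact: measurable_lt_indic.
have F0 z : 0 <= F z by rewrite mule_ge0.
exact: (measurable_fun_fubini_tonelli_F (m2 := lam) F mF F0).
Qed.

(** The volume of the chains a < v_1 < ... < v_k < u, that is, the kernel of [k.+1] iterated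
    tails. *)
Definition gap_density k (a u : R) : R := ((a < u)%R%:R * ((u - a) ^+ k / k`!%:R))%R.

Lemma gap_density_ge0 k a u : (0 <= gap_density k a u)%R.
Proof.
rewrite /gap_density; case: ltP => au; last by rewrite mul0r.
by rewrite mul1r divr_ge0// exprn_ge0// subr_ge0 ltW.
Qed.

Lemma measurable_gap_density k :
  measurable_fun setT (fun z : R * R => gap_density k z.1 z.2).
Proof.
apply: measurable_funM; first exact: measurable_lt_indic.
by apply: measurable_funM => //; apply: measurable_funX; exact: measurable_funB.
Qed.

Lemma integral_gap_density k a u :
  \int[lam]_v (((a < v)%R%:R)%:E * (gap_density k v u)%:E) = (gap_density k.+1 a u)%:E.
Proof.
have [ua|au] := leP u a.
  rewrite /gap_density ltNge ua mul0r integral0_eq// => v _.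
  by case: ltP => av; rewrite ?mul0e// ltNge (le_trans ua (ltW av))/= mul0r mule0.
transitivity (\int[lam]_(v in `]a, u[) ((u - v) ^+ k / k`!%:R)%:E).
  rewrite [RHS]integral_mkcond; apply: eq_integral => v _; rewrite patchE /gap_density.
  have [av|av] := ltP a v; have [vu|vu] := ltP v u; rewrite ?mul0e ?mule0 ?mul0r ?mule0//.
  - by rewrite mem_set/= ?in_itv/= ?av ?vu// mul1e mul1r.
  - by rewrite memNset//= in_itv/= av ltNge vu.
  - by rewrite memNset//= in_itv/= ltNge av.
  - by rewrite memNset//= in_itv/= ltNge av.
have cf : continuous (fun v : R => (u - v) ^+ k / k`!%:R)%R.
  move=> v; apply: cvgM; last exact: cvg_cst.
  apply: (cvg_comp (fun v => u - v)%R (fun x => x ^+ k)%R).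
    by apply: (@cvgB _ R^o); [exact: cvg_cst|exact: cvg_id].
  exact: exprn_continuous.
transitivity (\int[lam]_(v in `[a, u]) ((u - v) ^+ k / k`!%:R)%:E).
  apply/esym; apply: integral_itv_bndoo; apply/measurable_EFinP; apply: measurable_funTS.
  exact: continuous_measurable_fun.
have dF (v : R) : (a <= v <= u)%R -> is_derive v (1 : R)%R
    (fun v => - ((u - v) ^+ k.+1 / k.+1`!%:R))%R ((u - v) ^+ k / k`!%:R)%R.
  move=> _; set c := (k.+1`!%:R^-1)%R.
  have cE : (c = k.+1%:R^-1 * k`!%:R^-1)%R by rewrite /c factS natrM invfM.
  (* Restating the power as a power of the function [g] lets the derivative be found by instance
     resolution. *)
  pose g t : R := (u - t)%R.
  have -> : (fun v => - ((u - v) ^+ k.+1 * c))%R = (fun v => - ((g ^+ k.+1) v * c))%R.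
    by apply/funext => t; rewrite exprfctE.
  move: c cE => c cE; apply: is_derive_eq; rewrite /GRing.scale/= cE.
  have : (k.+1%:R : R)%R != 0%R by rewrite pnatr_eq0.
  move: (k.+1%:R : R)%R (k`!%:R^-1 : R)%R => x y x0.
  by field.
rewrite (integral_is_derive (ltW au) dF) /gap_density ?au ?mul1r; last by move=> v _; exact: cf.
by congr EFin; rewrite subrr expr0n/= mul0r oppr0 sub0r opprK.
Qed.

Lemma iter_tail k G a : measurable_fun setT G -> (forall u, 0 <= G u) ->
  iter k.+1 tail G a = \int[lam]_u ((gap_density k a u)%:E * G u).
Proof.
move=> mG G0; elim: k a => [a|k IH a].
  by apply: eq_integral => u _; rewrite /gap_density expr0 fact0 divr1 mulr1.
rewrite iterS {1}/tail.
pose F (z : R * R) := ((a < z.1)%R%:R)%:E * (gap_density k z.1 z.2)%:E * G z.2.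
have mF : measurable_fun setT F.
  apply: emeasurable_funM; last exact: measurableT_comp.
  apply: emeasurable_funM; apply/measurable_EFinP.
    exact: (measurableT_comp (measurable_gt_indic a)).
  exact: measurable_gap_density.
have F0 z : 0 <= F z by rewrite !mule_ge0// lee_fin gap_density_ge0.
transitivity (\int[lam]_v \int[lam]_u F (v, u)).
  apply: eq_integral => v _; rewrite IH -ge0_integralZl//.
  - by apply: eq_integral => u _; rewrite muleA.
  - apply: emeasurable_funM => //; apply/measurable_EFinP.
    exact: (measurableT_comp (measurable_gap_density k) (measurable_pair1 _)).
  - by move=> u _; rewrite mule_ge0// lee_fin gap_density_ge0.
rewrite (fubini_tonelli (m1 := lam) (m2 := lam) F mF F0).
apply: eq_integral => u _; rewrite /F/= ge0_integralZr//.
- by rewrite integral_gap_density.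
- apply: emeasurable_funM; apply/measurable_EFinP; first exact: measurable_gt_indic.
  exact: (measurableT_comp (measurable_gap_density k) (measurable_pair2 _)).
- by move=> v _; rewrite mule_ge0// lee_fin gap_density_ge0.
Qed.

Lemma tail_expRN a : tail (fun u => (expR (- u))%:E) a = (expR (- a))%:E.
Proof.
rewrite -integral_expRN /tail.
transitivity (\int[lam]_(u in `]a, +oo[) (expR (- u))%:E).
  rewrite [RHS]integral_mkcond; apply: eq_integral => u _; rewrite patchE.
  have [au|au] := ltP a u; first by rewrite mem_set ?mul1e//= in_itv/= au.
  by rewrite memNset ?mul0e//= in_itv/= andbT ltNge au.
apply: integral_itv_obnd_cbnd; apply/measurable_EFinP; apply: measurable_funTS.
by apply: measurableT_comp => //; exact: measurableT_comp.
Qed.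

Lemma iter_tail_expRN k a :
  iter k tail (fun u => (expR (- u))%:E) a = (expR (- a))%:E.
Proof.
elim: k a => [//|k IH] a; rewrite iterS -[RHS]tail_expRN.
by congr tail; apply/funext => u; rewrite IH.
Qed.

End tail.

(** * The law of the last two order statistics *)

Lemma integral_density_measure d (T : measurableType d) (R : realType)
  (mu : {measure set T -> \bar R}) (w : T -> R)
  (mw : measurable_fun setT w) (w0 : forall x, 0 <= w x) (f : T -> \bar R) :
  measurable_fun setT f ->
  (\int[density_measure mu mw w0]_x f x = \int[mu]_x (f x * (w x)%:E))%E.
Proof.
move=> mf; rewrite [LHS]integralE [RHS]integralE.
rewrite (ge0_integral_density_measure mu mw w0 (measurable_funepos mf)
  (funepos_ge0 f)).
rewrite (ge0_integral_density_measure mu mw w0 (measurable_funeneg mf)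
  (funeneg_ge0 f)).
congr (_ - _)%E; apply: eq_integral => x _.
  rewrite !funeposE; have [f0|f0] := leP 0%E (f x).
    by rewrite !max_l// mule_ge0// lee_fin.
  by rewrite !max_r ?mul0e// ?(ltW f0)// mule_le0_ge0 ?(ltW f0)// lee_fin.
rewrite !funenegE; have [f0|f0] := leP 0%E (f x).
  by rewrite !max_r ?mul0e// oppe_le0// mule_ge0// lee_fin.
by rewrite !max_l ?mulNe// ?oppe_ge0 ?(ltW f0)// mule_le0_ge0 ?(ltW f0)// lee_fin.
Qed.

Section gev_chain.
Variables (R : realType) (mu sigma xi : R).
Hypothesis sigma0 : 0 < sigma.
Local Notation lam := (@lebesgue_measure R).
Local Notation U := (gev_arrival mu sigma xi).
Local Notation V := (gev_quantile mu sigma xi).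
Local Notation w := (gev_weight mu sigma xi).
Local Notation supp := (gev_supp mu sigma xi).

(** The GEV density read from the first coordinate on, in step with [iter_lebesgue]; [a] is the
    arrival time of the preceding coordinate, and the final [expR (- a)] the factor left by the last
    one. *)
Fixpoint chain_pdf (a : R) (s : seq R) : R :=
  if s is y :: s' then (a < U y)%R%:R * w y * chain_pdf (U y) s' else expR (- a).

Lemma chain_pdfE a s : chain_pdf a s =
  if path <%R a (map U s) && all supp s
  then (\prod_(y <- s) w y) * expR (- last a (map U s)) else 0.
Proof.
elim: s a => [|y s IH] a; first by rewrite /= big_nil mul1r.
rewrite /= IH big_cons; case: (a < U y) => /=; last by rewrite !mul0r.
have [sy|sy] := boolP (supp y); last first.
  by rewrite andbF /= /gev_weight (negbTE sy) mulr0 mul0r.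
by rewrite mul1r; case: ifP => _; rewrite ?mulr0// mulrA.
Qed.

(** [U] reverses the order on the support, so y_1 > ... > y_r becomes an increasing path of arrival
    times; its first inequality 0 < U y_1 always holds. *)
Lemma gevr_pdf_chain r s : size s = r.+1 -> gevr_pdf r.+1 mu sigma xi s = chain_pdf 0 s.
Proof.
move=> sr; rewrite chain_pdfE /gevr_pdf.
have eqs : `[< gevr_support r.+1 mu sigma xi s >] = path <%R 0 (map U s) && all supp s.
  apply/asboolP/andP.
    move=> [_ [dec sup]]; split; last first.
      by apply/(all_nthP 0) => j; rewrite sr => jr; exact: sup.
    apply/(pathP 0) => j; rewrite size_map sr => jr; rewrite (nth_map 0) ?sr//.
    case: j jr => [|j] jr; first exact: gev_arrival_gt0.
    rewrite /= (nth_map 0) ?sr ?(ltnW jr)//.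
    rewrite (gev_arrival_lt sigma0 (sup j (ltnW jr)) (sup j.+1 jr)); exact: dec.
  move=> [/(pathP 0) p /(all_nthP 0) a]; rewrite size_map sr in p; rewrite sr in a.
  split => //; split; last by move=> j jr; exact: a.
  move=> j jr; have := p _ jr.
  rewrite /= !(nth_map 0) ?sr// ?(ltnW jr)//.
  by rewrite (gev_arrival_lt sigma0 (a j (ltnW jr)) (a j.+1 jr)).
rewrite eqs; case: ifPn => // /andP[_ sup].
have lastE : last 0 (map U s) = U (nth 0 s r).
  by rewrite (last_nth 0) size_map sr/= (nth_map 0)// sr.
have wE (y : R) : y \in s -> w y = if xi == 0 then sigma^-1 * expR (- gev_z mu sigma y)
    else sigma^-1 * expR (- (xi^-1 + 1) * ln (1 + xi * gev_z mu sigma y)).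
  by move=> ys; rewrite /gev_weight (allP sup).
have prodE (f : R -> R) : (\prod_(y <- s) (sigma^-1 * expR (f y)) =
    sigma ^- r.+1 * expR (\sum_(j < r.+1) f (nth 0 s j)))%R.
  rewrite big_split/= big_const_seq count_predT sr iter_mulr_1 exprVn -expR_sum.
  by congr (_ * expR _); rewrite (big_nth 0) sr big_mkord.
rewrite lastE (eq_big_seq _ wE) /gev_arrival; case: eqVneq => [x0|x0].
  rewrite prodE -mulrA -expRD; congr (_ * expR _).
  by rewrite sumrN addrC.
have sr' : supp (nth 0 s r) by apply: (allP sup); rewrite mem_nth// sr.
rewrite prodE -mulrA -expRD; congr (_ * expR _).
rewrite addrC -mulr_sumr mulNr; congr (_ - _).
by rewrite /powR gt_eqF.
Qed.

Definition coord_rect (m : nat) (B : nat -> set R) : set (seq R) :=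
  [set s | forall j, (j < m)%N -> B j (nth 0 s j)].

(** The rectangle integral of [chain_pdf] once every coordinate has been replaced by its arrival
    time. *)
Fixpoint chain_mass (m : nat) (B : nat -> set R) : R -> \bar R :=
  if m is m'.+1 then
    tail (fun u => (\1_(B 0%N) (V u))%:E * chain_mass m' (B \o S) u)%E
  else fun a => (expR (- a))%:E.

Lemma chain_mass_prop m B : (forall j, measurable (B j)) ->
  measurable_fun setT (chain_mass m B) /\ (forall a, 0 <= chain_mass m B a)%E.
Proof.
elim: m B => [|m IH] B mB /=.
  split; last by move=> a; rewrite lee_fin expR_ge0.
  by apply/measurable_EFinP; apply: measurableT_comp => //; exact: measurableT_comp.
have [mm m0] := IH (B \o S) (fun j => mB j.+1).
have mI : measurable_fun setT (fun u : R => (\1_(B 0%N) (V u))%:E : \bar R).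
  apply/measurable_EFinP.
  apply: (measurableT_comp (measurable_indic (mB 0%N))); exact: measurable_gev_quantile.
have G0 u : (0 <= (\1_(B 0%N) (V u))%:E * chain_mass m (B \o S) u)%E.
  by rewrite mule_ge0// lee_fin.
split; last exact: tail_ge0.
by apply: measurable_tail => //; exact: emeasurable_funM.
Qed.

Lemma iter_lebesgue_ext m (f g : seq R -> \bar R) :
  (forall s, size s = m -> f s = g s) -> iter_lebesgue m f = iter_lebesgue m g.
Proof.
elim: m f g => [|m IH] f g fg /=; first exact: fg.
by apply: eq_integral => x _; apply: IH => s sm; apply: fg; rewrite /= sm.
Qed.

(** The constant [c] collects the weights and indicators of the coordinates already fixed, so that
    the induction hypothesis applies under the outer integral. *)
Lemma iter_lebesgue_chain m B a (c : R) : (forall j, measurable (B j)) -> 0 <= c ->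
  0 <= a ->
  iter_lebesgue m (fun s => (c * chain_pdf a s * \1_(coord_rect m B) s)%:E) =
  (c%:E * chain_mass m B a)%E.
Proof.
elim: m B a c => [|m IH] B a c mB c0 a0.
  by rewrite /= indicE mem_set// mulr1 EFinM.
have [mm m0] := chain_mass_prop m (fun j => mB j.+1 : measurable ((B \o S) j)).
pose G u : \bar R := (((a < u)%R%:R)%:E * ((\1_(B 0%N) (V u))%:E * chain_mass m (B \o S) u))%E.
have mI : measurable_fun setT (fun u : R => (\1_(B 0%N) (V u))%:E : \bar R).
  apply/measurable_EFinP.
  apply: (measurableT_comp (measurable_indic (mB 0%N))); exact: measurable_gev_quantile.
have mG : measurable_fun setT G.
  apply: emeasurable_funM; first by apply/measurable_EFinP; exact: measurable_gt_indic.
  exact: emeasurable_funM.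
have G0 u : (0 <= G u)%E by rewrite !mule_ge0// lee_fin.
rewrite /=.
transitivity (\int[lam]_y (c%:E * ((w y)%:E * G (U y))))%E.
  apply: eq_integral => y _.
  transitivity (iter_lebesgue m (fun s => ((c * ((a < U y)%R%:R * w y * \1_(B 0%N) y)) *
      chain_pdf (U y) s * \1_(coord_rect m (B \o S)) s)%:E)).
    apply: iter_lebesgue_ext => s _; congr EFin.
    have -> : \1_(coord_rect m.+1 B) (y :: s) =
        \1_(B 0%N) y * \1_(coord_rect m (B \o S)) s :> R.
      rewrite !indicE -natrM mulnb; congr (_%:R); congr nat_of_bool.
      apply/idP/andP; rewrite !inE => h.
        by split; [exact: (h 0%N)|move=> j jm; exact: (h j.+1)].
      by move: h => [h1 h2] [//|j] jm; exact: h2.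
    by rewrite /=; ring.
  rewrite IH ?(ltW (gev_arrival_gt0 _ _ _ _))//; last 2 first.
  - by move=> j; exact: mB.
  - by rewrite !mulr_ge0// gev_weight_ge0.
  rewrite EFinM -muleA; congr (_ * _)%E.
  have [sy|sy] := boolP (supp y); last first.
    by rewrite /gev_weight (negbTE sy) mulr0 mul0r !mul0e.
  rewrite /G gev_arrivalK// !EFinM -!muleA muleCA; congr (_ * _)%E.
rewrite ge0_integralZl//.
- congr (_ * _)%E; rewrite gev_change_of_variable//.
  (* The change of variable leaves the factor 0 < u, which a < u implies because a >= 0. *)
  apply: eq_integral => u _; rewrite /G muleA -EFinM -natrM mulnb.
  by have [au|au] := ltP a u; rewrite ?andbF// (le_lt_trans a0).
- apply: emeasurable_funM; first by apply/measurable_EFinP; exact: measurable_gev_weight.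
  by apply: measurableT_comp => //; exact: measurable_gev_arrival.
- by move=> y _; rewrite mule_ge0// lee_fin gev_weight_ge0.
Qed.

(* Joint density of the arrival times of ranks k + 1 and k + 2. *)
Definition arrival_density k (z : R * R) : R :=
  (0 < z.1)%R%:R * (z.1 ^+ k / k`!%:R) * ((z.1 < z.2)%R%:R * expR (- z.2)).

Lemma arrival_density_ge0 k z : 0 <= arrival_density k z.
Proof.
rewrite /arrival_density; case: ltP => z0; last by rewrite !mul0r.
by rewrite !mulr_ge0 ?expR_ge0 ?invr_ge0// exprn_ge0// ltW.
Qed.

Lemma measurable_arrival_density k : measurable_fun setT (arrival_density k).
Proof.
apply: measurable_funM.
  apply: measurable_funM; first exact: (measurableT_comp (measurable_gt_indic 0)).
  by apply: measurable_funM => //; apply: measurable_funX.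
apply: measurable_funM; first exact: measurable_lt_indic.
by apply: measurableT_comp => //; exact: measurableT_comp.
Qed.

(** The factor z.1^k / k! is the kernel of [k.+1] iterated tails from 0 ([iter_tail]); the inner
    tail integrates the last arrival time against exp(- t). *)
Lemma ge0_integral_arrival k (g : R * R -> \bar R) : measurable_fun setT g ->
  (forall z, 0 <= g z)%E ->
  (\int[lam \x lam]_z (g z * (arrival_density k z)%:E) =
   iter k.+1 (@tail R) (fun u => tail (fun t => g (u, t) * (expR (- t))%:E) u) 0%R)%E.
Proof.
move=> mg g0.
have mgd : measurable_fun setT (fun z => g z * (arrival_density k z)%:E)%E.
  by apply: emeasurable_funM => //; apply/measurable_EFinP; exact: measurable_arrival_density.
have gd0 z : (0 <= g z * (arrival_density k z)%:E)%E.
  by rewrite mule_ge0// lee_fin arrival_density_ge0.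
have mexp : measurable_fun setT (fun t : R => (expR (- t))%:E : \bar R).
  by apply/measurable_EFinP; apply: measurableT_comp => //; exact: measurableT_comp.
pose F (z : R * R) := (((z.1 < z.2)%R%:R)%:E * (g z * (expR (- z.2))%:E))%E.
have mF : measurable_fun setT F.
  apply: emeasurable_funM; first by apply/measurable_EFinP; exact: measurable_lt_indic.
  by apply: emeasurable_funM => //; exact: (measurableT_comp mexp).
have F0 z : (0 <= F z)%E by rewrite !mule_ge0// lee_fin expR_ge0.
rewrite fubini_tonelli1// iter_tail//; last 2 first.
- exact: (measurable_fun_fubini_tonelli_F (m2 := lam) F mF F0).
- by move=> u; apply: integral_ge0 => t _; exact: (F0 (u, t)).
apply: eq_integral => u _; rewrite /fubini_F.
rewrite [X in (_ * X)%E]/tail -ge0_integralZl//; last 3 first.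
- exact: (measurableT_comp mF (measurable_pair1 _)).
- by move=> t _; exact: (F0 (u, t)).
- by rewrite lee_fin gap_density_ge0.
apply: eq_integral => t _; rewrite /arrival_density /gap_density/= subr0.
by rewrite !EFinM; rewrite muleCA; congr (_ * _)%E; rewrite muleCA.
Qed.

End gev_chain.

(** * Transfer of the pair law from the blocks to arrival times *)

Section gev_pair_law.
Variables (R : realType) (mu sigma xi : R).
Hypothesis sigma0 : 0 < sigma.
Local Notation lam := (@lebesgue_measure R).
Local Notation V := (gev_quantile mu sigma xi).
Local Notation rho := (@arrival_density R).
Context d (T : measurableType d) (P : probability T R) (k : nat).
Variables (Y : nat -> T -> R) (mY : forall j, measurable_fun setT (Y j)).
Hypothesis gevY : is_gevr P k.+2 mu sigma xi Y.

Let last_two (B1 B2 : set R) j i : set R :=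
  if i == j then B1 else if i == j.+1 then B2 else setT.

Let mlast_two B1 B2 j i : measurable B1 -> measurable B2 ->
  measurable (last_two B1 B2 j i).
Proof. by rewrite /last_two => m1 m2; case: eqP => // _; case: eqP. Qed.

(** An unconstrained coordinate contributes a bare [tail], so the leading [j] coordinates only add
    iterations. *)
Let chain_mass_last_two B1 B2 j : chain_mass mu sigma xi j.+2 (last_two B1 B2 j) =
  iter j.+1 (@tail R) (fun u => (\1_B1 (V u))%:E *
    tail (fun t => (\1_B2 (V t))%:E * (expR (- t))%:E) u)%E.
Proof.
elim: j => [//|j IH]; rewrite iterS -IH.
rewrite [LHS]/=; congr tail; apply/funext => u.
have -> : last_two B1 B2 j.+1 \o S = last_two B1 B2 j by apply/funext.
by rewrite /last_two/= indicE mem_set// mul1e.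
Qed.

Let indicV (B : set R) : measurable B ->
  measurable_fun setT (fun u : R => (\1_B (V u))%:E : \bar R).
Proof.
move=> mB; apply/measurable_EFinP.
apply: (measurableT_comp (measurable_indic mB)); exact: measurable_gev_quantile.
Qed.

Let mVV : measurable_fun setT (fun z : R * R => (V z.1, V z.2)).
Proof.
apply: measurable_fun_pair; apply: measurableT_comp => //; exact: measurable_gev_quantile.
Qed.

Let mexp : measurable_fun setT (fun t : R => (expR (- t))%:E : \bar R).
Proof.
by apply/measurable_EFinP; apply: measurableT_comp => //; exact: measurableT_comp.
Qed.

Lemma gev_pair_rect B1 B2 : measurable B1 -> measurable B2 ->
  P [set w | B1 (Y k w) /\ B2 (Y k.+1 w)] =
  (\int[lam \x lam]_z ((\1_(B1 `*` B2) (V z.1, V z.2))%:E * (rho k z)%:E))%E.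
Proof.
move=> m1 m2.
have mB j : measurable (last_two B1 B2 k j) by exact: mlast_two.
transitivity (P (rect_event k.+2 Y (last_two B1 B2 k))).
  congr (P _); apply/seteqP; split => w /=.
    move=> [h1 h2] j _; rewrite /last_two.
    by case: eqP => [->//|_]; case: eqP => [->|].
  move=> h; split.
    by have := h k; rewrite /last_two eqxx; apply.
  have := h k.+1; rewrite /last_two eqxx (_ : (k.+1 == k) = false); first exact.
  by apply/negbTE; rewrite neq_ltn ltnSn orbT.
rewrite gevY//.
transitivity (iter_lebesgue k.+2 (fun s =>
    (1 * chain_pdf mu sigma xi 0 s * \1_(coord_rect k.+2 (last_two B1 B2 k)) s)%:E)).
  by apply: iter_lebesgue_ext => s sm; rewrite (@gevr_pdf_chain R mu sigma xi sigma0 k.+1 s sm) mul1r.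
rewrite iter_lebesgue_chain// mul1e chain_mass_last_two.
rewrite ge0_integral_arrival; last 2 first.
- apply/measurable_EFinP; apply: (measurableT_comp _ mVV).
  by apply: measurable_indic; exact: measurableX.
- by move=> z; rewrite lee_fin.
apply: (congr1 (fun f => iter k.+1 (@tail R) f 0)); apply/funext => u.
have mG : measurable_fun setT (fun t : R => ((u < t)%R%:R)%:E *
    ((\1_B2 (V t))%:E * (expR (- t))%:E))%E.
  apply: emeasurable_funM; first by apply/measurable_EFinP; exact: measurable_gt_indic.
  by apply: emeasurable_funM => //; exact: indicV.
have G0 t : (0 <= ((u < t)%R%:R)%:E * ((\1_B2 (V t))%:E * (expR (- t))%:E))%E.
  by rewrite !mule_ge0// lee_fin expR_ge0.
have i0 : (0 <= (\1_B1 (V u))%:E :> \bar R)%E by rewrite lee_fin.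
rewrite [in LHS]/tail -(ge0_integralZl lam measurableT mG (fun t _ => G0 t) i0).
apply: eq_integral => t _; rewrite muleCA; congr (_ * _)%E; rewrite muleA; congr (_ * _)%E.
rewrite -EFinM !indicE -natrM mulnb; congr (_%:R)%:E; congr nat_of_bool.
by apply/andP/idP; rewrite !inE.
Qed.

Let mYY : measurable_fun setT (fun w => (Y k w, Y k.+1 w)).
Proof. exact: measurable_fun_pair. Qed.

Let mrho := @measurable_arrival_density R k.

Let rho0 := @arrival_density_ge0 R k.

Let nu := [the {measure set _ -> \bar R} of density_measure (lam \x lam)%E mrho rho0].

Let gev_pair_law A : measurable A ->
  image_measure P mYY A = image_measure nu mVV A.
Proof.
apply: finite_measure_prod_unique.
  by rewrite /= /pushforward preimage_setT probability_setT ltry.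
move=> B1 B2 m1 m2; rewrite /= /pushforward.
have := gev_pair_rect m1 m2; rewrite (_ : [set w | _] =
  (fun w => (Y k w, Y k.+1 w)) @^-1` (B1 `*` B2))// => ->.
have mI : measurable_fun setT (fun z : R * R => (\1_(B1 `*` B2) z)%:E : \bar R).
  by apply/measurable_EFinP; apply: measurable_indic; exact: measurableX.
have I0 z : (0 <= (\1_(B1 `*` B2) z)%:E :> \bar R)%E by rewrite lee_fin.
have E1 := ge0_integral_density_measure (lam \x lam)%E mrho rho0
  (measurableT_comp mI mVV) (fun=> I0 _).
rewrite -[LHS]E1.
transitivity (\int[nu]_z (\1_((fun z => (V z.1, V z.2)) @^-1` (B1 `*` B2)) z)%:E)%E.
  by apply: eq_integral => z _; rewrite /= !indicE.
rewrite integral_indic ?setIT// -[X in measurable X]setTI.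
by apply: mVV => //; exact: measurableX.
Qed.

Lemma ge0_integral_gev_pair (g : R * R -> \bar R) : measurable_fun setT g ->
  (forall z, 0 <= g z)%E ->
  (\int[P]_w g (Y k w, Y k.+1 w) =
   \int[lam \x lam]_z (g (V z.1, V z.2) * (rho k z)%:E))%E.
Proof.
move=> mg g0.
have E1 := ge0_integral_density_measure (lam \x lam)%E mrho rho0
  (measurableT_comp mg mVV) (fun=> g0 _).
have mVV' : measurable_fun [set: (measurableTypeR R * measurableTypeR R)%type]
    (fun z => (V z.1, V z.2) : (R * R)%type) by exact: mVV.
have E2 := ge0_integral_pushforward mVV' nu measurableT mg (fun z _ => g0 z).
have E3 := ge0_integral_pushforward mYY P measurableT mg (fun z _ => g0 z).
rewrite -[RHS]E1 -[RHS]E2 -[LHS]E3.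
by apply: eq_measure_integral => A mA _; exact: gev_pair_law.
Qed.

Lemma integral_gev_pair (g : R * R -> \bar R) : measurable_fun setT g ->
  (\int[P]_w g (Y k w, Y k.+1 w) =
   \int[lam \x lam]_z (g (V z.1, V z.2) * (rho k z)%:E))%E.
Proof.
move=> mg; rewrite [LHS]integralE.
have mp := measurable_funepos mg; have mn := measurable_funeneg mg.
have comp_pos (S : Type) (f : S -> R * R) : ((g \o f)^\+ = g^\+ \o f)%E.
  by apply/funext => x; rewrite funepos_comp.
have comp_neg (S : Type) (f : S -> R * R) : ((g \o f)^\- = g^\- \o f)%E.
  by apply/funext => x; rewrite funeneg_comp.
rewrite (comp_pos T (fun w => (Y k w, Y k.+1 w))) (comp_neg T (fun w => (Y k w, Y k.+1 w))).
rewrite (ge0_integral_gev_pair mp (funepos_ge0 g)) (ge0_integral_gev_pair mn (funeneg_ge0 g)).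
have E := integral_density_measure (lam \x lam)%E mrho rho0 (measurableT_comp mg mVV).
rewrite -[RHS]E [RHS]integralE (comp_pos _ (fun z => (V z.1, V z.2))).
rewrite (comp_neg _ (fun z => (V z.1, V z.2))).
have Ep := ge0_integral_density_measure (lam \x lam)%E mrho rho0
  (measurableT_comp mp mVV) (fun=> funepos_ge0 _ _).
have En := ge0_integral_density_measure (lam \x lam)%E mrho rho0
  (measurableT_comp mn mVV) (fun=> funeneg_ge0 _ _).
by rewrite -[X in (X - _)%E = _]Ep -[X in (_ - X)%E = _]En.
Qed.

End gev_pair_law.

(** * Moments of the arrival times *)

Section arrival_moments.
Local Open Scope ereal_scope.
Variables (R : realType) (k : nat).
Local Notation lam := (@lebesgue_measure R).
Local Notation rho := (@arrival_density R k).
Local Notation gap := (@gap_density R).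

Let mexp : measurable_fun setT (fun t : R => (expR (- t))%:E : \bar R).
Proof.
by apply/measurable_EFinP; apply: measurableT_comp => //; exact: measurableT_comp.
Qed.

Let exp0 (t : R) : 0 <= (expR (- t))%:E :> \bar R.
Proof. by rewrite lee_fin expR_ge0. Qed.

Lemma integral_gap_expRN n : \int[lam]_t ((gap n 0 t)%:E * (expR (- t))%:E) = 1.
Proof.
by rewrite -(iter_tail n 0%R mexp exp0) iter_tail_expRN oppr0 expR0.
Qed.

(** When the integrand depends on the last arrival time alone, the inner tail merges with the outer
    ones into [k.+2] tails: the marginal is the Gamma law with density t^(k+1) exp(- t) / (k+1)!. *)
Lemma ge0_integral_arrival2 (f : R -> \bar R) : measurable_fun setT f ->
  (forall t, 0 <= f t) ->
  \int[lam \x lam]_z (f z.2 * (rho z)%:E) =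
  \int[lam]_t ((gap k.+1 0 t)%:E * (f t * (expR (- t))%:E)).
Proof.
move=> mf f0; have mf2 : measurable_fun setT (fun z : R * R => f z.2).
  exact: measurableT_comp.
rewrite (ge0_integral_arrival k mf2 (fun=> f0 _)).
rewrite -iter_tail; last 2 first.
- exact: emeasurable_funM.
- by move=> t; exact: mule_ge0.
by rewrite [iter k.+2 _ _]iterSr.
Qed.

(** Multiplying by t^n raises the rank of the Gamma density by n and leaves a ratio of
    factorials. *)
Lemma integral_arrival2_pow n :
  \int[lam \x lam]_z ((`|z.2| ^+ n)%:E * (rho z)%:E) =
  ((k.+1 + n)`!%:R / (k.+1)`!%:R)%:E.
Proof.
have mf : measurable_fun setT (fun t : R => (`|t| ^+ n)%:E : \bar R).
  by apply/measurable_EFinP; apply: measurable_funX; exact: normr_measurable.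
have f0 (t : R) : 0 <= (`|t| ^+ n)%:E :> \bar R by rewrite lee_fin exprn_ge0.
rewrite (ge0_integral_arrival2 mf f0).
pose c : R := ((k.+1 + n)`!%:R / (k.+1)`!%:R)%R.
have c0 : (0 <= c)%R by rewrite divr_ge0.
transitivity (\int[lam]_t (c%:E * ((gap (k.+1 + n) 0 t)%:E * (expR (- t))%:E))).
  apply: eq_integral => t _; rewrite !muleA; congr (_ * _); rewrite -!EFinM; congr EFin.
  rewrite /gap_density; case: ltP => t0; last by rewrite !mul0r mulr0.
  rewrite subr0 !mul1r gtr0_norm// exprD /c.
  have h m : (m`!%:R : R)%R != 0%R by rewrite pnatr_eq0 -lt0n fact_gt0.
  by rewrite mulrAC; field; rewrite !h.
rewrite ge0_integralZl//.
- by rewrite integral_gap_expRN mule1.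
- apply: emeasurable_funM => //; apply/measurable_EFinP.
  exact: (measurableT_comp (measurable_gap_density (k.+1 + n)) (measurable_pair1 _)).
- by move=> t _; rewrite mule_ge0// lee_fin gap_density_ge0.
Qed.

(** Dividing by t lowers the rank by one. The rank [k.+2] is at least 2, so a Gamma density remains;
    this is where r >= 2 enters the moments. *)
Lemma integral_arrival2_inv :
  \int[lam \x lam]_z ((z.2 `^ (-1))%:E * (rho z)%:E) = (k.+1%:R^-1)%:E.
Proof.
have mf : measurable_fun setT (fun t : R => (t `^ (-1))%:E : \bar R).
  by apply/measurable_EFinP; exact: measurable_powR.
have f0 (t : R) : 0 <= (t `^ (-1))%:E :> \bar R by rewrite lee_fin powR_ge0.
rewrite (ge0_integral_arrival2 mf f0).
have c0 : (0 <= k.+1%:R^-1 :> R)%R by rewrite invr_ge0.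
transitivity (\int[lam]_t (k.+1%:R^-1%:E * ((gap k 0 t)%:E * (expR (- t))%:E))).
  apply: eq_integral => t _; rewrite !muleA; congr (_ * _); rewrite -!EFinM; congr EFin.
  rewrite /gap_density; case: ltP => t0; last by rewrite !mul0r mulr0.
  rewrite subr0 !mul1r powR_inv1 ?(ltW t0)// exprS factS natrM invfM.
  have h : (k.+1%:R : R)%R != 0%R by rewrite pnatr_eq0.
  move: (k.+1%:R : R)%R (k`!%:R^-1 : R)%R h => x y x0.
  by field; rewrite x0 gt_eqF.
rewrite ge0_integralZl//.
- by rewrite integral_gap_expRN mule1.
- apply: emeasurable_funM => //; apply/measurable_EFinP.
  exact: (measurableT_comp (measurable_gap_density k) (measurable_pair1 _)).
- by move=> t _; rewrite mule_ge0// lee_fin gap_density_ge0.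
Qed.

Lemma integral_arrival_density : \int[lam \x lam]_z (rho z)%:E = 1.
Proof.
have := integral_arrival2_pow 0; rewrite addn0 divff ?pnatr_eq0 -?lt0n ?fact_gt0// => <-.
by apply: eq_integral => z _; rewrite expr0 mul1e.
Qed.

(** On the support the maximum is just the gap; it makes the integrand nonnegative everywhere, as
    Tonelli requires. Given u, the integral of (t - u) exp(- t) is a second iterated tail, equal to
    exp(- u). *)
Lemma integral_arrival_gap :
  \int[lam \x lam]_z ((Num.max (z.2 - z.1) 0)%:E * (rho z)%:E) = 1.
Proof.
have mg : measurable_fun setT (fun z : R * R => (Num.max (z.2 - z.1) 0)%:E : \bar R).
  apply/measurable_EFinP; apply: measurable_maxr => //; exact: measurable_funB.
have g0 (z : R * R) : 0 <= (Num.max (z.2 - z.1) 0)%:E :> \bar R.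
  by rewrite lee_fin le_max lexx orbT.
rewrite (ge0_integral_arrival k mg g0).
rewrite (_ : (fun u => tail _ u) = (fun u => (expR (- u))%:E)).
  by rewrite iter_tail_expRN oppr0 expR0.
apply/funext => u; rewrite -(iter_tail_expRN 2) (iter_tail 1 u mexp exp0).
apply: eq_integral => t _; rewrite muleA; congr (_ * _); rewrite -EFinM; congr EFin.
rewrite /gap_density; case: ltP => ut; last by rewrite !mul0r.
by rewrite !mul1r max_l ?subr_ge0 ?(ltW ut)// expr1 (_ : 1`!%:R = 1)%R ?divr1.
Qed.

End arrival_moments.

(** * The digamma function at integers *)

Section digamma_integral.
Variables (R : realType) (k : nat).
Local Notation lam := (@lebesgue_measure R).
Local Notation gap := (@gap_density R).
Local Notation D := (`]0%R, +oo[%classic : set (measurableTypeR R)).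

Let mD : measurable D.
Proof. exact: measurable_itv. Qed.

Let mexp : measurable_fun setT (fun t : R => expR (- t)).
Proof. by apply: measurableT_comp => //; exact: measurableT_comp. Qed.

Let DE (f : R -> \bar R) n :
  (\int[lam]_t ((gap n 0 t)%:E * f t) =
   \int[lam]_(t in D) ((t ^+ n / n`!%:R)%:E * f t))%E.
Proof.
rewrite [RHS]integral_mkcond; apply: eq_integral => t _; rewrite patchE /gap_density.
case: ltP => t0; first by rewrite mem_set/= ?in_itv/= ?t0// mul1r subr0.
by rewrite memNset/= ?mul0r ?mul0e// in_itv/= andbT ltNge t0.
Qed.

Lemma integral_pow_expRN n :
  (\int[lam]_(t in D) (t ^+ n * expR (- t))%:E = n`!%:R%:E)%E.
Proof.
have n0 : (n`!%:R : R) != 0 by rewrite pnatr_eq0 -lt0n fact_gt0.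
transitivity (\int[lam]_(t in D) ((n`!%:R)%:E * ((t ^+ n / n`!%:R)%:E * (expR (- t))%:E)))%E.
  apply: eq_integral => t _; rewrite -!EFinM; congr EFin; field.
  by [].
rewrite ge0_integralZl//.
- by rewrite -DE integral_gap_expRN mule1.
- apply: measurable_funTS; apply/measurable_EFinP; apply: measurable_funM => //.
  exact: measurable_funM.
- move=> t /=; rewrite in_itv/= andbT => t0.
  by rewrite -EFinM lee_fin mulr_ge0 ?expR_ge0// divr_ge0// exprn_ge0// ltW.
Qed.

Lemma integrable_pow_expRN n : lam.-integrable D (fun t => (t ^+ n * expR (- t))%:E).
Proof.
apply/integrableP; split.
  apply: measurable_funTS; apply/measurable_EFinP; exact: measurable_funM.
apply: (@le_lt_trans _ _ (n`!%:R)%:E); last exact: ltry.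
rewrite le_eqVlt; apply/orP; left; apply/eqP.
apply: (etrans _ (integral_pow_expRN n)); apply: eq_integral => t; rewrite inE/= in_itv/= andbT => t0.
by rewrite ger0_norm// mulr_ge0 ?expR_ge0// exprn_ge0// ltW.
Qed.

(** From s ln t = ln(t^s) <= t^s, taken at s = p and s = - p. *)
Lemma ln_norm_le (t p : R) : 0 < t -> 0 < p -> `|ln t| <= p^-1 * (t `^ p + t `^ (- p)).
Proof.
move=> t0 p0; rewrite mulrC ler_pdivlMr//.
have l (s : R) : ln t * s <= t `^ s.
  by rewrite mulrC -ln_powR; apply/ltW/ln_sublinear; exact: powR_gt0.
have [l0|l0] := leP 0 (ln t).
  by rewrite ger0_norm// (le_trans (l p))// lerDl powR_ge0.
by rewrite ltr0_norm// mulNr -mulrN (le_trans (l (- p)))// lerDr powR_ge0.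
Qed.

Local Notation r := (k.+2%:R : R).

Let f (x t : R) : R := t `^ (x - 1) * expR (- t).

(** A neighbourhood of r on which x - 1 exceeds 1/2, so that t^(x-1) absorbs the singularity
    t^(-1/2) of the bound on |ln t| near 0. *)
Let I : set R := `](r - 2^-1)%R, (r + 1)%R[.

Let powR_bound (x t : R) : I x -> 0 < t -> t `^ (x - 1) <= 1 + t ^+ k.+2.
Proof.
rewrite /I/= in_itv/= => /andP[x1 x2] t0.
have rE : r = k%:R + 2 by rewrite -addn2 natrD.
have k0 : 0 <= k%:R :> R by [].
have [t1|t1] := leP t 1.
  apply: (@le_trans _ _ 1); last by rewrite lerDl exprn_ge0// ltW.
  rewrite -[leRHS](powRr0 t); apply: ger_powR; rewrite ?t0 ?t1//; lra.
apply: (@le_trans _ _ (t ^+ k.+2)); last by rewrite lerDr.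
rewrite -powR_mulrn ?(ltW t0)//; apply: ler_powR; rewrite ?(ltW t1)//; lra.
Qed.

Let ln_powR_bound (x t : R) : I x -> 0 < t -> `|ln t| * t `^ (x - 1) <= 4 + t ^+ k.+3.
Proof.
rewrite /I/= in_itv/= => /andP[x1 x2] t0.
have rE : r = k%:R + 2 by rewrite -addn2 natrD.
have k0 : 0 <= k%:R :> R by [].
have [t1|t1] := leP t 1.
  apply: (@le_trans _ _ 4); last by rewrite lerDl exprn_ge0// ltW.
  have h2 : 0 < (2^-1 : R) by rewrite invr_gt0.
  apply: (@le_trans _ _ (2^-1^-1 * (t `^ 2^-1 + t `^ (- 2^-1)) * t `^ (x - 1))).
    by apply: ler_wpM2r; [exact: powR_ge0|exact: ln_norm_le].
  have p1 (s : R) : 0 <= s -> t `^ s <= 1.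
    by move=> s0; rewrite -[leRHS](powRr0 t); apply: ger_powR; rewrite ?t0 ?t1.
  rewrite -mulrA mulrDl -!powRD; last 2 first.
    by rewrite (gt_eqF t0) implybT.
    by rewrite (gt_eqF t0) implybT.
  have : t `^ (2^-1 + (x - 1)) <= 1 by apply: p1; lra.
  have : t `^ (- 2^-1 + (x - 1)) <= 1 by apply: p1; lra.
  by rewrite invrK; lra.
apply: (@le_trans _ _ (t ^+ k.+3)); last by rewrite lerDr.
rewrite exprS; apply: ler_pM => //; first exact: powR_ge0.
  by rewrite ger0_norm ?ln_ge0 ?(ltW t1)//; apply/ltW/ln_sublinear.
rewrite -powR_mulrn ?(ltW t0)//; apply: ler_powR; rewrite ?(ltW t1)//; lra.
Qed.

Let mpow x : measurable_fun setT (fun t : R => f x t).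
Proof. by apply: measurable_funM => //; exact: measurable_powR. Qed.

Let poly_int (c : R) n :
  lam.-integrable D (fun t => ((c + t ^+ n) * expR (- t))%:E).
Proof.
have -> : (fun t : R => ((c + t ^+ n) * expR (- t))%:E) =
    (fun t => c%:E * (t ^+ 0 * expR (- t))%:E + (t ^+ n * expR (- t))%:E)%E.
  by apply/funext => t; rewrite -EFinM -EFinD expr0 mul1r mulrDl.
apply: integrableD => //; last exact: integrable_pow_expRN.
by apply: integrableZl => //; exact: integrable_pow_expRN.
Qed.

Let intf x : I x -> lam.-integrable D (EFin \o f x).
Proof.
move=> Ix; apply: (le_integrable mD _ _ (poly_int 1 k.+2)).
  apply: measurable_funTS; apply/measurable_EFinP; exact: mpow.
move=> t /=; rewrite in_itv/= andbT => t0; rewrite lee_fin /f.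
rewrite !normrM (ger0_norm (expR_ge0 _)) ler_wpM2r ?expR_ge0//.
rewrite ger0_norm ?powR_ge0// (le_trans (powR_bound Ix t0))//.
exact: ler_norm.
Qed.

Let derf (x t : R) : 0 < t ->
  is_derive x (1 : R) (f ^~ t) (ln t * t `^ (x - 1) * expR (- t)).
Proof.
move=> t0.
have -> : f ^~ t = fun x => expR ((x - 1) * ln t) * expR (- t).
  by apply/funext => y; rewrite /f /powR gt_eqF.
rewrite /powR gt_eqF//; apply: is_derive_eq; rewrite /GRing.scale/=; ring.
Qed.

Let Ir : I r.
Proof. by rewrite /I/= in_itv/=; apply/andP; split; lra. Qed.

Let d1E t : 0 < t -> partial1of2 f r t = ln t * t ^+ k.+1 * expR (- t).
Proof.
move=> t0; rewrite partial1of2E; have h := derf r t0; rewrite derive_val.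
by rewrite -(@natrB _ k.+2 1)// subSS subn0 powR_mulrn// ltW.
Qed.

Let derG (x t : R) : I x -> D t ->
  `|partial1of2 f x t| <= (4 + t ^+ k.+3) * expR (- t).
Proof.
rewrite /= in_itv/= andbT => Ix t0; rewrite partial1of2E.
have h := derf x t0; rewrite derive_val !normrM (ger0_norm (expR_ge0 _)).
by rewrite ler_wpM2r ?expR_ge0// (ger0_norm (powR_ge0 _ _)) ln_powR_bound.
Qed.

Lemma integrable_ln_pow_expRN :
  lam.-integrable D (fun t => (ln t * t ^+ k.+1 * expR (- t))%:E).
Proof.
apply: (le_integrable mD _ _ (poly_int 4 k.+3)).
  apply: measurable_funTS; apply/measurable_EFinP; apply: measurable_funM => //.
  by apply: measurable_funM.
move=> t /=; rewrite in_itv/= andbT => t0; rewrite lee_fin.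
rewrite !normrM (ger0_norm (expR_ge0 _)) ler_wpM2r ?expR_ge0//.
have := ln_powR_bound Ir t0; rewrite -(@natrB _ k.+2 1)// subSS subn0.
rewrite powR_mulrn ?(ltW t0)// => h; rewrite (ger0_norm (exprn_ge0 _ (ltW t0))).
exact: le_trans (ler_norm _).
Qed.

Lemma Gamma_natE : Gamma r = k.+1`!%:R.
Proof.
rewrite /Gamma; apply: (congr1 fine (etrans _ (integral_pow_expRN k.+1))).
apply: eq_integral => t; rewrite inE/= in_itv/= andbT => t0.
by rewrite -(@natrB _ k.+2 1)// subSS subn0 powR_mulrn// ltW.
Qed.

Lemma digamma_natE : digamma r =
  k.+1`!%:R^-1 * fine (\int[lam]_(t in D) (ln t * t ^+ k.+1 * expR (- t))%:E)%E.
Proof.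
(* The absolute value makes the dominating function nonnegative on the whole line, not only for t >
   0. *)
pose Gt t : R := `|4 + t ^+ k.+3| * expR (- t).
have Gt0 t : 0 <= Gt t by rewrite mulr_ge0 ?expR_ge0.
have iG : lam.-integrable D (EFin \o Gt).
  apply: (le_integrable mD _ _ (poly_int 4 k.+3)).
    apply: measurable_funTS; apply/measurable_EFinP; apply: measurable_funM => //.
    apply: measurableT_comp => //; apply: measurable_funD => //.
  move=> t _; rewrite /Gt /= lee_fin !normrM normr_id.
  by [].
have ub x t : I x -> D t -> `|partial1of2 f x t| <= Gt t.
  move=> Ix Dt; apply: (le_trans (derG Ix Dt)).
  by rewrite ler_wpM2r ?expR_ge0// ler_norm.
have df x t : I x -> D t -> derivable (f ^~ t) x 1.
  by rewrite /= in_itv/= andbT => _ t0; have h := derf x t0; exact: ex_derive.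
have dG : derivable (@Gamma R) r 1.
  exact: (derivable_under_integral mD Ir intf df Gt0 iG ub).
have GE : derive1 (@Gamma R) r =
    fine (\int[lam]_(t in D) (ln t * t ^+ k.+1 * expR (- t))%:E)%E.
  rewrite (differentiation_under_integral mD Ir intf df Gt0 iG ub) /Rintegral.
  congr fine; apply: eq_integral => t; rewrite inE/= in_itv/= andbT => t0.
  by rewrite d1E.
have GN := Gamma_natE; move: dG GE GN.
rewrite /digamma; move: (@Gamma R) r => G x dG GE GN.
have hl : is_derive (G x) (1 : R) (@ln R) (G x)^-1.
  by apply: is_derive1_ln; rewrite GN ltr0n fact_gt0.
have hG : is_derive x (1 : R) G ('D_1 G x) by exact: DeriveDef.
have hc := is_derive1_comp hl hG.
by rewrite derive1E derive_val -derive1E GE GN.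
Qed.

End digamma_integral.

Section arrival_log_moments.
Local Open Scope ereal_scope.
Variables (R : realType) (k : nat).
Local Notation lam := (@lebesgue_measure R).
Local Notation rho := (@arrival_density R k).
Local Notation gap := (@gap_density R).

Let wt (t : R) : R := (gap k.+1 0 t * expR (- t))%R.

Let mwt : measurable_fun setT wt.
Proof.
apply: measurable_funM.
  exact: (measurableT_comp (measurable_gap_density k.+1) (measurable_pair1 _)).
by apply: measurableT_comp => //; exact: measurableT_comp.
Qed.

Let wt0 t : (0 <= wt t)%R.
Proof. by rewrite mulr_ge0 ?expR_ge0 ?gap_density_ge0. Qed.

(** Extends [ge0_integral_arrival2] to integrands of either sign, as the logarithm requires, through
    positive and negative parts. *)
Lemma integral_arrival2 (f : R -> \bar R) : measurable_fun setT f ->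
  \int[lam \x lam]_z (f z.2 * (rho z)%:E) = \int[lam]_t (f t * (wt t)%:E).
Proof.
move=> mf; have mf2 : measurable_fun setT (fun z : R * R => f z.2).
  exact: measurableT_comp.
have E2 := integral_density_measure (lam \x lam) (measurable_arrival_density k)
  (@arrival_density_ge0 R k) mf2.
have E1 := integral_density_measure lam mwt wt0 mf.
rewrite -[RHS]E1 -[LHS]E2 [LHS]integralE [RHS]integralE.
have pos (g : R -> \bar R) : measurable_fun setT g -> (forall t, 0 <= g t) ->
    \int[density_measure (lam \x lam) (measurable_arrival_density k)
      (@arrival_density_ge0 R k)]_z g z.2 = \int[density_measure lam mwt wt0]_t g t.
  move=> mg g0; have mg2 : measurable_fun setT (fun z : R * R => g z.2).
    exact: measurableT_comp.
  have F2 := ge0_integral_density_measure (lam \x lam) (measurable_arrival_density k)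
    (@arrival_density_ge0 R k) mg2 (fun=> g0 _).
  have F1 := ge0_integral_density_measure lam mwt wt0 mg g0.
  rewrite [LHS]F2 [RHS]F1 (ge0_integral_arrival2 k mg g0).
  by apply: eq_integral => t _; rewrite muleCA EFinM.
have -> : (fun z : R * R => f z.2)^\+ = fun z => f^\+ z.2.
  by apply/funext => z; rewrite !funeposE.
have -> : (fun z : R * R => f z.2)^\- = fun z => f^\- z.2.
  by apply/funext => z; rewrite !funenegE.
by congr (_ - _); apply: pos => //; [exact: measurable_funepos|exact: measurable_funeneg].
Qed.

Lemma integral_arrival2_ln :
  \int[lam \x lam]_z ((ln z.2)%:E * (rho z)%:E) = (digamma (k.+2%:R : R))%:E.
Proof.
have ml : measurable_fun setT (fun t : R => (ln t)%:E) by apply/measurable_EFinP.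
rewrite (integral_arrival2 ml) digamma_natE.
have mD : measurable (`]0%R, +oo[%classic : set (measurableTypeR R)).
  exact: measurable_itv.
have fin := integrable_fin_num mD (integrable_ln_pow_expRN R k).
have EZ := integralZl mD (integrable_ln_pow_expRN R k) (k.+1`!%:R^-1)%R.
rewrite EFinM (fineK fin) -[RHS]EZ.
rewrite [RHS]integral_mkcond; apply: eq_integral => t _; rewrite patchE /wt /gap_density.
case: ltP => t0; last by rewrite memNset/= ?mul0r ?mule0// in_itv/= andbT ltNge t0.
rewrite mem_set/= ?in_itv/= ?t0// -!EFinM mul1r subr0; congr EFin.
by move: (k.+1`!%:R^-1)%R (t ^+ k.+1)%R => x y; ring.
Qed.

End arrival_log_moments.

(** * The statistic D in arrival times *)

(** Two uses of (a + b)^2 <= 2 (a^2 + b^2), whence 2^2 times 2. *)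
Lemma ge0_exprD4_le (R : realDomainType) (x y : R) : 0 <= x -> 0 <= y ->
  (x + y) ^+ 4 <= 8 * (x ^+ 4 + y ^+ 4).
Proof.
move=> x0 y0.
have sq (a b : R) : (a + b) ^+ 2 <= 2 * (a ^+ 2 + b ^+ 2).
  rewrite -subr_ge0 (_ : _ - _ = (a - b) ^+ 2) ?sqr_ge0//; ring.
have e4 (a : R) : a ^+ 4 = (a ^+ 2) ^+ 2 by rewrite -exprM.
rewrite e4 (e4 x) (e4 y); apply: (@le_trans _ _ ((2 * (x ^+ 2 + y ^+ 2)) ^+ 2)).
  by rewrite ler_sqr ?nnegrE ?sqr_ge0 ?mulr_ge0 ?addr_ge0 ?sqr_ge0.
rewrite exprMn (_ : 8 = 2 ^+ 2 * 2) -?mulrA ?ler_pM2l ?exprn_gt0//; ring.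
Qed.

Lemma norm_exprD4_le (R : realDomainType) (x y : R) :
  `|x + y| ^+ 4 <= 8 * (`|x| ^+ 4 + `|y| ^+ 4).
Proof.
apply: le_trans (ge0_exprD4_le _ _) => //.
by rewrite lerXn2r ?nnegrE ?addr_ge0 ?ler_normD.
Qed.

Section arrival_statistic.
Variables (R : realType) (mu sigma xi : R).
Hypothesis sigma0 : 0 < sigma.
Local Notation lam := (@lebesgue_measure R).
Local Notation U := (gev_arrival mu sigma xi).
Local Notation V := (gev_quantile mu sigma xi).

Definition D_arrival (z : R * R) : R := - ln sigma - z.2 + z.1 + (1 + xi) * ln z.2.

(** In arrival times ln(1 + xi z) = - xi ln t, so the last term of [D_stat] becomes (1 + xi) ln t,
    in the same form as for xi = 0. *)
Lemma D_stat_quantile (u t : R) : 0 < u -> 0 < t ->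
  D_stat mu sigma xi (V t) (V u) = D_arrival (u, t).
Proof.
move=> u0 t0; have := gev_quantileK mu xi sigma0 u0; have := gev_quantileK mu xi sigma0 t0.
have := gev_supp_quantile mu xi sigma0 t; have := gev_supp_quantile mu xi sigma0 u.
rewrite /D_stat /D_arrival/=; move: (V t) (V u) => yt yu.
rewrite /gev_supp /gev_arrival => st su; case: ifPn => xi0 Et Eu.
  have -> : ln t = - gev_z mu sigma yt by rewrite -Et expRK.
  by rewrite Et Eu (eqP xi0); ring.
rewrite /powR !gt_eqF//= Et Eu.
have -> : ln t = - xi^-1 * ln (1 + xi * gev_z mu sigma yt) by rewrite -Et expRK.
by field.
Qed.

Lemma measurable_D_arrival : measurable_fun setT D_arrival.
Proof.
apply: measurable_funD.
  apply: measurable_funD => //; exact: measurable_funB.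
by apply: measurable_funM => //; exact: measurableT_comp.
Qed.

End arrival_statistic.

(** [ln_norm_le] at p = 1/4: fourth powers turn the exponents into 1 and -1, with constant 4^4 times
    8. *)
Lemma ln_norm_expr4_le (R : realType) (t : R) : 0 < t ->
  `|ln t| ^+ 4 <= 2048 * (t + t `^ (-1)).
Proof.
move=> t0; have q0 : 0 < (4^-1 : R) by rewrite invr_gt0.
have p0 (s : R) : 0 <= t `^ s by exact: powR_ge0.
have E (s : R) : (t `^ s) ^+ 4 = t `^ (s * 4) by rewrite -powR_mulrn// -powRrM.
apply: (@le_trans _ _ ((4 * (t `^ 4^-1 + t `^ (- 4^-1))) ^+ 4)).
  rewrite lerXn2r ?nnegrE ?mulr_ge0 ?addr_ge0//.
  by have := ln_norm_le t0 q0; rewrite invrK.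
rewrite exprMn; apply: (@le_trans _ _ (4 ^+ 4 * (8 * (t + t `^ (-1))))).
  rewrite ler_wpM2l ?exprn_ge0//; apply: (le_trans (ge0_exprD4_le (p0 _) (p0 _))).
  by rewrite !E mulNr mulVf// powRr1// ltW.
by rewrite mulrA ler_wpM2r ?addr_ge0 ?(ltW t0)//; lra.
Qed.

Lemma arrival_density_neq0 (R : realType) k (z : R * R) :
  arrival_density k z != 0 -> 0 < z.1 /\ z.1 < z.2.
Proof.
rewrite /arrival_density; case: ltP => z1; last by rewrite !mul0r eqxx.
by case: ltP => z2; last by rewrite mul0r mulr0 eqxx.
Qed.

(** * Integrability and mean of the statistic in arrival times *)

Section arrival_statistic_moments.
Local Open Scope ereal_scope.
Variables (R : realType) (sigma xi : R) (k : nat).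
Local Notation lam := (@lebesgue_measure R).
Local Notation rho := (@arrival_density R k).
Local Notation D := (D_arrival sigma xi).

Let mrho : measurable_fun setT (fun z => (rho z)%:E).
Proof. by apply/measurable_EFinP; exact: measurable_arrival_density. Qed.

Let m2 : measurable_fun [set: R * R] snd. Proof. exact: measurable_snd. Qed.

Definition arrival_integrable (f : R * R -> R) : Prop :=
  (lam \x lam)%E.-integrable setT (fun z => (f z)%:E * (rho z)%:E).

Let ai_ge0 (f : R * R -> R) (c : R) : measurable_fun setT f -> (forall z, (0 <= f z)%R) ->
  \int[lam \x lam]_z ((f z)%:E * (rho z)%:E) = c%:E -> arrival_integrable f.
Proof.
move=> mf f0 E; apply/integrableP; split.
  by apply: emeasurable_funM => //; apply/measurable_EFinP.
under eq_integral do rewrite gee0_abs ?mule_ge0 ?lee_fin ?arrival_density_ge0//.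
by rewrite E ltry.
Qed.

Let ai_add f g : arrival_integrable f -> arrival_integrable g ->
  arrival_integrable (fun z => f z + g z)%R.
Proof.
move=> hf hg; have := integrableD measurableT hf hg; apply: eq_integrable => // z _.
by rewrite EFinD muleDl// fin_num_adde_defl.
Qed.

Let ai_scale c f : arrival_integrable f -> arrival_integrable (fun z => c * f z)%R.
Proof.
move=> hf; have := integrableZl measurableT c hf; apply: eq_integrable => // z _.
by rewrite EFinM muleA.
Qed.

(** Domination is asked only where the density can be nonzero; elsewhere both products vanish. *)
Let ai_le (f g : R * R -> R) : measurable_fun setT f -> arrival_integrable g ->
  (forall z : R * R, (0 < z.1)%R -> (z.1 < z.2)%R -> (`|f z| <= g z)%R) -> arrival_integrable f.
Proof.
move=> mf hg fg; apply: le_integrable hg => //.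
  by apply: emeasurable_funM => //; apply/measurable_EFinP.
move=> z _; rewrite -!EFinM lee_fin !(normrM _ (rho z)).
have [->|] := eqVneq (rho z) 0%R; first by rewrite normr0 !mulr0.
move/arrival_density_neq0 => [z1 z2]; apply: ler_wpM2r => //.
by apply: (le_trans (fg _ z1 z2)); exact: ler_norm.
Qed.

Let ai_pow n : arrival_integrable (fun z => `|z.2| ^+ n)%R.
Proof.
apply: ai_ge0 (integral_arrival2_pow R k n).
  by apply: measurable_funX; exact: measurableT_comp.
by move=> z; exact: exprn_ge0.
Qed.

Let ai_inv : arrival_integrable (fun z => z.2 `^ (-1))%R.
Proof.
apply: ai_ge0 (integral_arrival2_inv R k); last by move=> z; exact: powR_ge0.
by apply: (measurableT_comp (measurable_powR _)).
Qed.

Let ai_cst c : arrival_integrable (fun=> c).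
Proof.
have := ai_scale c (ai_pow 0); congr arrival_integrable.
by apply/funext => z; rewrite expr0 mulr1.
Qed.

Let ai_gap : arrival_integrable (fun z => Num.max (z.2 - z.1) 0)%R.
Proof.
apply: ai_ge0 (integral_arrival_gap R k).
  by apply: measurable_maxr => //; exact: measurable_funB.
by move=> z; rewrite le_max lexx orbT.
Qed.

Let mln : measurable_fun setT (fun z : R * R => ln z.2).
Proof. exact: measurableT_comp. Qed.

Let ai_ln : arrival_integrable (fun z => ln z.2)%R.
Proof.
apply: (ai_le mln (ai_add (ai_pow 1) ai_inv)) => z z1 z2.
have z20 : (0 < z.2)%R by exact: lt_trans z2.
have := ln_norm_le z20 ltr01; rewrite invr1 mul1r powRr1 ?(ltW z20)//.
by rewrite expr1 (gtr0_norm z20).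
Qed.

Lemma arrival_integrable_D4 : arrival_integrable (fun z => `|D z| ^+ 4)%R.
Proof.
(* D is split twice with the factor 8, first isolating the logarithm: 64 = 8 times 8 and 16384 = 8
   times 2048. On 0 < z.1 < z.2 the gap is at most z.2. *)
pose B (z : R * R) : R := (64 * `|ln sigma| ^+ 4 + 64 * `|z.2| ^+ 4 +
  16384 * `|1 + xi| ^+ 4 * (`|z.2| ^+ 1 + z.2 `^ (-1)))%R.
have iB : arrival_integrable B.
  apply: ai_add; first by apply: ai_add; [exact: ai_cst|exact/ai_scale/ai_pow].
  by apply: ai_scale; apply: ai_add => //; exact: ai_pow.
apply: (ai_le _ iB).
  apply: measurable_funX; apply: measurableT_comp => //; exact: measurable_D_arrival.
move=> z z1 z2; have z20 : (0 < z.2)%R by exact: lt_trans z2.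
rewrite ger0_norm ?exprn_ge0// /D_arrival.
rewrite (_ : - ln sigma - z.2 + z.1 = - ln sigma + (z.1 - z.2))%R; last by ring.
apply: (le_trans (norm_exprD4_le _ _)).
have h1 := norm_exprD4_le (- ln sigma) (z.1 - z.2).
rewrite normrN in h1.
have h2 : (`|z.1 - z.2| ^+ 4 <= `|z.2| ^+ 4)%R.
  rewrite lerXn2r ?nnegrE// ltr0_norm ?subr_lt0// gtr0_norm//; lra.
have h3 : (`|(1 + xi) * ln z.2| ^+ 4 <= `|1 + xi| ^+ 4 * (2048 * (z.2 + z.2 `^ (-1))))%R.
  by rewrite normrM exprMn ler_wpM2l ?exprn_ge0// ln_norm_expr4_le.
rewrite /B expr1 [in X in (_ <= _ + _ * X)%R](gtr0_norm z20).
move: h1 h2 h3.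
move: (`|_ + _| ^+ 4)%R (`|_ * _| ^+ 4)%R (`|_ - _| ^+ 4)%R => a b c.
move: (`|_| ^+ 4)%R (`|_| ^+ 4)%R (`|_| ^+ 4)%R (_ `^ _)%R => e f g h.
by move=> *; lra.
Qed.

Lemma integral_D_arrival :
  \int[lam \x lam]_z ((D z)%:E * (rho z)%:E) = (eta_r k.+2 sigma xi)%:E.
Proof.
transitivity (\int[lam \x lam]_z (((- ln sigma)%:E * (rho z)%:E
    + (-1)%:E * ((Num.max (z.2 - z.1) 0)%:E * (rho z)%:E))
    + (1 + xi)%:E * ((ln z.2)%:E * (rho z)%:E))).
  apply: eq_integral => z _; rewrite -!EFinM -!EFinD; congr EFin.
  have [->|] := eqVneq (rho z) 0%R; first by rewrite !(mulr0, addr0).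
  move/arrival_density_neq0 => [z1 z2].
  rewrite max_l ?subr_ge0 ?(ltW z2)// /D_arrival; ring.
have i1 := ai_cst (- ln sigma)%R.
have i2 := integrableZl measurableT (-1) ai_gap.
have i3 := integrableZl measurableT (1 + xi) ai_ln.
have i0 : (lam \x lam)%E.-integrable setT (fun z => (rho z)%:E).
  have := ai_cst 1; apply: eq_integrable => // z _; by rewrite mul1e.
have i12 := integrableD measurableT i1 i2.
rewrite (integralD measurableT i12 i3) (integralD measurableT i1 i2).
rewrite (integralZl measurableT i0) (integralZl measurableT ai_gap).
rewrite (integralZl measurableT ai_ln) integral_arrival_density.
rewrite (integral_arrival_gap R k) (integral_arrival2_ln R k) !mule1.
by rewrite -EFinM -!EFinD.
Qed.

End arrival_statistic_moments.

Section arrival_statistic_nondegenerate.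
Local Open Scope ereal_scope.
Variables (R : realType) (sigma xi : R) (k : nat).
Local Notation lam := (@lebesgue_measure R).
Local Notation rho := (@arrival_density R k).
Local Notation D := (D_arrival sigma xi).

Let mD := @measurable_D_arrival R sigma xi.

Let mrho : measurable_fun setT (fun z => (rho z)%:E).
Proof. by apply/measurable_EFinP; exact: measurable_arrival_density. Qed.

(* For a given second arrival time, [D] is an injective affine function of the first one. *)
Lemma integral_arrival_level c :
  \int[lam \x lam]_z ((\1_[set c] (D z))%:E * (rho z)%:E) = 0.
Proof.
have mf : measurable_fun setT (fun z => (\1_[set c] (D z))%:E * (rho z)%:E).
  apply: emeasurable_funM => //; apply/measurable_EFinP.
  exact: (measurableT_comp (measurable_indic (measurable_set1 c)) mD).
have f0 z : 0 <= (\1_[set c] (D z))%:E * (rho z)%:E.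
  by rewrite mule_ge0// lee_fin arrival_density_ge0.
have E := fubini_tonelli2 (m1 := lam) (m2 := lam) _ mf f0.
rewrite [LHS]E; apply: integral0_eq => t _; rewrite /fubini_G.
pose u0 : R := (c + ln sigma + t - (1 + xi) * ln t)%R.
rewrite -[RHS](integral_set1 (fun u => (\1_[set c] (D (u, t)))%:E * (rho (u, t))%:E) u0).
rewrite [RHS]integral_mkcond; apply: eq_integral => u _; rewrite patchE.
case: ifPn => //; rewrite notin_setE/= => uu0.
rewrite indicE memNset ?mul0e//= => Dc; apply: uu0.
by rewrite /u0 -Dc /D_arrival/=; ring.
Qed.

(** If the integral vanished, [D] would equal [c] almost everywhere for the density [rho]; then the
    total mass 1 would sit on a level set of mass 0. *)
Lemma integral_D_arrival_sqr_gt0 c :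
  0 < \int[lam \x lam]_z (((D z - c) ^+ 2)%:E * (rho z)%:E).
Proof.
have mf : measurable_fun setT (fun z => ((D z - c) ^+ 2)%:E * (rho z)%:E).
  apply: emeasurable_funM => //; apply/measurable_EFinP.
  by apply: measurable_funX; exact: measurable_funB.
have f0 z : 0 <= ((D z - c) ^+ 2)%:E * (rho z)%:E.
  by rewrite mule_ge0// lee_fin ?sqr_ge0 ?arrival_density_ge0.
rewrite lt_neqAle integral_ge0 ?andbT; last by move=> z _; exact: f0.
apply/eqP => I0; have a0 : ae_eq (lam \x lam) setT
    (fun z => ((D z - c) ^+ 2)%:E * (rho z)%:E) (cst 0).
  apply/ae_eq_integral_abs => //; rewrite -[RHS]/(0) I0.
  by apply: eq_integral => z _; rewrite gee0_abs.
have mg : measurable_fun setT (fun z => (\1_[set c] (D z))%:E * (rho z)%:E).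
  apply: emeasurable_funM => //; apply/measurable_EFinP.
  exact: (measurableT_comp (measurable_indic (measurable_set1 c)) mD).
have ag : ae_eq (lam \x lam) setT (fun z => (rho z)%:E)
    (fun z => (\1_[set c] (D z))%:E * (rho z)%:E).
  apply: filterS a0 => z h /h; have [->|Dc] := eqVneq (D z) c; first by rewrite indicE mem_set// mul1e.
  move/eqP; rewrite mule_eq0 eqe expf_eq0/= subr_eq0 (negbTE Dc)/= => /eqP ->.
  by rewrite mule0.
have := @ae_eq_integral _ _ _ (lam \x lam) _ _ _ measurableT mrho mg ag.
rewrite (integral_arrival_density R k) integral_arrival_level => /eqP.
by rewrite eqe oner_eq0.
Qed.

End arrival_statistic_nondegenerate.

Lemma integrable_expr4 d (T : measurableType d) (R : realType) (P : probability T R)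
    (f : T -> R) : measurable_fun setT f ->
  P.-integrable setT (fun w => (f w ^+ 4)%:E) ->
  [/\ P.-integrable setT (fun w => (f w)%:E), P.-integrable setT (fun w => (f w ^+ 2)%:E)
    & P.-integrable setT (fun w => (`|f w| ^+ 3)%:E)].
Proof.
move=> mf i4; have i1 := finite_measure_integrable_cst P 1 measurableT.
have i14 := integrableD measurableT i1 i4.
have p4 (x : R) : x ^+ 4 = `|x| ^+ 4 by rewrite -normrX ger0_norm ?exprn_even_ge0.
have le4 n (x : R) : (n <= 4)%N -> `|x| ^+ n <= 1 + x ^+ 4.
  move=> n4; have [x1|x1] := leP `|x| 1.
    rewrite (@le_trans _ _ 1) ?exprn_ile1//.
    by rewrite lerDl p4 exprn_ge0.
  rewrite (@le_trans _ _ (`|x| ^+ 4)) ?ler_weXn2l ?(ltW x1)//.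
  by rewrite -p4 lerDr.
have dom (g : T -> R) n : (n <= 4)%N -> measurable_fun setT g -> (forall w, `|g w| = `|f w| ^+ n) ->
    P.-integrable setT (fun w => (g w)%:E).
  move=> n4 mg gf; apply: le_integrable i14 => //; first exact/measurable_EFinP.
  move=> w _; rewrite lee_fin gf (le_trans (le4 n _ n4))//; exact: ler_norm.
split; [apply: (dom _ 1) => //|apply: (dom _ 2)|apply: (dom _ 3)] => //.
- exact: measurable_funX.
- by move=> w; rewrite normrX.
- by apply: measurable_funX; exact: measurableT_comp.
- by move=> w; rewrite normrX normr_id.
Qed.

Lemma measurable_D_stat (R : realType) (mu sigma xi : R) :
  measurable_fun setT (fun z : R * R => D_stat mu sigma xi z.2 z.1).
Proof.
have mz1 : measurable_fun setT (fun z : R * R => gev_z mu sigma z.1).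
  by apply: measurableT_comp; first exact: measurable_gev_z.
have mz2 : measurable_fun setT (fun z : R * R => gev_z mu sigma z.2).
  by apply: measurableT_comp; first exact: measurable_gev_z.
rewrite /D_stat; case: (xi == 0).
  apply: measurable_funB => //; apply: measurable_funD.
    apply: measurable_funB => //; apply: measurableT_comp => //.
    exact: measurableT_comp.
  by apply: measurableT_comp => //; exact: measurableT_comp.
have mx1 : measurable_fun setT (fun z : R * R => 1 + xi * gev_z mu sigma z.1).
  by apply: measurable_funD => //; exact: measurable_funM.
have mx2 : measurable_fun setT (fun z : R * R => 1 + xi * gev_z mu sigma z.2).
  by apply: measurable_funD => //; exact: measurable_funM.
apply: measurable_funB; last by apply: measurable_funM => //; exact: measurableT_comp.
apply: measurable_funD; last exact: (measurableT_comp (measurable_powR _)).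
by apply: measurable_funB => //; exact: (measurableT_comp (measurable_powR _)).
Qed.

Section D_stat_moments.
Local Open Scope ereal_scope.
Variables (R : realType) (mu sigma xi : R).
Hypothesis sigma0 : (0 < sigma)%R.
Context d (T : measurableType d) (P : probability T R) (k : nat).
Variables (Y : nat -> T -> R) (mY : forall j, measurable_fun setT (Y j)).
Hypothesis gevY : is_gevr P k.+2 mu sigma xi Y.
Local Notation lam := (@lebesgue_measure R).
Local Notation rho := (@arrival_density R k).
Local Notation D := (D_arrival sigma xi).
Local Notation eta := (eta_r k.+2 sigma xi).
Let DY w : R := D_stat mu sigma xi (Y k.+1 w) (Y k w).

Let mYY : measurable_fun setT (fun w => (Y k w, Y k.+1 w)).
Proof. exact: measurable_fun_pair. Qed.

Let mDY : measurable_fun setT DY.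
Proof. exact: (measurableT_comp (@measurable_D_stat R mu sigma xi) mYY). Qed.

Lemma integral_D_stat (phi : R -> R) : measurable_fun setT phi ->
  \int[P]_w (phi (D_stat mu sigma xi (Y k.+1 w) (Y k w)))%:E =
  \int[lam \x lam]_z ((phi (D z))%:E * (rho z)%:E).
Proof.
move=> mphi.
have mg : measurable_fun setT (fun z : R * R => (phi (D_stat mu sigma xi z.2 z.1))%:E).
  apply/measurable_EFinP; apply: (measurableT_comp mphi); exact: measurable_D_stat.
have E := integral_gev_pair sigma0 mY gevY mg.
rewrite [LHS]E; apply: eq_integral => z _.
(* The passage to [D_arrival] is valid for positive arrival times only; elsewhere the density is
   0. *)
have [->|] := eqVneq (rho z) 0%R; first by rewrite !mule0.
move/arrival_density_neq0 => [z1 z2]; congr ((phi _)%:E * _).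
by case: z z1 z2 => u t /= u0 ut; apply: D_stat_quantile => //; exact: lt_trans ut.
Qed.

Lemma expectation_D_stat :
  \int[P]_w (D_stat mu sigma xi (Y k.+1 w) (Y k w))%:E = eta%:E.
Proof. by rewrite (integral_D_stat (@measurable_id _ _ _)) integral_D_arrival. Qed.

Lemma integrable_D_stat4 :
  P.-integrable setT (fun w => (D_stat mu sigma xi (Y k.+1 w) (Y k w) ^+ 4)%:E).
Proof.
apply/integrableP; split; first by apply/measurable_EFinP; exact: measurable_funX.
have m4 : measurable_fun setT (fun x : R => `|x| ^+ 4)%R.
  by apply: measurable_funX; exact: normr_measurable.
have /integrableP[mI] := arrival_integrable_D4 sigma xi k.
apply: le_lt_trans; rewrite (eq_integral (fun w => (`|DY w| ^+ 4)%:E)); last first.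
  by move=> w _; rewrite /= normrX.
rewrite (integral_D_stat m4); apply: ge0_le_integral => //.
- by move=> z _; rewrite mule_ge0// lee_fin ?exprn_ge0 ?arrival_density_ge0.
- exact: (measurableT_comp (@abse_measurable R setT) mI).
- by move=> z _; exact: lee_abs.
Qed.

Lemma integrable_D_stat4_centered : P.-integrable setT
  (fun w => ((D_stat mu sigma xi (Y k.+1 w) (Y k w) - eta) ^+ 4)%:E).
Proof.
have i1 := finite_measure_integrable_cst P (eta ^+ 4) measurableT.
have i8 := integrableZl measurableT 8 (integrableD measurableT integrable_D_stat4 i1).
apply: le_integrable i8 => //.
  by apply/measurable_EFinP; apply: measurable_funX; exact: measurable_funB.
have p4 (x : R) : (`|x| ^+ 4 = x ^+ 4)%R by rewrite -normrX ger0_norm ?exprn_even_ge0.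
move=> w _; rewrite -EFinD -EFinM lee_fin normrX (le_trans (norm_exprD4_le _ _))//.
by rewrite normrN !p4 ler_norm.
Qed.

Lemma variance_D_stat : 0 <
  \int[P]_w ((D_stat mu sigma xi (Y k.+1 w) (Y k w) - eta) ^+ 2)%:E < +oo.
Proof.
have m2 : measurable_fun setT (fun x : R => (x - eta) ^+ 2)%R.
  by apply: measurable_funX; exact: measurable_funB.
apply/andP; split; first by rewrite (integral_D_stat m2) integral_D_arrival_sqr_gt0.
have mf : measurable_fun setT (fun w => DY w - eta)%R by exact: measurable_funB.
have [_ i2 _] := integrable_expr4 mf integrable_D_stat4_centered.
exact: integrable_lty i2.
Qed.

End D_stat_moments.

(** * The studentized statistic of independent blocks *)

Section gev_blocks.
Local Open Scope ereal_scope.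
Variables (R : realType) (mu sigma xi : R).
Hypothesis sigma0 : (0 < sigma)%R.
Context d (T : measurableType d) (P : probability T R) (k : nat).
Variables (Y : nat -> nat -> T -> R) (mY : forall i j, measurable_fun setT (Y i j)).
Hypothesis gevY : forall i, is_gevr P k.+2 mu sigma xi (Y i).
Hypothesis indepY : independent_vectors P k.+2 Y.
Local Notation N01 := (@normal_prob R 0%R 1%R).
Local Notation eta := (eta_r k.+2 sigma xi).

Let W i w : R * R := (Y i k w, Y i k.+1 w).

Let mW i : measurable_fun setT (W i).
Proof. exact: measurable_fun_pair. Qed.

(** A rectangle in the last two coordinates is a full rectangle event with [setT] in the other
    coordinates. *)
Lemma indep_last_two s (A B : nat -> set R) : uniq s ->
  (forall i, measurable (A i)) -> (forall i, measurable (B i)) ->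
  P [set w | forall i, i \in s -> (A i `*` B i) (W i w)] =
  \prod_(i <- s) P (W i @^-1` (A i `*` B i)).
Proof.
move=> us mA mB.
pose C i j : set R := if j == k then A i else if j == k.+1 then B i else setT.
have mC i j : measurable (C i j).
  by rewrite /C; case: (j == k) => //; case: (j == k.+1).
have rectE i : W i @^-1` (A i `*` B i) = rect_event k.+2 (Y i) (C i).
  apply/seteqP; split => w /=.
    move=> [h1 h2] j _; rewrite /C.
    by case: eqP => [->//|_]; case: eqP => [->|].
  move=> h; split.
    by have := h k; rewrite /C eqxx; apply.
  have := h k.+1; rewrite /C eqxx (_ : (k.+1 == k) = false); first exact.
  by apply/negbTE; rewrite neq_ltn ltnSn orbT.
under [RHS]eq_bigr do rewrite rectE.
rewrite -(indepY us mC); congr (P _).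
by apply/seteqP; split => w h i /= /h; rewrite -rectE.
Qed.

Lemma ident_last_two i A : measurable A -> P (W i @^-1` A) = P (W 0%N @^-1` A).
Proof.
have h := @finite_measure_prod_unique _ _ _ _ R (image_measure P (mW i))
  (image_measure P (mW 0%N)).
apply: h; first by rewrite /= /pushforward preimage_setT probability_setT ltry.
move=> B1 B2 m1 m2; rewrite /= /pushforward.
have E1 := gev_pair_rect sigma0 (gevY i) m1 m2.
have E0 := gev_pair_rect sigma0 (gevY 0%N) m1 m2.
exact: etrans E1 (esym E0).
Qed.

Let tau2 : R := fine (\int[P]_w ((D_stat mu sigma xi (Y 0%N k.+1 w) (Y 0%N k w) - eta) ^+ 2)%:E).

Let tau2_gt0 : (0 < tau2)%R.
Proof. by apply: fine_gt0; exact: variance_D_stat. Qed.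

Let tau : R := Num.sqrt tau2.

Let tau0 : (0 < tau)%R. Proof. by rewrite sqrtr_gt0. Qed.

Let g (z : R * R) : R := ((D_stat mu sigma xi z.2 z.1 - eta) / tau)%R.

Let mg : measurable_fun setT g.
Proof.
apply: measurable_funM => //; apply: measurable_funB => //; exact: measurable_D_stat.
Qed.

Let X i w : R := g (W i w).

Let mX i : measurable_fun setT (X i).
Proof. exact: (measurableT_comp mg (mW i)). Qed.

(** Puts the summands into the affine form [eta + tau * X] required by [studentized_clt]. *)
Let XE i w : D_stat mu sigma xi (Y i k.+1 w) (Y i k w) = (eta + tau * X i w)%R.
Proof. by rewrite /X /g mulrCA divff ?gt_eqF// mulr1 addrC subrK. Qed.

Let X4 : P.-integrable setT (fun w => (X 0%N w ^+ 4)%:E).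
Proof.
have := integrableZl measurableT (tau ^- 4)
  (integrable_D_stat4_centered sigma0 (mY 0%N) (gevY 0%N)).
apply: eq_integrable => // w _.
by rewrite -EFinM /X /g /= expr_div_n mulrC.
Qed.

Let iD : P.-integrable setT (fun w => (D_stat mu sigma xi (Y 0%N k.+1 w) (Y 0%N k w))%:E).
Proof.
have mD : measurable_fun setT (fun w => D_stat mu sigma xi (Y 0%N k.+1 w) (Y 0%N k w)).
  exact: (measurableT_comp (@measurable_D_stat R mu sigma xi) (mW 0%N)).
by have [] := integrable_expr4 mD (integrable_D_stat4 sigma0 (mY 0%N) (gevY 0%N)).
Qed.

Let X1 : \int[P]_w (X 0%N w)%:E = 0.
Proof.
have i1 := finite_measure_integrable_cst P eta measurableT.
have iB := integrableB measurableT iD i1.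
transitivity (\int[P]_w ((tau^-1)%:E *
    ((D_stat mu sigma xi (Y 0%N k.+1 w) (Y 0%N k w))%:E - eta%:E))).
  by apply: eq_integral => w _; rewrite -EFinB -EFinM mulrC.
have EZ := integralZl measurableT iB tau^-1.
have EB := integralB measurableT iD i1.
rewrite [LHS]EZ [X in _ * X]EB (expectation_D_stat sigma0 (mY 0%N) (gevY 0%N)).
have -> : \int[P]_w (EFin \o cst eta) w = eta%:E.
  by rewrite -[RHS]mule1 -(probability_setT P); exact: (integral_cst P measurableT eta%:E).
by rewrite subee// mule0.
Qed.

Let X2 : \int[P]_w (X 0%N w ^+ 2)%:E = 1.
Proof.
have mc : measurable_fun setT
    (fun w => D_stat mu sigma xi (Y 0%N k.+1 w) (Y 0%N k w) - eta)%R.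
  apply: measurable_funB => //.
  exact: (measurableT_comp (@measurable_D_stat R mu sigma xi) (mW 0%N)).
have [_ i2 _] := integrable_expr4 mc
  (integrable_D_stat4_centered sigma0 (mY 0%N) (gevY 0%N)).
transitivity (\int[P]_w ((tau ^- 2)%:E *
    ((D_stat mu sigma xi (Y 0%N k.+1 w) (Y 0%N k w) - eta) ^+ 2)%:E)).
  by apply: eq_integral => w _; rewrite -EFinM mulrC -expr_div_n.
have EZ := integralZl measurableT i2 (tau ^- 2).
rewrite [LHS]EZ -(fineK (integrable_fin_num measurableT i2)) -EFinM.
by rewrite sqr_sqrtr ?(ltW tau2_gt0)// mulVf// gt_eqF.
Qed.

Lemma T_stat_clt (x e : R) : (0 < e)%R -> exists N, forall n, (N <= n)%N ->
  P [set w | (T_stat k.+2 mu sigma xi Y n.+1 w <= x)%R] <= N01 [set y | (y <= x)%R] + e%:E /\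
  N01 [set y | (y <= x)%R] <= P [set w | (T_stat k.+2 mu sigma xi Y n.+1 w <= x)%R] + e%:E.
Proof.
move=> e0; have [i1 i2 i3] := integrable_expr4 (mX 0%N) X4.
have indW := indep_pairs mW indep_last_two.
have indX := indep_comp mg indW.
have idX := ident_comp mg ident_last_two.
have [N hN] := studentized_clt mX indX idX i1 i2 i3 X4 X1 X2 eta tau0 x e0.
exists N => n /hN; rewrite (_ : [set w | _] =
  [set w | (T_stat k.+2 mu sigma xi Y n.+1 w <= x)%R])//.
have DE : (fun i w => eta + tau * X i w)%R =
    (fun i w => D_stat mu sigma xi (Y i k.+1 w) (Y i k w)).
  by apply/funext => i; apply/funext => w; rewrite XE.
by rewrite DE.
Qed.

Lemma T_stat_cvg : cvg_in_distribution P (T_stat k.+2 mu sigma xi Y) N01.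
Proof.
move=> x _.
have fN : N01 [set y | (y <= x)%R] \is a fin_num.
  by apply: fin_num_measure; exact: measurable_le_itv.
have fP n : P [set w | (T_stat k.+2 mu sigma xi Y n w <= x)%R] \is a fin_num.
  apply: fin_num_measure; rewrite -[X in measurable X]setTI.
  have mT := @measurable_student_stat _ _ _ eta
    (fun i w => D_stat mu sigma xi (Y i k.+1 w) (Y i k w)) n
    (fun i => measurableT_comp (@measurable_D_stat R mu sigma xi) (mW i)).
  exact: (mT measurableT _ (measurable_le_itv x)).
rewrite -(fineK fN).
apply/fine_cvgP; split; first by apply: nearW => n; exact: fP.
apply/cvgrPdist_le => e e0.
have [N hN] := T_stat_clt x e0.
(* Starting at [N.+1] discards the empty sample and matches the shift in [T_stat_clt], which speaks
   of sample size [n.+1]. *)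
exists N.+1 => //= -[//|n] Nn.
have [h1 h2] := hN n Nn.
move: h1 h2; rewrite -(fineK fN) -(fineK (fP n.+1)).
rewrite -!EFinD !lee_fin ler_distlC => h1 h2.
by apply/andP; split; lra.
Qed.

End gev_blocks.

Theorem theorem1 (R : realType) (d : measure_display) (T : measurableType d)
  (P : probability T R) (r : nat) (mu sigma xi : R) (Y : nat -> nat -> T -> R) :
  (2 <= r)%N -> 0 < sigma ->
  (forall i j, measurable_fun setT (Y i j)) ->
  (forall i, is_gevr P r mu sigma xi (Y i)) ->
  independent_vectors P r Y ->
  cvg_in_distribution P (T_stat r mu sigma xi Y) (normal_prob 0 1).
Proof.
case: r => [|[|k]]// _ sigma0 mY gevY indepY; exact: T_stat_cvg.
Qed.
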